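(* Let $K=\mathbb{Z}[v^{\pm1}]$, $q=v^2$, $m\ge1$. For $w\in\Sigma_m\times\Sigma_m$ set $I_{wt_1}:=I_wb_1$. Then $\{I_x\mid x\in\Sigma_m\wr\Sigma_2\}$ is a standard basis of $\mathcal{A}(m)$, in the sense that $\overline{I_x}\in I_x+\sum_{y<x}\mathbb{Z}[v^{\pm1}]I_y$ for all $x\in\Sigma_m\wr\Sigma_2$, where $y<x$ refers to the Bruhat order inherited from $\Sigma_{2m}$.
   Context: $\mathcal{H}_q(\Sigma_{2m})$ is the $K$-algebra generated by $T_1,\dots,T_{2m-1}$ with type A braid relations and $T_i^2=(q-1)T_i+q$; $I_w:=v^{-\ell(w)}T_w$; the bar involution sends $v\mapsto v^{-1}$, $I_w\mapsto I_{w^{-1}}^{-1}$. $\Sigma_m\times\Sigma_m\subseteq\Sigma_{2m}$ is the Young subgroup generated by $s_i$, $i\ne m$; $t_1:=w_{m,m}\in\Sigma_{2m}$ sends $j\mapsto m+j$, $m+j\mapsto j$ ($1\le j\le m$); $\Sigma_m\wr\Sigma_2=(\Sigma_m\times\Sigma_m)\sqcup(\Sigma_m\times\Sigma_m)t_1\subseteq\Sigma_{2m}$. With $I_{a\to b}:=I_a\cdots I_b$ (indices decreasing if $a>b$, increasing if $a<b$), $I^+_{a\to b}=I_{a\to b}$, $I^-_{a\to b}=I_{b\to a}^{-1}$, $c_{m,0}=1$, $c_{m,i}=I_{m+i\to m+1}I_{m+1\to m+i}$, for $\epsilon\in\{\pm\}^m$ let $I_\epsilon:=I^{\epsilon_1}_{m\to2m-1}I^{\epsilon_2}_{m-1\to2m-2}\cdots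 I^{\epsilon_m}_{1\to m}$ and $C_\epsilon:=\prod_{i:\epsilon_i=-}c_{m,m-i}$. Let $H_1:=v^{m(2m-1)}\sum_\epsilon I_\epsilon C_\epsilon$, $\gamma:=\pi_m(I_{w_0^{(m)}})$ ($w_0^{(m)}$ longest in $\Sigma_m$, $\pi_m$ the shift $T_i\mapsto T_{i+m}$), and $b_1:=v^{-m(2m-1)}H_1\overline{\gamma}$. The Hu algebra $\mathcal{A}(m)$ is the subalgebra of $\mathcal{H}_q(\Sigma_{2m})$ generated by $T_i$ ($1\le i\le 2m-1$, $i\ne m$) and $H_1$. *)

(* Defs.v *)
(* Hecke algebra H_q(Sigma_n) over K = Z[v^{+-1}], realised inside
   the Hecke algebra over the field F = Frac(Z[v]). *)
From mathcomp Require Import all_boot all_order all_algebra fingroup perm.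
Set Implicit Arguments.
Unset Strict Implicit.
Unset Printing Implicit Defensive.
Import GRing.Theory.
Local Open Scope ring_scope.

Notation F := {fraction {poly int}}.

Definition v : F := tofrac ('X : {poly int}).
Definition q : F := v ^+ 2.

Definition isLaurent (x : F) : Prop :=
  exists (p : {poly int}) (k : nat), x = tofrac p / v ^+ k.

Definition ev_vinv (p : {poly int}) : F :=
  \sum_(i < size p) (p`_i)%:~R * (v^-1) ^+ i.

(* The ring involution of F with v |-> v^{-1}:  p/d |-> p(v^-1)/d(v^-1). *)
Definition sigma (x : F) : F :=
  let r := generic_quotient.repr x in ev_vinv (frac r).1 / ev_vinv (frac r).2.

(* The symmetric group Sigma_n = 'S_n acting on {0,..,n-1}; the point j of  *)
(* the paper (1 <= j <= n) is the ordinal j-1.  Group product is the one of  *)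
(* mathcomp ((s * t) x = t (s x)).                             *)

(* simple reflection s_i (1 <= i <= n-1): swaps the points i and i+1
   (0-based: i-1 and i); identity for indices out of range. *)
Definition sref (n : nat) (i : nat) : 'S_n :=
  match (insub i.-1 : option 'I_n), (insub i : option 'I_n) with
  | Some a, Some b => if (0 < i)%N then tperm a b else 1%g
  | _, _ => 1%g
  end.

Definition ell (n : nat) (w : 'S_n) : nat :=
  #|[set p : 'I_n * 'I_n | (p.1 < p.2)%N && (w p.2 < w p.1)%N]|.

Fixpoint rword_rec (n : nat) (k : nat) (w : 'S_n) : seq nat :=
  match k with
  | 0 => [::]
  | k'.+1 =>
      match [pick i : 'I_n | (0 < i)%N && (ell (w * sref n i)%g < ell w)%N] with
      | Some i => rcons (rword_rec k' (w * sref n i)%g) (val i)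
      | None => [::]
      end
  end.
Definition redword (n : nat) (w : 'S_n) : seq nat := rword_rec (ell w) w.

Definition bruhat_step (n : nat) : rel 'S_n :=
  fun u w => [exists a : 'I_n, exists b : 'I_n,
                [&& a != b, w == (u * tperm a b)%g & (ell u < ell w)%N]].
Definition bruhat_le (n : nat) (y x : 'S_n) : bool := connect (@bruhat_step n) y x.
Definition bruhat_lt (n : nat) (y x : 'S_n) : bool := bruhat_le y x && (y != x).

(* The Hecke algebra H_q(Sigma_n) over F, as the free F-module with basis   *)
(* T_w (w in Sigma_n), with the standard multiplication.                    *)
Definition hecke (n : nat) := {ffun 'S_n -> F^o}.

Definition T (n : nat) (w : 'S_n) : hecke n := [ffun x => (x == w)%:R].
Definition hone (n : nat) : hecke n := T 1%g.

Definition TmulS (n : nat) (w s : 'S_n) : hecke n :=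
  if (ell w < ell (w * s)%g)%N then T (w * s)%g
  else (q - 1) *: T w + q *: T (w * s)%g.

Definition rmulS (n : nat) (h : hecke n) (i : nat) : hecke n :=
  \sum_(w : 'S_n) h w *: TmulS w (sref n i).

Definition hmul (n : nat) (h1 h2 : hecke n) : hecke n :=
  \sum_(x : 'S_n) h2 x *: foldl (@rmulS n) h1 (redword x).

Definition hprod (n : nat) (s : seq (hecke n)) : hecke n := foldr (@hmul n) (hone n) s.

Definition Iw (n : nat) (w : 'S_n) : hecke n := v ^- ell w *: T w.
Definition Ig (n : nat) (i : nat) : hecke n := Iw (sref n i).
Definition Iginv (n : nat) (i : nat) : hecke n := Ig n i - (v - v^-1) *: hone n.

(* bar involution (h = sum_w h(w) T_w = sum_w h(w) v^{ell w} I_w): sum_w a_w I_w |-> sum_w sigma(a_w) I_{w^{-1}}^{-1}, where for a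
   reduced word w = s_{i1}...s_{ik}, I_{w^{-1}}^{-1} = I_{i1}^{-1} ... I_{ik}^{-1}. *)
Definition barI (n : nat) (w : 'S_n) : hecke n := hprod [seq Iginv n i | i <- redword w].
Definition hbar (n : nat) (h : hecke n) : hecke n :=
  \sum_(w : 'S_n) (sigma (h w * v ^+ ell w)) *: barI w.

Definition arrow (a b : nat) : seq nat :=
  if (b <= a)%N then [seq (a - j)%N | j <- iota 0 (a - b).+1]
  else [seq (a + j)%N | j <- iota 0 (b - a).+1].

(* I^+_{a->b} = I_{a->b},  I^-_{a->b} = (I_{b->a})^{-1} = I_a^{-1} ... I_b^{-1} *)
Definition Iarrow (n : nat) (eps : bool) (a b : nat) : hecke n :=
  if eps then hprod [seq Ig n i | i <- arrow a b]
  else hprod [seq Iginv n i | i <- arrow a b].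

Definition cmi (m i : nat) : hecke (m.*2) :=
  if i == 0%N then hone _
  else hmul (Iarrow _ true (m + i) m.+1) (Iarrow _ true m.+1 (m + i)).

(* eps : {ffun 'I_m -> bool}, eps k = true means eps_{k+1} = '+' *)
Definition Ieps (m : nat) (eps : {ffun 'I_m -> bool}) : hecke (m.*2) :=
  hprod [seq Iarrow _ (eps k) (m - k) (m.*2 - k.+1) | k <- enum 'I_m].

Definition Ceps (m : nat) (eps : {ffun 'I_m -> bool}) : hecke (m.*2) :=
  hprod (map (fun k : 'I_m => cmi m (m - k.+1)) (filter (fun k : 'I_m => ~~ eps k) (enum 'I_m))).

Definition H1 (m : nat) : hecke (m.*2) :=
  v ^+ (m * (m.*2).-1) *: \sum_(eps : {ffun 'I_m -> bool}) hmul (Ieps eps) (Ceps eps).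

(* pi_m(w_0^{(m)}): longest element of the second factor Sigma_m (points m+1..2m) *)
Definition w0shift_fun (m : nat) (j : 'I_(m.*2)) : 'I_(m.*2) :=
  if (j < m)%N then j
  else odflt j (insub (m.*2 + m - j.+1)%N).
Definition w0shift (m : nat) : 'S_(m.*2) :=
  odflt 1%g (insub [ffun j : 'I_(m.*2) => w0shift_fun j] : option 'S_(m.*2)).
Definition gamma (m : nat) : hecke (m.*2) := Iw (w0shift m).

Definition b1 (m : nat) : hecke (m.*2) :=
  v ^- (m * (m.*2).-1) *: hmul (H1 m) (hbar (gamma m)).

Definition t1_fun (m : nat) (j : 'I_(m.*2)) : 'I_(m.*2) :=
  odflt j (insub (if (j < m)%N then (j + m)%N else (j - m)%N)).
Definition t1 (m : nat) : 'S_(m.*2) := odflt 1%g (insub [ffun j : 'I_(m.*2) => t1_fun j] : option 'S_(m.*2)).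

(* Sigma_m x Sigma_m: permutations stabilising {1..m} (equivalently generated by
   the s_i, i <> m) *)
Definition young (m : nat) (w : 'S_(m.*2)) : bool :=
  [forall j : 'I_(m.*2), (w j < m)%N == (j < m)%N].
Arguments young : clear implicits.

Definition wreath (m : nat) (x : 'S_(m.*2)) : bool :=
  young m x || young m (x * (t1 m)^-1)%g.
Arguments wreath : clear implicits.

Definition Iwr (m : nat) (x : 'S_(m.*2)) : hecke (m.*2) :=
  if young m x then Iw x else hmul (Iw (x * (t1 m)^-1)%g) (b1 m).
Arguments Iwr : clear implicits.

Unset Implicit Arguments.
Inductive inHu (m : nat) : hecke (m.*2) -> Prop :=
  | Hu_T i : (1 <= i)%N -> (i <= (m.*2).-1)%N -> i != m -> inHu m (T (sref (m.*2) i))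
  | Hu_H1 : inHu m (H1 m)
  | Hu_one : inHu m (hone _)
  | Hu_add a b : inHu m a -> inHu m b -> inHu m (a + b)
  | Hu_scale (c : F) a : isLaurent c -> inHu m a -> inHu m (c *: a)
  | Hu_mul a b : inHu m a -> inHu m b -> inHu m (hmul a b).

(* Main.v *)
Require Import Defs.
From HB Require Import structures.
From mathcomp Require Import all_boot all_order all_algebra fingroup perm.
From mathcomp Require Import generic_quotient zify ring.
Set Implicit Arguments.
Unset Strict Implicit.
Unset Printing Implicit Defensive.
Import GRing.Theory.

(* Write h = v^{-m(2m-1)} H_1 and b_1 = h gamma^{-1}, where gamma = I_{w_0} for the longest
   element w_0 of the second factor.

   The element h satisfies h I_j = I_{j+m} h and h I_{m+j} = I_j h for 0 < j < m, and the bar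
   involution sends it to h gamma^{-2}, because gamma^2 is the product of the c_{m,k} and bar
   exchanges the two signs in each factor of I_epsilon. Hence bar b_1 = b_1, and triangularity
   of bar on the Young subgroup, multiplied by b_1, gives the last claim, since right
   multiplication by t_1 is length-additive on the Young subgroup and so preserves the Bruhat
   order there.

   For the span one needs h^2 in the Young subalgebra. The operator Lam, left linear for s_2,
   ..., s_{2m-1} and right linear for s_j, j <> m, satisfies with left multiplication by I_1 the
   type B braid relation; let L_{k+1} = I_k L_k I_k be its Jucys-Murphy operators. Then h = (L_m
   + 1) ... (L_1 + 1) I_{t_1}, whereas (L_{m+1} + 1) ... (L_1 + 1) kills I_{t_1}. So L_{m+1} h =
   -h, which says that (I^+_{1->m} + I^-_{1->m}) h lies in the image of 1 - Lam, and that image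
   is supported on the w with w(1) <= m. Following the recursive construction of h, the same
   support condition holds for h^2, and as h^2 commutes with the I_j, j <> m, its support is
   then contained in the Young subgroup.

   For independence, b_1 specialises at v = 1 to 2^m times a permutation outside the Young
   subgroup, so that the coefficients of a relation over Z[v, 1/v] are all divisible by v - 1,
   and by descent they vanish. *)

(** * Permutations as functions on nat *)

(** At v = 1 the operator [Lam] multiplies w by -1 if w(1) <= m and by 1 otherwise, so L_i becomes
    the sign that tells whether w(i) <= m, and (L_m + 1) ... (L_1 + 1) is 2^m times the projection
    onto the w that send 1, ..., m beyond m. With one more factor it vanishes by the pigeonhole
    principle, and L_{m+1} h = -h is the deformation of this fact. For general v, the value of [Lam]
    on I_1 ... I_m is the one for which L_{m+1}(1) = 1. Then L_{m+k+1}(1) = c_{m,k}, and the rule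
    L_j I_j = I_j^{-1} L_{j+1} creates both the negative words and the c_{m,k} of H_1. The obstacle
    is h^2, for which no formula is computed. The condition w(1) <= m survives left multiplication
    by I_j with j > 1 and right multiplication by I_j with j <> m; after its first step the
    recursion for h uses nothing else. All algebra is done over a field. Integrality enters through
    an abstract predicate [Lau] on scalars, instantiated by Laurent polynomials at the end. *)

Section PermAsNatFunction.
Variable n : nat.
Implicit Types (u w : 'S_n) (i j x y : nat).

(* Extended by the identity outside [0, n). *)
Definition pv u x : nat := oapp (fun o => val (u o)) x (insub x).

Lemma pv_ord u (o : 'I_n) : pv u o = u o.
Proof. by rewrite /pv valK. Qed.

Lemma pv_out u x : n <= x -> pv u x = x.
Proof. by move=> h; rewrite /pv insubN //= -leqNgt. Qed.

Lemma pv_lt u x : (pv u x < n) = (x < n).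
Proof.
case: (ltnP x n) => h; last by rewrite pv_out // ltnNge h.
by rewrite -[x]/(val (Ordinal h)) pv_ord ltn_ord.
Qed.

Lemma pv1 x : pv 1%g x = x.
Proof.
case: (ltnP x n) => h; last by rewrite pv_out.
by rewrite -[x in LHS]/(val (Ordinal h)) pv_ord perm1.
Qed.

Lemma pvM u w x : pv (u * w)%g x = pv w (pv u x).
Proof.
case: (ltnP x n) => h; last by rewrite !pv_out.
by rewrite -[x]/(val (Ordinal h)) !pv_ord permM.
Qed.

Lemma pvK u : cancel (pv u) (pv u^-1%g).
Proof. by move=> x; rewrite -pvM mulgV pv1. Qed.

Lemma pvVK u : cancel (pv u^-1%g) (pv u).
Proof. by move=> x; rewrite -pvM mulVg pv1. Qed.

Lemma pv_inj u : injective (pv u).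
Proof. exact: can_inj (pvK u). Qed.

Lemma pv_perm u w : (forall x, x < n -> pv u x = pv w x) -> u = w.
Proof.
by move=> h; apply/permP => o; apply/val_inj; rewrite /= -!pv_ord h.
Qed.

Lemma pvV_eq u x y : pv u x = y -> pv u^-1%g y = x.
Proof. by move<-; rewrite pvK. Qed.

Lemma srefP i : 0 < i < n ->
  exists a b : 'I_n, [/\ val a = i.-1, val b = i & sref n i = tperm a b].
Proof.
case/andP=> i0 hi; have hi' : i.-1 < n by lia.
exists (Ordinal hi'), (Ordinal hi); split=> //.
by rewrite /sref !insubT i0.
Qed.

Lemma pv_sref i x : 0 < i < n ->
  pv (sref n i) x = if x == i.-1 then i else if x == i then i.-1 else x.
Proof.
move=> hi; case: (ltnP x n) => h; last first.
  by rewrite pv_out //; case: (eqVneq x i.-1) => [|_]; first lia; case: (eqVneq x i); lia.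
have [a [b [ea eb ->]]] := srefP hi.
rewrite -[x]/(val (Ordinal h)) pv_ord permE /= -ea -eb.
rewrite -!(inj_eq val_inj) /=.
by case: (x == val a) => //; case: (x == val b).
Qed.

Lemma pv_srefl i : 0 < i < n -> pv (sref n i) i.-1 = i.
Proof. by move=> hi; rewrite pv_sref // eqxx. Qed.

Lemma pv_srefr i : 0 < i < n -> pv (sref n i) i = i.-1.
Proof. by move=> hi; rewrite pv_sref // eqxx; case: eqP. Qed.

Lemma pv_srefN i x : 0 < i < n -> x != i.-1 -> x != i -> pv (sref n i) x = x.
Proof. by move=> hi /negPf h1 /negPf h2; rewrite pv_sref // h1 h2. Qed.

Lemma sref_sq i : 0 < i < n -> (sref n i * sref n i = 1)%g.
Proof. by move=> /srefP [a [b [_ _ ->]]]; rewrite tperm2. Qed.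

Lemma srefV i : 0 < i < n -> (sref n i)^-1%g = sref n i.
Proof. by move=> /srefP [a [b [_ _ ->]]]; rewrite tpermV. Qed.

Lemma mul_srefK i u : 0 < i < n -> (u * sref n i * sref n i)%g = u.
Proof. by move=> hi; rewrite -mulgA sref_sq // mulg1. Qed.

Lemma sref_mulK i u : 0 < i < n -> (sref n i * (sref n i * u))%g = u.
Proof. by move=> hi; rewrite mulgA sref_sq // mul1g. Qed.

Lemma ellV u : ell u^-1%g = ell u.
Proof.
rewrite /ell -(card_imset _ (f := fun p : 'I_n * 'I_n => (u^-1%g p.2, u^-1%g p.1))).
  apply: eq_card => -[a b]; rewrite inE /=; apply/imsetP/andP.
    case=> -[c d]; rewrite inE /= => /andP[h1 h2] [-> ->].
    by rewrite h2 !permKV.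
  case=> h1 h2; exists (u b, u a); rewrite ?inE /= ?permK ?h1 ?h2 //.
by move=> [a b] [c d] /= [/perm_inj -> /perm_inj ->].
Qed.

Lemma ell1 : ell (1%g : 'S_n) = 0.
Proof.
apply/eqP; rewrite cards_eq0; apply/eqP/setP => -[a b].
by rewrite !inE !perm1 /=; lia.
Qed.

(** Products compose from left to right, so a right factor s_i swaps the values [i.-1] and [i]. As
    these are adjacent, the only pair whose order changes is that of their positions. *)
Lemma ell_mul_sref_up u i : 0 < i < n ->
  pv u^-1 i.-1 < pv u^-1 i -> ell (u * sref n i)%g = (ell u).+1.
Proof.
move=> hi; have [a [b [ea eb ->]]] := srefP hi; rewrite -ea -eb !pv_ord => hup.
have -> : (ell u).+1 = #|(u^-1%g a, u^-1%g b) |: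
   [set p : 'I_n * 'I_n | (p.1 < p.2)%N && (u p.2 < u p.1)%N]|.
  rewrite cardsU1 inE /= !permKV hup /= /ell; case: (ltnP b a) => //.
  by move: ea eb => /= -> ->; lia.
apply: eq_card => -[c d]; rewrite !inE !permM xpair_eqE /=.
have hK (e f : 'I_n) : (e == u^-1%g f) = (u e == f).
  by apply/eqP/eqP => [->|<-]; rewrite ?permK ?permKV.
have hV (e f : 'I_n) : (u e == f) -> val e = val (u^-1%g f).
  by move/eqP<-; rewrite permK.
rewrite !hK !permE /=.
have inj : (u c == u d) = (c == d) by rewrite (inj_eq perm_inj).
move: (hV c a) (hV d a) (hV c b) (hV d b) inj hup; rewrite -!(inj_eq val_inj) /=.
move: ea eb => /=.
case: (eqVneq (u c : nat) a); case: (eqVneq (u d : nat) a);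
  case: (eqVneq (u c : nat) b); case: (eqVneq (u d : nat) b) => //=; lia.
Qed.

Lemma ell_mul_sref_dn u i : 0 < i < n ->
  pv u^-1 i < pv u^-1 i.-1 -> (ell (u * sref n i)%g).+1 = ell u.
Proof.
move=> hi h; rewrite -[u in RHS](mul_srefK u hi).
rewrite [RHS]ell_mul_sref_up //.
by rewrite invMg srefV // !pvM pv_srefl // pv_srefr.
Qed.

Lemma pvV_neq u i : 0 < i < n -> pv u i.-1 != pv u i.
Proof. by move=> hi; rewrite (inj_eq (@pv_inj u)); lia. Qed.

Lemma ell_mul_sref_ltE u i : 0 < i < n ->
  (ell u < ell (u * sref n i)%g) = (pv u^-1 i.-1 < pv u^-1 i).
Proof.
move=> hi; have := pvV_neq u^-1 hi; case: (ltngtP (pv u^-1 i.-1)) => // h _.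
  by rewrite ell_mul_sref_up //; lia.
by have := ell_mul_sref_dn hi h; lia.
Qed.

Lemma ell_sref_mul_ltE u i : 0 < i < n ->
  (ell u < ell (sref n i * u)%g) = (pv u i.-1 < pv u i).
Proof.
move=> hi; rewrite -ellV -[X in _ < X]ellV invMg srefV //.
by rewrite ell_mul_sref_ltE // invgK.
Qed.

Lemma ell_mul_sref_gtE u i : 0 < i < n ->
  (ell (u * sref n i)%g < ell u) = (pv u^-1 i < pv u^-1 i.-1).
Proof.
move=> hi; have := pvV_neq u^-1 hi; case: (ltngtP (pv u^-1 i.-1)) => // h _.
  by rewrite ell_mul_sref_up //; lia.
by have := ell_mul_sref_dn hi h; lia.
Qed.

Lemma ell_sref i : 0 < i < n -> ell (sref n i) = 1.
Proof.
move=> hi; rewrite -[sref n i]mul1g ell_mul_sref_up ?ell1 //.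
by rewrite invg1 !pv1; lia.
Qed.

Lemma no_descent u : (forall i, 0 < i < n -> pv u i.-1 < pv u i) -> u = 1%g.
Proof.
move=> h; apply: pv_perm => x; rewrite pv1.
have lo y : y < n -> y <= pv u y.
  by elim: y => // y IH hy; have := h y.+1; rewrite hy /= => /(_ isT); have := IH; lia.
have hi k : k < n -> pv u (n - k.+1) <= n - k.+1.
  elim: k => [|k IH] hk; first by (have : pv u (n - 1) < n by rewrite pv_lt; lia); lia.
  have := h (n - k.+1); have -> : (n - k.+1).-1 = n - k.+2 by lia.
  by have := IH; lia.
move=> hx; have := lo x hx; have := hi (n - x.+1).
have -> : n - (n - x.+1).+1 = x by lia.
lia.
Qed.

Lemma perm_descent u : u != 1%g ->
  exists2 i, 0 < i < n & pv u^-1 i < pv u^-1 i.-1.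
Proof.
move=> u1; case: (boolP [exists i : 'I_n, (0 < i) && (pv u^-1 i < pv u^-1 i.-1)]).
  by case/existsP=> i /andP[h1 h2]; exists (val i) => //; rewrite h1 ltn_ord.
rewrite negb_exists => /forallP h; case/negP: u1; rewrite -invg_eq1.
apply/eqP/no_descent => i hi; case/andP: (hi) => i0 hi'.
have := h (Ordinal hi') ; rewrite /= i0 /= -leqNgt ltn_neqAle => ->.
by rewrite (pvV_neq _ hi).
Qed.

(** [pick] may choose another descent than the one at hand, but every descent lowers the length by
    exactly one, so the fuel left over is the length of the shorter element. *)
Lemma redword_rcons u : u != 1%g ->
  exists i, [/\ 0 < i < n, ell u = (ell (u * sref n i)%g).+1 &
    redword u = rcons (redword (u * sref n i)%g) i].
Proof.
move=> u1; have [i0 hi0 hd0] := perm_descent u1.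
have := ell_mul_sref_dn hi0 hd0 => hl.
rewrite /redword -hl /=; case: pickP => [i /andP[i1 hi]|]; last first.
  have hi0' : i0 < n by lia.
  by move/(_ (Ordinal hi0')); rewrite /= -hl ltnSn; lia.
have hin : 0 < i < n by rewrite i1 ltn_ord.
move: (hi); rewrite ell_mul_sref_gtE // => /(ell_mul_sref_dn hin) hh.
have e : ell (u * sref n i0)%g = ell (u * sref n i)%g by apply: succn_inj; rewrite hl hh.
by exists (val i); split=> //; rewrite e // hl e.
Qed.

Lemma redword1 : redword (1%g : 'S_n) = [::].
Proof. by rewrite /redword ell1. Qed.

(** Induction along the fixed reduced words: the equation on [redword] serves products over
    [redword], and the inequality on [pv] says that the letter lengthens [u]. *)
Lemma perm_ind (Q : 'S_n -> Prop) : Q 1%g ->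
  (forall u i, 0 < i < n -> pv u^-1 i.-1 < pv u^-1 i ->
     redword (u * sref n i)%g = rcons (redword u) i -> Q u -> Q (u * sref n i)%g) ->
  forall u, Q u.
Proof.
move=> Q1 QS u; have [k] := ubnP (ell u); elim: k u => // k IH u hk.
have [->//|u1] := eqVneq u 1%g.
have [i [hi hl hr]] := redword_rcons u1.
rewrite -(mul_srefK u hi); apply: QS => //.
- by rewrite -ell_mul_sref_ltE // mul_srefK // hl.
- by rewrite mul_srefK.
- by apply: IH; lia.
Qed.

End PermAsNatFunction.

Lemma sref_conj n (w : 'S_n) i j : (0 < i < n)%N -> (0 < j < n)%N ->
  pv w i.-1 = j.-1 /\ pv w i = j \/ pv w i.-1 = j /\ pv w i = j.-1 ->
  (sref n i * w = w * sref n j)%g.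
Proof.
move=> hi hj H; apply: pv_perm => x hx; rewrite !pvM.
have [->|x1] := eqVneq x i.-1.
  by rewrite pv_srefl //; case: H => -[-> ->]; rewrite ?pv_srefl ?pv_srefr.
have [->|x2] := eqVneq x i.
  by rewrite pv_srefr //; case: H => -[-> ->]; rewrite ?pv_srefl ?pv_srefr.
have y1 : pv w x != pv w i.-1 by rewrite (inj_eq (@pv_inj _ w)).
have y2 : pv w x != pv w i by rewrite (inj_eq (@pv_inj _ w)).
by rewrite !pv_srefN //; case: H y1 y2 => -[-> ->].
Qed.

(** Whether s_j lengthens w is read off from the order of the preimages of j-1 and j. A left factor
    s_i alters this order only if the two preimages are i-1 and i, which is the excluded
    equality. *)
Lemma ell_sref_mul_sref n (w : 'S_n) i j : (0 < i < n)%N -> (0 < j < n)%N ->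
  (sref n i * w != w * sref n j)%g ->
  (ell (sref n i * w) < ell (sref n i * w * sref n j)%g)%N = (ell w < ell (w * sref n j)%g)%N.
Proof.
move=> hi hj H; rewrite !ell_mul_sref_ltE // invMg srefV // !pvM !pv_sref //.
have neq := pvV_neq w^-1 hj.
have H1 : ~ (pv w^-1 j.-1 = i.-1 /\ pv w^-1 j = i).
  move=> [e1 e2]; case/eqP: H; apply: sref_conj => //; left.
  by rewrite -e1 -e2 !pvVK.
have H2 : ~ (pv w^-1 j.-1 = i /\ pv w^-1 j = i.-1).
  move=> [e1 e2]; case/eqP: H; apply: sref_conj => //; right.
  by rewrite -{2}e1 -e2 !pvVK.
move: H1 H2 neq; set a := pv _ _; set b := pv _ _ => H1 H2 neq.
case: (eqVneq a i.-1); case: (eqVneq b i.-1); case: (eqVneq a i); case: (eqVneq b i); lia.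
Qed.

(** * Bruhat order *)

Section Bruhat.
Variable n : nat.
Implicit Types (w u y : 'S_n) (a b c : 'I_n).
Notation s := (sref n).

Lemma sref_tperm a b : val b = (val a).+1 -> s b = tperm a b.
Proof.
move=> e; have hb : 0 < b < n by rewrite ltn_ord andbT; move: e => /= ->.
have [a' [b' [ea eb ->]]] := srefP hb.
by congr tperm; apply: val_inj; rewrite /= ?ea ?eb //; move: e => /= ->.
Qed.

Lemma ell_mul_sref_ge u i : 0 < i < n -> ell u <= (ell (u * s i)%g).+1.
Proof.
move=> hi; have := pvV_neq u^-1 hi; rewrite neq_ltn => /orP[h|h].
  by rewrite ell_mul_sref_up //; lia.
by rewrite -(ell_mul_sref_dn hi h).
Qed.

Lemma ell_mul_sref_le u i : 0 < i < n -> ell (u * s i)%g <= (ell u).+1.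
Proof. by move=> hi; have := ell_mul_sref_ge (u * s i)%g hi; rewrite mul_srefK. Qed.

Lemma ell_tperm_up u a b : a < b -> u^-1%g a < u^-1%g b -> ell u < ell (u * tperm a b)%g.
Proof.
have [d] := ubnP (b - a); elim: d u a b => // d IH u a b hd lab hu.
have b0 : 0 < b < n by rewrite ltn_ord andbT; lia.
have [e|ne] := eqVneq (val b) (val a).+1.
  rewrite -(sref_tperm e) ell_mul_sref_ltE //.
  have -> : b.-1 = val a by move: e => /=; lia.
  by rewrite !pv_ord.
have hc : b.-1 < n by move: b0; lia.
pose c := Ordinal hc; have e : val b = (val c).+1 by rewrite /=; lia.
have sE := sref_tperm e.
have sa : s b a = a by rewrite sE tpermD // -(inj_eq val_inj) /=; move: ne => /=; lia.
have sc : s b c = b by rewrite sE tpermL.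
have sb : s b b = c by rewrite sE tpermR.
(* Conjugation by s_b replaces the endpoint b by b-1, so the induction on b - a applies to the
   middle factor. *)
have tE : tperm a b = (s b * tperm a c * s b)%g.
  have := tpermJ a c (s b); rewrite sa sc /conjg srefV // => <-.
  by rewrite mulgA.
rewrite tE !mulgA; set u1 := (u * s b)%g; set u2 := (u1 * tperm a c)%g.
have V1 x : u1^-1%g x = u^-1%g (s b x) by rewrite invMg srefV // permM.
have lac : a < c by move: ne => /=; lia.
have l12 : ell u1 < ell u2.
  apply: IH => //; last by rewrite !V1 sa sc.
  by rewrite -[nat_of_ord c]/(b.-1); lia.
have pc : pv u^-1 b.-1 = u^-1%g c by rewrite -pv_ord.
have := pvV_neq u^-1 b0; rewrite neq_ltn pc pv_ord.
case/orP=> h.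
  have e1 : ell u1 = (ell u).+1 by rewrite ell_mul_sref_up // pc pv_ord.
  by rewrite -ltnS; apply: leq_trans (ell_mul_sref_ge u2 b0); rewrite -e1.
have e1 : (ell u1).+1 = ell u by rewrite ell_mul_sref_dn // pc pv_ord.
have e2 : ell (u2 * s b)%g = (ell u2).+1.
  rewrite ell_mul_sref_up // -[b.-1]/(nat_of_ord c) !pv_ord /u2 invMg tpermV !permM tpermR.
  rewrite tpermD ?V1 ?sa ?sb //; last 2 first.
  - by rewrite -(inj_eq val_inj) /=; move: ne => /=; lia.
  - by rewrite -(inj_eq val_inj) /=; lia.
  by apply: ltn_trans h.
by rewrite e2; lia.
Qed.

Lemma bruhat_stepP u w : reflect
  (exists a b, [/\ a < b, u^-1%g a < u^-1%g b & w = (u * tperm a b)%g]) (bruhat_step u w).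
Proof.
apply: (iffP existsP) => [[a /existsP[b /and3P[ab /eqP-> lt]]]|[a [b [ab hu ->]]]]; last first.
  exists a; apply/existsP; exists b; rewrite eqxx ell_tperm_up //= andbT.
  by rewrite -(inj_eq val_inj) /=; lia.
wlog ltab : a b ab lt / a < b.
  move=> W; move: (ab); rewrite -(inj_eq val_inj) neq_ltn => /orP[h|h]; first exact: (W a b).
  by rewrite tpermC; apply: (W b a); rewrite 1?eq_sym // tpermC.
exists a, b; split=> //; rewrite ltnNge; apply/negP => h.
have h' : u^-1%g b < u^-1%g a.
  by rewrite ltn_neqAle h andbT (inj_eq val_inj) (inj_eq perm_inj) eq_sym.
have := @ell_tperm_up (u * tperm a b)%g a b ltab.
rewrite invMg tpermV !permM tpermL tpermR => /(_ h').
by rewrite -mulgA tperm2 mulg1; lia.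
Qed.

(** Multiplying both ends of a step by s_i conjugates its reflection by s_i. The order of the two
    points swapped, hence the direction of the step, survives unless the reflection is s_i
    itself. *)
Lemma bruhat_step_sref u w i : 0 < i < n -> bruhat_step u w ->
  w = (u * s i)%g \/ bruhat_step (u * s i)%g (w * s i)%g.
Proof.
move=> hi /bruhat_stepP[a [b [ab hu ew]]].
case: (boolP ((val a == i.-1) && (val b == i))) => [/andP[/eqP ea /eqP eb]|hab].
  have e : s b = tperm a b by apply: sref_tperm; rewrite eb ea prednK //; case/andP: hi.
  by left; rewrite ew -e -eb.
right; apply/bruhat_stepP; exists (s i a), (s i b); split.
- rewrite -!pv_ord !pv_sref //; move: hab ab; rewrite /=.
  by case: (eqVneq (a : nat) i.-1); case: (eqVneq (a : nat) i);
    case: (eqVneq (b : nat) i.-1); case: (eqVneq (b : nat) i) => //=; lia.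
- have ss x : s i (s i x) = x by rewrite -permM sref_sq // perm1.
  by rewrite invMg srefV // !permM !ss.
- by rewrite ew -tpermJ /conjg srefV // !mulgA mul_srefK.
Qed.

Lemma bruhat_le_refl u : bruhat_le u u. Proof. exact: connect0. Qed.

Lemma bruhat_le_trans u w y : bruhat_le u w -> bruhat_le w y -> bruhat_le u y.
Proof. exact: connect_trans. Qed.

(** The lifting property: the chain is multiplied by s_i step by step until a step by s_i itself is
    met, if there is one. *)
Lemma bruhat_le_sref_or y w i : 0 < i < n -> bruhat_le y w ->
  bruhat_le (y * s i)%g (w * s i)%g \/ bruhat_le (y * s i)%g w.
Proof.
move=> hi /connectP[p hp ->]; elim: p y hp => [|u p IH] y /=; first by left; apply: connect0.
case/andP=> /(bruhat_step_sref hi) h hp; case: h => [e|h].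
  by right; rewrite -e; apply/connectP; exists p.
by case: (IH u hp) => h2; [left|right]; apply: connect_trans h2; apply: connect1.
Qed.

Lemma bruhat_le_up u i : 0 < i < n -> ell u < ell (u * s i)%g -> bruhat_le u (u * s i)%g.
Proof.
move=> hi h; apply: connect1; have [a [b [ea eb e]]] := srefP hi.
apply/existsP; exists a; apply/existsP; exists b; rewrite e eqxx -e h andbT.
by rewrite -(inj_eq val_inj) ea eb; lia.
Qed.

Lemma bruhat_le_mul_sref y w i : 0 < i < n -> ell w < ell (w * s i)%g ->
  bruhat_le y w -> bruhat_le (y * s i)%g (w * s i)%g.
Proof.
move=> hi hw /(bruhat_le_sref_or hi) [//|h].
by apply: bruhat_le_trans h _; apply: bruhat_le_up.
Qed.

Lemma bruhat_le_ell y w : bruhat_le y w -> ell y <= ell w.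
Proof.
case/connectP=> p hp ->; elim: p y hp => //= u p IH y /andP[h hp].
apply: leq_trans (IH _ hp); case/existsP: h => a /existsP[b /and3P[_ _ h]].
exact: ltnW.
Qed.

Lemma ell_mul_le w x : ell (w * x)%g <= ell w + ell x.
Proof.
elim/perm_ind: x => [|x i hi hup _ IH]; first by rewrite mulg1 ell1 addn0.
rewrite mulgA (ell_mul_sref_up hi hup) addnS.
by apply: leq_trans (ell_mul_sref_le _ hi) _.
Qed.

Lemma bruhat_le_mul y w x : ell (w * x)%g = ell w + ell x ->
  bruhat_le y w -> bruhat_le (y * x)%g (w * x)%g.
Proof.
elim/perm_ind: x => [|x i hi hup _ IH]; first by rewrite !mulg1.
rewrite !mulgA (ell_mul_sref_up hi hup) addnS => e hy.
have h1 := ell_mul_sref_le (w * x)%g hi; have h2 := ell_mul_le w x.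
have e1 : ell (w * x)%g = ell w + ell x by apply/eqP; rewrite eqn_leq h2 -ltnS -e.
by apply: bruhat_le_mul_sref => //; [rewrite e e1|apply: IH].
Qed.

(** No inversion of [w] is undone by [x], so the inversions of the product are those of [w] together
    with those of [x] pulled back along [w]. *)
Lemma ell_mul_add w (x : 'S_n) : (forall p q : 'I_n, p < q -> w q < w p -> x (w q) < x (w p)) ->
  ell (w * x)%g = ell w + ell x.
Proof.
move=> h; pose B := [set p : 'I_n * 'I_n | [&& p.1 < p.2, w p.1 < w p.2 & x (w p.2) < x (w p.1)]].
pose f (p : 'I_n * 'I_n) := (w p.1, w p.2).
have fi : injective f by move=> [p1 p2] [q1 q2] [/perm_inj -> /perm_inj ->].
have eB : ell x = #|B|.
  rewrite -(card_imset _ fi); apply: eq_card => -[c d]; rewrite inE /=.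
  apply/andP/imsetP => [[h1 h2]|[[p q]]]; last first.
    by rewrite inE /= => /and3P[h1 h2 h3] [-> ->].
  exists (w^-1%g c, w^-1%g d); last by rewrite /f /= !permKV.
  rewrite inE /= !permKV h1 h2 andbT andbT ltnNge; apply/negP => h3.
  have h4 : w^-1%g d < w^-1%g c.
    rewrite ltn_neqAle h3 andbT (inj_eq val_inj) (inj_eq perm_inj).
    by rewrite -(inj_eq val_inj) /=; lia.
  by have := h _ _ h4; rewrite !permKV => /(_ h1); lia.
rewrite eB /ell -cardsUI [X in _ = _ + X](_ : _ = 0) ?addn0; last first.
  by apply/eqP; rewrite cards_eq0; apply/eqP/setP => -[p q]; rewrite !inE /=; lia.
apply: eq_card => -[p q]; rewrite !inE !permM /=.
case: (ltnP p q) => //= pq.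
have := h p q pq; have : w p != w q :> nat by rewrite (inj_eq val_inj) (inj_eq perm_inj) -(inj_eq val_inj) /=; lia.
by case: ltngtP => //= _ _ ->.
Qed.

End Bruhat.

Local Open Scope ring_scope.

(** * The Hecke algebra over an arbitrary field *)

(* The parameter [v] is part of the type because the product depends on it. *)
Definition heckeA (K : fieldType) (v : K) n : Type := {ffun 'S_n -> K^o}.

HB.instance Definition _ (K : fieldType) (v : K) n := GRing.Lmodule.on (heckeA v n).

Section Hecke.
Variables (K : fieldType) (v : K) (n : nat).
Notation H := (heckeA v n).
Implicit Types (w u : 'S_n) (h : H).
Notation s := (sref n).

Definition gT w : H := [ffun x => (x == w)%:R].
Notation T := gT.

Definition gTmulS w t : H :=
  if (ell w < ell (w * t)%g)%N then T (w * t)%g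
  else (v ^+ 2 - 1) *: T w + v ^+ 2 *: T (w * t)%g.

Lemma ffE h1 h2 w : (h1 + h2) w = h1 w + h2 w. Proof. exact: ffunE. Qed.
Lemma ffZ c h w : (c *: h) w = c * h w. Proof. exact: ffunE. Qed.
Lemma ff0 w : (0 : H) w = 0. Proof. exact: ffunE. Qed.
Lemma ffN h w : (- h) w = - h w. Proof. exact: ffunE. Qed.
Lemma ffsum I (r : seq I) (P : pred I) (f : I -> H) w :
  (\sum_(i <- r | P i) f i) w = \sum_(i <- r | P i) f i w.
Proof. by elim/big_rec2: _ => [|i x y _ <-]; rewrite ?ff0 ?ffE. Qed.
Lemma TE w u : T w u = (u == w)%:R. Proof. exact: ffunE. Qed.

Lemma heckeE h : h = \sum_w h w *: T w.
Proof.
apply/ffunP => u; rewrite ffsum (bigD1 u) //= ffZ TE eqxx mulr1.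
rewrite big1 ?addr0 // => w hw; rewrite ffZ TE eq_sym (negPf hw) mulr0 //.
Qed.

Definition lext (V : lmodType K) (f : 'S_n -> V) h : V := \sum_w (h w : K) *: f w.

Lemma lext_is_linear (V : lmodType K) (f : 'S_n -> V) : linear (lext f).
Proof.
move=> c x y; rewrite /lext scaler_sumr -big_split; apply: eq_bigr => w _ /=.
by rewrite ffE ffZ scalerDl scalerA.
Qed.

HB.instance Definition _ (V : lmodType K) (f : 'S_n -> V) :=
  GRing.isLinear.Build K (H) V _ (lext f) (@lext_is_linear V f).

Lemma lextT (V : lmodType K) (f : 'S_n -> V) w : lext f (T w) = f w.
Proof.
rewrite /lext (bigD1 w) //= TE eqxx scale1r big1 ?addr0 // => u hu.
by rewrite TE (negPf hu) scale0r.
Qed.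

Lemma eq_linear (V : lmodType K) (f g : {linear H -> V}) :
  (forall w, f (T w) = g (T w)) -> f =1 g.
Proof.
move=> e h; rewrite (heckeE h) !linear_sum; apply: eq_bigr => w _.
by rewrite !linearZ e.
Qed.

Definition rm i : H -> H := lext (fun w => gTmulS w (s i)).
HB.instance Definition _ i := GRing.Linear.on (rm i).
Definition star : H -> H := lext (fun w => T w^-1%g).
HB.instance Definition _ := GRing.Linear.on star.
(** Left multiplication by T_{s_i}, obtained from the right one through the anti-involution, so that
    it is available before the product is. *)
Definition lm i h := star (rm i (star h)).
HB.instance Definition _ i := GRing.Linear.copy (lm i) (star \o rm i \o star).

Lemma starT w : star (T w) = T w^-1%g. Proof. exact: lextT. Qed.
Lemma starK : involutive star.
Proof. by apply: (@eq_linear _ (star \o star) idfun) => w /=; rewrite !starT invgK. Qed.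

(** The flag is true when the letter s lengthens w; [cA] and [cB] are the coefficients of T_w and
    T_{ws} in T_w T_s. *)
Definition cA (b : bool) : K := if b then 0 else v ^+ 2 - 1.
Definition cB (b : bool) : K := if b then 1 else v ^+ 2.

Lemma rmT i w : rm i (T w) =
  cA (ell w < ell (w * s i)%g)%N *: T w + cB (ell w < ell (w * s i)%g)%N *: T (w * s i)%g.
Proof. by rewrite /rm lextT /gTmulS /cA /cB; case: ifP => _; rewrite ?scale0r ?add0r ?scale1r. Qed.

Lemma lmT i w : (0 < i < n)%N -> lm i (T w) =
  cA (ell w < ell (s i * w)%g)%N *: T w + cB (ell w < ell (s i * w)%g)%N *: T (s i * w)%g.
Proof.
move=> hi; rewrite /lm starT rmT linearD !linearZ /= !starT invgK.
by rewrite -[ell (w^-1 * _)%g]ellV invMg invgK srefV // ellV.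
Qed.

(** If s_i w = w s_j, both operators act in the same way on T_w and T_{w s_j}. Otherwise
    [ell_sref_mul_sref] makes the length comparison on one side independent of the multiplication on
    the other. *)
Lemma rm_lmC i j h : (0 < i < n)%N -> (0 < j < n)%N -> rm j (lm i h) = lm i (rm j h).
Proof.
move=> hi hj; apply: (@eq_linear _ (rm j \o lm i) (lm i \o rm j)) => w /=.
have [e|ne] := eqVneq (s i * w)%g (w * s j)%g.
  have e1 : lm i (T w) = rm j (T w) by rewrite rmT lmT // e.
  have e2 : lm i (T (w * s j)%g) = rm j (T (w * s j)%g).
    have e3 : (s i * (w * s j))%g = w by rewrite -e sref_mulK.
    by rewrite rmT lmT // e3 mul_srefK.
  by rewrite e1 [in LHS]rmT [in RHS]rmT !linearD !linearZ /= e1 e2.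
have h1 := ell_sref_mul_sref hi hj ne.
have h2 : (ell (w * s j)%g < ell (s i * (w * s j))%g)%N = (ell w < ell (s i * w)%g)%N.
  have ne' : (s j * w^-1 != w^-1 * s i)%g.
    apply: contraNneq ne => /(congr1 invg).
    by rewrite !invMg !srefV // invgK => ->.
  have := ell_sref_mul_sref hj hi ne'.
  rewrite -[ell (_ * _ * _)%g]ellV -[ell (s j * _)%g]ellV -[ell (_ * s i)%g]ellV.
  by rewrite !invMg !srefV // !invgK ellV.
rewrite lmT // rmT !linearD !linearZ /= !lmT // !rmT h1 h2 !mulgA.
rewrite !scalerDr !scalerA !addrA; congr (_ + _); last by rewrite mulrC.
rewrite -!addrA; congr (_ + _); first by rewrite mulrC.
by rewrite addrC; congr (_ *: _ + _ *: _); rewrite mulrC.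
Qed.

End Hecke.

Section HeckeRing.
Variables (K : fieldType) (v : K) (n : nat).
Notation H := (heckeA v n).
Implicit Types (w u : 'S_n) (h a b c : H).
Notation T := (gT v).
Notation s := (sref n).

Definition rmw (t : seq nat) h : H := foldl (fun x i => rm i x) h t.

Lemma rmw_is_linear t : linear (rmw t).
Proof. by elim: t => [|i t IH] c x y //=; rewrite /rmw /= linearP; exact: IH. Qed.
HB.instance Definition _ t := GRing.isLinear.Build K (H) (H) _ (rmw t) (@rmw_is_linear t).

Lemma rmw_rcons t i h : rmw (rcons t i) h = rm i (rmw t h).
Proof. by rewrite /rmw foldl_rcons. Qed.

Lemma rmw_redword w : rmw (redword w) (T 1%g) = T w.
Proof.
elim/perm_ind: w => [|w i hi hup hr IH]; first by rewrite redword1.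
rewrite hr rmw_rcons IH rmT ell_mul_sref_ltE // hup.
by rewrite scale0r add0r scale1r.
Qed.

(** It uses the same fixed reduced words as [hmul], so that the two products are convertible
    ([hmul_bridge]) and the ring structure transfers at no cost. *)
Definition hecke_mul a b : H := lext (fun x => rmw (redword x) a) b.

Lemma hmulE a b : hecke_mul a b = lext (fun x => rmw (redword x) a) b.
Proof. by []. Qed.

Definition mulr_of b a : H := hecke_mul a b.

Lemma mulr_of_is_linear b : linear (mulr_of b).
Proof.
move=> c x y; rewrite /mulr_of /hecke_mul /lext scaler_sumr -big_split; apply: eq_bigr => w _ /=.
by rewrite linearP scalerDr !scalerA mulrC.
Qed.
HB.instance Definition _ b := GRing.isLinear.Build K (H) (H) _ (mulr_of b) (@mulr_of_is_linear b).

Lemma lm_up w i : (0 < i < n)%N -> (pv w i.-1 < pv w i)%N -> lm i (T w) = T (s i * w)%g.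
Proof.
move=> hi hup; rewrite lmT // ell_sref_mul_ltE // hup.
by rewrite scale0r add0r scale1r.
Qed.

(* The left multiplications generate everything from 1, so an operator commuting with them is
   determined by its value at 1; associativity of [hecke_mul] follows without Matsumoto's
   theorem. *)
Lemma lm_ext (f g : {linear H -> H}) :
  (forall i h, (0 < i < n)%N -> f (lm i h) = lm i (f h)) ->
  (forall i h, (0 < i < n)%N -> g (lm i h) = lm i (g h)) ->
  f (T 1%g) = g (T 1%g) -> f =1 g.
Proof.
move=> hf hg e; apply: eq_linear => w; rewrite -[w]invgK.
elim/perm_ind: w^-1%g => {w} [|w i hi hup _ IH]; first by rewrite invg1.
by rewrite invMg srefV // -lm_up // hf // hg // IH.
Qed.

Lemma mulr_of_lm b i h : (0 < i < n)%N -> mulr_of b (lm i h) = lm i (mulr_of b h).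
Proof.
move=> hi; rewrite /mulr_of !hmulE /lext linear_sum; apply: eq_bigr => w _.
rewrite linearZ; congr (_ *: _) => /=; case: (elimT andP hi) => i0 hi'.
elim/perm_ind: w => [|w j hj hup hr IH]; first by rewrite redword1.
by rewrite hr !rmw_rcons IH rm_lmC.
Qed.

Lemma hmul1l b : hecke_mul (T 1%g) b = b.
Proof. by rewrite hmulE [in RHS](heckeE b); apply: eq_bigr => w _; rewrite rmw_redword. Qed.

Lemma hmul1r a : hecke_mul a (T 1%g) = a.
Proof. by rewrite hmulE lextT redword1. Qed.

Lemma hmulA a b c : hecke_mul a (hecke_mul b c) = hecke_mul (hecke_mul a b) c.
Proof.
apply: (@lm_ext (mulr_of (hecke_mul b c)) (mulr_of c \o mulr_of b)).
- by move=> i h hi; exact: mulr_of_lm.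
- move=> i h hi; rewrite -[LHS]/(mulr_of c (mulr_of b (lm i h))) !mulr_of_lm //.
- by rewrite /= /mulr_of !hmul1l.
Qed.

Lemma hmulDl : left_distributive (hecke_mul) +%R.
Proof. by move=> a b c; exact: (linearD (mulr_of c)). Qed.

Lemma hmulDr : right_distributive (hecke_mul) +%R.
Proof. by move=> a b c; rewrite !hmulE linearD. Qed.

Lemma hone_neq0 : (T 1%g : H) != 0.
Proof. by apply/eqP => /ffunP /(_ 1%g) /eqP; rewrite TE ff0 eqxx oner_eq0. Qed.

HB.instance Definition _ := GRing.Zmodule_isNzRing.Build (H)
  hmulA hmul1l hmul1r hmulDl hmulDr hone_neq0.

Lemma hscalerAl (k : K) a b : k *: (a * b) = (k *: a) * b.
Proof. by rewrite -[RHS]/(mulr_of b (k *: a)) linearZ. Qed.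
HB.instance Definition _ := GRing.Lmodule_isLalgebra.Build K (H) hscalerAl.

Lemma hscalerAr (k : K) a b : k *: (a * b) = a * (k *: b).
Proof. by rewrite -[RHS]/(hecke_mul a (k *: b)) hmulE linearZ. Qed.
HB.instance Definition _ := GRing.Lalgebra_isAlgebra.Build K (H) hscalerAr.

Lemma T1 : T 1%g = 1. Proof. by []. Qed.

Lemma mul_Ts i a : (0 < i < n)%N -> a * T (s i) = rm i a.
Proof.
move=> hi; apply: (@lm_ext (mulr_of (T (s i))) (rm i)).
- by move=> j h hj; exact: mulr_of_lm.
- by move=> j h hj; exact: rm_lmC.
- rewrite /= /mulr_of hmul1l rmT ell_mul_sref_ltE // invg1 !pv1 mul1g.
  have -> : (i.-1 < i)%N by lia.
  by rewrite scale0r add0r scale1r.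
Qed.

Lemma mul_sT i a : (0 < i < n)%N -> T (s i) * a = lm i a.
Proof.
move=> hi; have := mulr_of_lm a (T 1%g) hi; rewrite lm_up ?mulg1 //; last by rewrite !pv1; lia.
by rewrite /mulr_of hmul1l.
Qed.

Lemma mul_T_up w i : (0 < i < n)%N -> (pv w^-1 i.-1 < pv w^-1 i)%N -> T w * T (s i) = T (w * s i)%g.
Proof.
move=> hi hup; rewrite mul_Ts // rmT ell_mul_sref_ltE // hup.
by rewrite scale0r add0r scale1r.
Qed.

Lemma starD a b : star (a + b) = star a + star b. Proof. exact: linearD. Qed.
Lemma starZ (k : K) a : star (k *: a) = k *: star a. Proof. exact: linearZ. Qed.

Lemma star1 : star 1 = 1 :> H.
Proof. by rewrite -T1 starT invg1. Qed.

Lemma star_rm i h : (0 < i < n)%N -> star (rm i h) = lm i (star h).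
Proof. by move=> hi; rewrite /lm starK. Qed.

Lemma starM a b : star (a * b) = star b * star a.
Proof.
have -> : star (a * b) = lext (fun w => star (a * T w)) b.
  by rewrite /lext [in LHS](heckeE b) mulr_sumr linear_sum; apply: eq_bigr => w _; rewrite -scalerAr linearZ.
rewrite [in RHS](heckeE b) linear_sum mulr_suml; apply: eq_bigr => w _.
rewrite linearZ -scalerAl; congr (_ *: _) => /=.
elim/perm_ind: w => [|w i hi hup _ IH]; first by rewrite T1 mulr1 star1 mul1r.
rewrite -mul_T_up // mulrA mul_Ts // star_rm // IH -mul_sT // mulrA.
by rewrite mul_Ts // star_rm // -mul_sT.
Qed.

End HeckeRing.

(** * Normalised basis and generators *)

Section Generators.
Variables (K : fieldType) (v : K) (n : nat).
Hypothesis v0 : v != 0.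
Notation H := (heckeA v n).
Implicit Types (w u : 'S_n) (h a b c x y : H).
Notation T := (gT v).
Notation s := (sref n).

Definition kap : K := v - v^-1.
(* Locked: otherwise rewriting with laws of scalar multiplication unfolds [g]. *)
Definition gIw w : H := locked (v ^- ell w *: T w).
Definition g i : H := locked (gIw (s i)).

Lemma gIwE w : gIw w = v ^- ell w *: T w. Proof. by rewrite /gIw -lock. Qed.
Lemma gIw_sref i : gIw (s i) = g i. Proof. by rewrite /g -lock. Qed.

Lemma gIw1 : gIw 1%g = 1.
Proof. by rewrite gIwE ell1 expr0 invr1 scale1r. Qed.

Lemma gE i : (0 < i < n)%N -> g i = v^-1 *: T (s i).
Proof. by move=> hi; rewrite -gIw_sref gIwE ell_sref // expr1. Qed.

Lemma gIw_up w i : (0 < i < n)%N -> (pv w^-1 i.-1 < pv w^-1 i)%N ->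
  gIw w * g i = gIw (w * s i)%g.
Proof.
move=> hi hup; rewrite gE // !gIwE -scalerAl -scalerAr scalerA mul_T_up //.
by rewrite ell_mul_sref_up // exprS invfM mulrC.
Qed.

Lemma gIw_dn w i : (0 < i < n)%N -> (pv w^-1 i < pv w^-1 i.-1)%N ->
  gIw w * g i = gIw (w * s i)%g + kap *: gIw w.
Proof.
move=> hi hdn; rewrite gE // !gIwE -scalerAl -scalerAr scalerA mul_Ts // rmT.
rewrite ell_mul_sref_ltE // ltnNge (ltnW hdn) /= scalerDr !scalerA addrC.
rewrite -(ell_mul_sref_dn hi hdn); set l := ell _.
by congr (_ *: _ + _ *: _); rewrite /cA /cB /kap exprS; field; rewrite ?v0 ?expf_neq0.
Qed.

Lemma star_gIw w : star (gIw w) = gIw w^-1%g.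
Proof. by rewrite !gIwE starZ starT ellV. Qed.

Lemma star_g i : (0 < i < n)%N -> star (g i) = g i.
Proof. by move=> hi; rewrite -gIw_sref star_gIw srefV. Qed.

Lemma g_gIw_up w i : (0 < i < n)%N -> (pv w i.-1 < pv w i)%N ->
  g i * gIw w = gIw (s i * w)%g.
Proof.
move=> hi hup; apply: (can_inj (@starK K v n)); rewrite starM !star_gIw star_g // invMg !srefV //.
by rewrite gIw_up // invgK.
Qed.

Lemma g_gIw_dn w i : (0 < i < n)%N -> (pv w i < pv w i.-1)%N ->
  g i * gIw w = gIw (s i * w)%g + kap *: gIw w.
Proof.
move=> hi hup; apply: (can_inj (@starK K v n)); rewrite starD starZ starM.
rewrite star_g // !star_gIw !invMg !srefV // gIw_dn ?invgK //.
Qed.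

Lemma g_sq i : (0 < i < n)%N -> g i * g i = 1 + kap *: g i.
Proof.
move=> hi; rewrite -[X in X * _ = _]gIw_sref gIw_dn // ?sref_sq ?gIw1 ?gIw_sref //.
by rewrite srefV // pv_srefl // pv_srefr //; lia.
Qed.

Lemma g_comm i j : (0 < i)%N -> (i.+1 < j < n)%N -> GRing.comm (g i) (g j).
Proof.
move=> i0 hj; have [hi hj'] : (0 < i < n)%N /\ (0 < j < n)%N by lia.
rewrite /GRing.comm -[g i in LHS]gIw_sref -[g j in RHS]gIw_sref gIw_up // ?gIw_up //; try (rewrite srefV // !pv_srefN //; lia).
congr gIw; apply: sref_conj => //.
by left; rewrite !pv_srefN //; lia.
Qed.

(** Every letter of the two words lengthens, so both sides are [gIw] of one and the same
    permutation. *)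
Lemma g_braid i : (0 < i)%N -> (i.+1 < n)%N ->
  g i * g i.+1 * g i = g i.+1 * g i * g i.+1.
Proof.
move=> i0 hj; have [hi hj'] : (0 < i < n)%N /\ (0 < i.+1 < n)%N by lia.
have e1 : (s i * s i.+1 * s i = s i.+1 * s i * s i.+1)%g.
  rewrite -[RHS]mulgA; have := @sref_conj n (s i * s i.+1)%g i.+1 i hj' hi.
  rewrite -mulgA => -> //; left; rewrite !pvM /=.
  by rewrite pv_srefr // [pv _ i.+1]pv_srefN ?pv_srefr ?(@pv_srefN _ i.+1 i.-1) //; lia.
have ha : pv (s i) i.+1 = i.+1 by rewrite pv_srefN //; lia.
have hb : pv (s i.+1) i.-1 = i.-1 by rewrite pv_srefN //; lia.
have hl := pv_srefl hj'; rewrite /= in hl.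
have -> : g i * g i.+1 = gIw (s i * s i.+1)%g.
  by rewrite -[X in X * _ = _]gIw_sref gIw_up //= srefV // ha pv_srefr //; lia.
have -> : g i.+1 * g i = gIw (s i.+1 * s i)%g.
  by rewrite -[X in X * _ = _]gIw_sref gIw_up //= srefV // hb hl; lia.
rewrite !gIw_up ?e1 // invMg !srefV // !pvM /=.
  by rewrite ha !pv_srefr // hb /=; lia.
by rewrite hb pv_srefl // hl ha; lia.
Qed.

End Generators.

(** * Jucys-Murphy operators of type B *)

Section JucysMurphy.
Variables (K : fieldType) (R : algType K) (kap : K) (N : nat).
Variables (g : nat -> R) (Lam : {linear R -> R}).
Hypothesis g_quad : forall k y, (0 < k < N)%N -> g k * (g k * y) = y + kap *: (g k * y).
Hypothesis g_br : forall k y, (0 < k)%N -> (k.+1 < N)%N ->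
  g k * (g k.+1 * (g k * y)) = g k.+1 * (g k * (g k.+1 * y)).
Hypothesis g_far : forall k j y, (0 < k)%N -> (k.+1 < j < N)%N ->
  g k * (g j * y) = g j * (g k * y).
Hypothesis Lam_g : forall j y, (1 < j < N)%N -> Lam (g j * y) = g j * Lam y.
Hypothesis Lam_B : forall y, (1 < N)%N ->
  Lam (g 1 * Lam (g 1 * y)) = g 1 * Lam (g 1 * Lam y).

(* [JM k] is the operator L_{k+1}. *)
Fixpoint JM k (y : R) : R := if k is k'.+1 then g k * JM k' (g k * y) else Lam y.

Lemma JM_is_linear k : linear (JM k).
Proof.
elim: k => [|k IH] c x y /=; first exact: linearP.
by rewrite mulrDr -scalerAr IH mulrDr -scalerAr.
Qed.
HB.instance Definition _ k := GRing.isLinear.Build K R R _ (JM k) (@JM_is_linear k).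

Lemma JM_g_gt k j y : (k.+1 < j < N)%N -> JM k (g j * y) = g j * JM k y.
Proof.
elim: k y => [|k IH] y hj /=; first exact: Lam_g.
have h1 : (k.+2 < j < N)%N by lia.
have h2 : (k.+1 < j < N)%N by lia.
by rewrite (@g_far k.+1 j) // IH // (@g_far k.+1 j).
Qed.

(** For j < k-1 this is far commutation. For j = k-1, write [JM k] as g_k g_{k-1} [JM (k-2)] g_{k-1}
    g_k: the braid relation on the right turns g_{k-1} into g_k, which passes the inner operator and
    is turned back on the left. *)
Lemma JM_g_lt k j y : (0 < j < k)%N -> (k < N)%N -> JM k (g j * y) = g j * JM k y.
Proof.
elim: k j y => [|k IH] j y hj hk; first lia.
have [e|ne] := eqVneq j k; last first.
  have h1 : (j.+1 < k.+1 < N)%N by lia.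
  have [h2 h3 h4] : [/\ (0 < j)%N, (0 < j < k)%N & (k < N)%N] by split; lia.
  by rewrite /= -(@g_far j k.+1) // IH // (@g_far j k.+1).
case: k => [|k] in IH hj hk e *; first lia.
have h1 : (k.+1 < k.+2 < N)%N by lia.
by rewrite e /= g_br // (@JM_g_gt k k.+2) // -g_br.
Qed.

(** The braid relations carry the type B relation from [Lam] and g_1 to each [JM k] and g_{k+1}; in
    this form it says that consecutive Jucys-Murphy operators commute. *)
Lemma JM_B k y : (k.+1 < N)%N -> JM k (g k.+1 * JM k (g k.+1 * y)) = g k.+1 * JM k (g k.+1 * JM k y).
Proof.
elim: k y => [|k IH] y hk; first by apply: Lam_B.
have h1 : (k.+1 < k.+2 < N)%N by lia.
have h2 : (k.+1 < N)%N by lia.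
have gt z : JM k (g k.+2 * z) = g k.+2 * JM k z by apply: JM_g_gt.
have br z : g k.+1 * (g k.+2 * (g k.+1 * z)) = g k.+2 * (g k.+1 * (g k.+2 * z)) by apply: g_br.
rewrite [LHS]/= br -gt -br gt IH // gt [RHS]/=.
by rewrite [X in _ = g k.+2 * (g k.+1 * JM k X)]br gt -br.
Qed.

Lemma JM_comm_succ k y : (k.+1 < N)%N -> JM k (JM k.+1 y) = JM k.+1 (JM k y).
Proof. by move=> hk /=; rewrite JM_B. Qed.

Lemma JM_comm i j y : (i < j < N)%N -> JM i (JM j y) = JM j (JM i y).
Proof.
elim: j y => [|j IH] y hj; first lia.
have [e|ne] := eqVneq i j; first by rewrite -e in hj *; apply: JM_comm_succ; lia.
have [h1 h2] : (i.+1 < j.+1 < N)%N /\ (i < j < N)%N by lia.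
by rewrite /= (@JM_g_gt i j.+1) // IH // (@JM_g_gt i j.+1).
Qed.

(** (L_k + 1) ... (L_1 + 1), the counterpart of the Dipper-James element of the type B Hecke
    algebra. *)
Fixpoint JMu k (y : R) : R := if k is k'.+1 then JM k' (JMu k' y) + JMu k' y else y.

Lemma JMu_g_gt k j y : (k < j < N)%N -> JMu k (g j * y) = g j * JMu k y.
Proof.
elim: k => [|k IH] hj //=.
have [h1 h2] : (k < j < N)%N /\ (k.+1 < j < N)%N by lia.
by rewrite IH // (@JM_g_gt k j) // mulrDr.
Qed.

Lemma JM_quad k y : (k.+1 < N)%N ->
  g k.+1 * (JM k.+1 y + JM k y) = JM k.+1 (g k.+1 * y) + JM k (g k.+1 * y).
Proof.
move=> hk; have hk' : (0 < k.+1 < N)%N by lia.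
rewrite /= mulrDr !g_quad // linearD linearZ /= mulrDr -scalerAr.
by rewrite addrC -!addrA; congr (_ + _); rewrite addrC.
Qed.

(* The product of the L_i + 1 over i <= k is symmetric in the L_i. *)
Lemma JMu_g_lt k j y : (0 < j < k)%N -> (k <= N)%N -> JMu k (g j * y) = g j * JMu k y.
Proof.
elim: k j y => [|k IH] j y hj hk; first lia.
have [e|ne] := eqVneq j k; last first.
  have h1 : (0 < j < k)%N by lia.
  by rewrite [JMu k.+1 _]/= IH ?(ltnW hk) // (@JM_g_lt k j) // -mulrDr.
case: k => [|k] in IH hj hk e *; first lia.
have h1 : (k < k.+1 < N)%N by lia.
have h2 : (k.+1 < N)%N by lia.
rewrite e.
(* Two neighbouring factors expand into the elementary symmetric functions of their operators:
   [JM_B] moves the generator through the product and [JM_quad] through the sum. *)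
have E z : JMu k.+2 z = JM k.+1 (JM k (JMu k z)) + (JM k.+1 (JMu k z) + JM k (JMu k z)) + JMu k z.
  by rewrite [LHS]/= -/(JM k.+1 _) linearD !addrA.
rewrite !E JMu_g_gt // -JM_quad // !mulrDr; congr (_ + _ + _).
by rewrite /= JM_B.
Qed.

End JucysMurphy.

(** * The intertwiner *)

Section HeckeRelations.
Variables (K : fieldType) (R : algType K) (kap : K) (m : nat) (g : nat -> R).
Notation n := (m.*2).
Hypothesis g_sq : forall i, (0 < i < n)%N -> g i * g i = 1 + kap *: g i.
Hypothesis g_braid : forall i, (0 < i)%N -> (i.+1 < n)%N ->
  g i * g i.+1 * g i = g i.+1 * g i * g i.+1.
Hypothesis g_comm : forall i j, (0 < i)%N -> (i.+1 < j < n)%N -> GRing.comm (g i) (g j).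
Implicit Types (h y z : R).

Definition gi i : R := g i - kap *: 1.
Definition gs (e : bool) i : R := if e then g i else gi i.

Lemma g_gi i : (0 < i < n)%N -> g i * gi i = 1.
Proof. by move=> hi; rewrite /gi mulrBr g_sq // -scalerAr mulr1 addrK. Qed.

Lemma gi_g i : (0 < i < n)%N -> gi i * g i = 1.
Proof. by move=> hi; rewrite /gi mulrBl g_sq // -scalerAl mul1r addrK. Qed.

Lemma gs_gs e i : (0 < i < n)%N -> gs e i * gs (~~ e) i = 1.
Proof. by case: e => hi; rewrite /gs /= ?g_gi ?gi_g. Qed.

(* I_a ... I_{b-1} for [e = true], and I_a^{-1} ... I_{b-1}^{-1} for [e = false]. *)
Definition Gx e a b : R := \prod_(a <= i < b) gs e i.

Lemma Gx_recr e a b : (a <= b)%N -> Gx e a b.+1 = Gx e a b * gs e b.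
Proof. by move=> h; rewrite /Gx big_nat_recr. Qed.

Lemma Gx_recl e a b : (a < b)%N -> Gx e a b = gs e a * Gx e a.+1 b.
Proof. by move=> h; rewrite /Gx big_ltn. Qed.

Lemma Gx_nil e a : Gx e a a = 1.
Proof. by rewrite /Gx big_geq. Qed.

Lemma Gx_geq e a b : (b <= a)%N -> Gx e a b = 1.
Proof. by move=> h; rewrite /Gx big_geq. Qed.

Lemma Gx_cat e a b c : (a <= b <= c)%N -> Gx e a c = Gx e a b * Gx e b c.
Proof. by move=> /andP[h1 h2]; rewrite /Gx (big_cat_nat h1 h2). Qed.

Lemma gi_def i : gi i = g i - kap *: 1. Proof. by []. Qed.

Lemma comm_gs_of y e i : GRing.comm y (g i) -> GRing.comm y (gs e i).
Proof.
move=> h; case: e => //; apply: commrB => //.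
by rewrite /GRing.comm -scalerAl -scalerAr mul1r mulr1.
Qed.

Lemma gs_comm e e' i j : (0 < i)%N -> (i.+1 < j < n)%N -> GRing.comm (gs e i) (gs e' j).
Proof.
move=> i0 hj; apply: comm_gs_of; apply/commr_sym/comm_gs_of/commr_sym.
exact: g_comm.
Qed.

Lemma gs_commN e e' i j : (0 < i < n)%N -> (0 < j < n)%N -> (i.+1 < j)%N || (j.+1 < i)%N ->
  GRing.comm (gs e i) (gs e' j).
Proof. by move=> hi hj /orP[h|h]; [|apply: commr_sym]; apply: gs_comm; lia. Qed.

Lemma comm_Gx y e a b : (forall i, (a <= i < b)%N -> GRing.comm y (g i)) -> GRing.comm y (Gx e a b).
Proof.
move=> h; rewrite /Gx big_nat; apply: big_ind => //; first exact: commr1.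
- by move=> z t; exact: commrM.
- by move=> i /h; exact: comm_gs_of.
Qed.

Lemma Gx_comm_far e e' a b c d : (0 < a)%N -> (b < c)%N -> (b <= n)%N -> (d <= n)%N ->
  GRing.comm (Gx e a b) (Gx e' c d).
Proof.
move=> a0 hbc hb hd; apply: comm_Gx => j hj; apply/commr_sym/comm_Gx => i hi.
by apply/commr_sym/(gs_comm true true); lia.
Qed.

Lemma Gx_comm_gs e e' a b j : (0 < a)%N -> (b <= n)%N -> (0 < j < n)%N ->
  (b < j)%N || (j.+1 < a)%N -> GRing.comm (Gx e a b) (gs e' j).
Proof.
move=> a0 hb hj h; apply/commr_sym/comm_Gx => i hi.
by apply: (gs_commN e' true); lia.
Qed.

(** For the negative sign, put X = g_{i+1} g_i: the braid relation is g_i X = X g_{i+1}, to be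
    multiplied by the inverse of X on both sides. *)
Lemma gs_gs_g e i : (0 < i)%N -> (i.+1 < n)%N -> gs e i * gs e i.+1 * g i = g i.+1 * gs e i * gs e i.+1.
Proof.
move=> i0 hi; case: e; first exact: g_braid.
have hi0 : (0 < i < n)%N by lia.
have hi1 : (0 < i.+1 < n)%N by lia.
pose X := g i.+1 * g i; pose Y := gi i * gi i.+1.
have XY : X * Y = 1 by rewrite /X /Y mulrA -[_ * _ * gi i]mulrA g_gi // mulr1 g_gi.
have YX : Y * X = 1 by rewrite /X /Y mulrA -[_ * _ * g i.+1]mulrA gi_g // mulr1 gi_g.
have br : g i * X = X * g i.+1 by rewrite /X mulrA g_braid.
rewrite /= -/Y -[_ * _ * gi i.+1]mulrA -/Y.
move: X Y XY YX br => X Y XY YX br.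
have : Y * (g i * X) * Y = Y * (X * g i.+1) * Y by rewrite br.
by rewrite -!mulrA XY mulr1 2!mulrA YX mul1r.
Qed.

Lemma Gx_g e a b j : (0 < a)%N -> (a <= j)%N -> (j.+1 < b)%N -> (b <= n)%N ->
  Gx e a b * g j = g j.+1 * Gx e a b.
Proof.
move=> a0 haj hjb hb; have [j0 jn] : (0 < j)%N /\ (j.+1 < n)%N by lia.
rewrite (@Gx_cat e a j b); last lia.
rewrite (@Gx_cat e j j.+2 b); last lia.
have -> : Gx e j j.+2 = gs e j * gs e j.+1 by rewrite Gx_recr // Gx_recr // Gx_nil mul1r.
have c1 : GRing.comm (Gx e j.+2 b) (g j) by apply: (@Gx_comm_gs _ true); lia.
have c2 : GRing.comm (Gx e a j) (g j.+1) by apply: (@Gx_comm_gs _ true); lia.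
rewrite -!mulrA c1 [gs e j.+1 * _]mulrA [gs e j * (_ * _)]mulrA [gs e j * (_ * _)]mulrA.
rewrite gs_gs_g //.
by rewrite ![in LHS]mulrA c2 !mulrA.
Qed.

Lemma Gx_gs e e' a b j : (0 < a)%N -> (a <= j)%N -> (j.+1 < b)%N -> (b <= n)%N ->
  Gx e a b * gs e' j = gs e' j.+1 * Gx e a b.
Proof.
move=> a0 haj hjb hb; case: e'; first exact: Gx_g.
by rewrite /gs /= !gi_def mulrBr mulrBl Gx_g // -scalerAr mulr1 -scalerAl mul1r.
Qed.

Lemma Gx_Gx e e' a b c d : (0 < a)%N -> (a <= c)%N -> (d < b)%N -> (b <= n)%N ->
  Gx e a b * Gx e' c d = Gx e' c.+1 d.+1 * Gx e a b.
Proof.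
move=> a0 hac hdb hb; elim: d hdb => [|d IH] hdb.
  by rewrite !(@Gx_geq e') ?mulr1 ?mul1r.
case: (leqP c d) => hcd; last by rewrite !(@Gx_geq e') ?mulr1 ?mul1r.
have hcj : (a <= d)%N by lia.
by rewrite Gx_recr // [Gx e' c.+1 _]Gx_recr // mulrA IH ?(ltnW hdb) // -!mulrA Gx_gs.
Qed.

(* c_{m,k} *)
Fixpoint J k : R := if k is k'.+1 then g (m + k'.+1) * J k' * g (m + k'.+1) else 1.

Lemma JS k : J k.+1 = g (m + k.+1) * J k * g (m + k.+1). Proof. by []. Qed.

Notation JMJ := (JM (fun j => g (m + j)) (idfun : {linear R -> R})).

(** With the identity for [Lam] and generators shifted by m, the Jucys-Murphy operators are
    multiplications by c_{m,k}; their commutation relations thus come for free. *)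
Lemma J_JM k y : (k < m)%N -> JMJ k y = J k * y.
Proof.
elim: k y => [|k IH] y hk /=; first by rewrite mul1r.
by rewrite IH ?(ltnW hk) // !mulrA.
Qed.

Lemma g_quad k y : (0 < k < n)%N -> g k * (g k * y) = y + kap *: (g k * y).
Proof. by move=> hk; rewrite mulrA g_sq // mulrDl mul1r scalerAl. Qed.

Lemma g_br k y : (0 < k)%N -> (k.+1 < n)%N ->
  g k * (g k.+1 * (g k * y)) = g k.+1 * (g k * (g k.+1 * y)).
Proof. by move=> k0 hk; rewrite !mulrA g_braid. Qed.

Lemma gJ_br k y : (0 < k)%N -> (k.+1 < m)%N ->
  g (m + k) * (g (m + k.+1) * (g (m + k) * y)) = g (m + k.+1) * (g (m + k) * (g (m + k.+1) * y)).
Proof. by move=> k0 hk; rewrite addnS g_br //; lia. Qed.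

Lemma g_far k j y : (0 < k)%N -> (k.+1 < j < n)%N -> g k * (g j * y) = g j * (g k * y).
Proof. by move=> k0 hk; rewrite !mulrA g_comm. Qed.

Lemma gJ_far k j y : (0 < k)%N -> (k.+1 < j < m)%N ->
  g (m + k) * (g (m + j) * y) = g (m + j) * (g (m + k) * y).
Proof. by move=> k0 hk; rewrite g_far //; lia. Qed.

Lemma idLam_g j y : (1 < j < m)%N ->
  (idfun : {linear R -> R}) (g (m + j) * y) = g (m + j) * (idfun : {linear R -> R}) y.
Proof. by []. Qed.

Lemma idLam_B y : (1 < m)%N ->
  (idfun : {linear R -> R}) (g (m + 1) * (idfun : {linear R -> R}) (g (m + 1) * y)) =
  g (m + 1) * (idfun : {linear R -> R}) (g (m + 1) * (idfun : {linear R -> R}) y).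
Proof. by []. Qed.

Lemma J_g_hi k j : (0 < j < k)%N -> (k < m)%N -> GRing.comm (J k) (g (m + j)).
Proof.
move=> hj hk; have := JM_g_lt gJ_br gJ_far idLam_g 1 hj hk.
by rewrite !J_JM // !mulr1.
Qed.

Lemma J_comm i j : (i < m)%N -> (j < m)%N -> GRing.comm (J i) (J j).
Proof.
wlog lt_ij : i j / (i < j)%N.
  move=> W hi hj; case: (ltngtP i j) => h; first exact: W.
    by apply: commr_sym; apply: W.
  by rewrite h; apply: commr_refl.
move=> hi hj; have hij : (i < j < m)%N by lia.
have := JM_comm gJ_br gJ_far idLam_g idLam_B 1 hij.
by rewrite !J_JM // !mulr1.
Qed.

Lemma J_B k : (k.+1 < m)%N ->
  J k * g (m + k.+1) * J k * g (m + k.+1) = g (m + k.+1) * J k * g (m + k.+1) * J k.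
Proof.
move=> hk; have := JM_B gJ_br gJ_far idLam_g idLam_B 1 hk.
by rewrite !J_JM ?(ltnW hk) // !mulr1 !mulrA.
Qed.

Lemma J_lo k y : (k < m)%N -> (forall j, (m < j < n)%N -> GRing.comm y (g j)) -> GRing.comm y (J k).
Proof.
move=> hk hy; elim: k hk => [|k IH] hk; first exact: commr1.
have c : GRing.comm y (g (m + k.+1)) by apply: hy; lia.
by rewrite JS; do 2?apply: commrM => //; apply: IH; lia.
Qed.

Lemma J_g_lo k j : (k < m)%N -> (0 < j < m)%N -> GRing.comm (J k) (g j).
Proof.
move=> hk hj; apply/commr_sym/J_lo => // i hi.
by apply: g_comm => //; lia.
Qed.

Lemma J_g_far k j : (m + k.+1 < j < n)%N -> GRing.comm (J k) (g j).
Proof.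
elim: k => [|k IH] hj; first exact/commr_sym/commr1.
have c : GRing.comm (g j) (g (m + k.+1)) by apply/commr_sym/g_comm => //; lia.
by apply/commr_sym; rewrite JS; do 2!apply: commrM => //; apply/commr_sym/IH; lia.
Qed.

Definition D e i : R := Gx e i (m + i).

(* The recursion splits the sum over sign vectors on the first sign, so that [hh m] is
   v^{-m(2m-1)} H_1. *)
Fixpoint hh k : R := if k is k'.+1 then D true k * hh k' + D false k * hh k' * J k' else 1.

Lemma hhS k : hh k.+1 = D true k.+1 * hh k + D false k.+1 * hh k * J k. Proof. by []. Qed.

(** Each of the k factors [D] raises the index of the generator by one, and the letters of [J] are
    far from g_j. *)
Lemma hh_g_lo k j : (k <= m)%N -> (0 < j < m)%N -> hh k * g j = g (j + k) * hh k.
Proof.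
elim: k => [|k IH] hk hj; first by rewrite addn0 mulr1 mul1r.
have hD e : D e k.+1 * g (j + k) = g (j + k.+1) * D e k.+1 by rewrite addnS Gx_g //; lia.
rewrite hhS mulrDl -(mulrA _ (J k)) J_g_lo // !mulrA -(mulrA _ (hh k)) -(mulrA _ (hh k) (g j)).
by rewrite IH ?(ltnW hk) // !mulrA !hD mulrDr !mulrA.
Qed.

Lemma hh_g_far k j : (k <= m)%N -> (m + k < j < n)%N -> GRing.comm (hh k) (g j).
Proof.
elim: k => [|k IH] hk hj; first exact/commr_sym/commr1.
have c : GRing.comm (g j) (hh k) by apply/commr_sym/IH; lia.
have cD e : GRing.comm (g j) (D e k.+1) by apply/commr_sym; apply: (@Gx_comm_gs _ true); lia.
have cJ : GRing.comm (g j) (J k) by apply/commr_sym/J_g_far; lia.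
by apply/commr_sym; rewrite hhS; apply: commrD; do ?apply: commrM.
Qed.

(** The letter [gs e' i] completes [D e' i.+1] to a word with one more letter; that word shifts
    [D e i] to [D e i.+1], and its last letter is then split off. *)
Lemma D_D e e' i : (0 < i < m)%N ->
  gs e' i * D e' i.+1 * D e i = D e i.+1 * D e' i * gs e' (m + i).
Proof.
move=> hi; have [h1 h2 h3] : [/\ (i < (m + i).+1)%N, (i <= m + i)%N & ((m + i).+1 <= n)%N] by split; lia.
have h0 : (0 < i)%N by lia.
by rewrite /D addnS -Gx_recl // Gx_Gx // -mulrA -Gx_recr.
Qed.

Lemma hh_g_hi k i : (k <= m)%N -> (0 < i < k)%N -> hh k * g (m + i) = g i * hh k.
Proof.
elim: k => [|k IH] hk hi; first lia.
have [e|ne] := eqVneq i k; last first.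
  have cD e : GRing.comm (g i) (D e k.+1).
    by apply/commr_sym; apply: (@Gx_comm_gs _ true); lia.
  have cJ : GRing.comm (J k) (g (m + i)) by apply: J_g_hi; lia.
  rewrite hhS mulrDl mulrDr -(mulrA _ (J k)) cJ !mulrA -(mulrA _ (hh k)) -(mulrA _ (hh k) (g _)).
  by rewrite IH ?mulrA -?cD //; lia.
case: k => [|k] in IH hk hi e *; first lia.
rewrite e; move=> {IH e hi} {i}; rewrite 2!hhS JS.
set i := k.+1; set h := hh k; set x := g (m + i); set j := J k; set A := D true i.
have hi : (0 < i < m)%N by rewrite /i; lia.
have hmi : (0 < m + i < n)%N by lia.
have ch : h * x = x * h by apply: hh_g_far; rewrite /i; lia.
have cj : j * x * j * x = x * j * x * j by apply: J_B; rewrite /i in hi *; lia.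
have Ei : gi i = g i - kap *: 1 by [].
have Em : gi (m + i) = x - kap *: 1 by [].
have eA : g i * D true i.+1 * D true i = D true i.+1 * D true i * x by exact: (D_D true true).
have eX : g i * D true i.+1 * D false i = D false i.+1 * D true i * x by exact: (D_D false true).
have eB : g i * D false i.+1 * D false i = D false i.+1 * D false i * x.
  have := D_D false false hi; rewrite /= Ei Em mulrBr !mulrBl.
  by rewrite -!scalerAl -!scalerAr !mul1r mulr1 => /addIr.
(* Here the sign of the letter differs from that of the first word, which costs a term in [kap]. It
   is matched by the term that x * x produces when x meets the last letter of the outer J, namely x
   * j * x. *)
have eZ : g i * D false i.+1 * D true i =
    D true i.+1 * D false i * gi (m + i) + kap *: (D false i.+1 * D true i).
  have e : D false i.+1 * D true i = g i * D true i.+1 * D false i * gi (m + i).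
    by rewrite eX -mulrA g_gi // mulr1.
  rewrite -(mulrA (g i)) [in LHS]e -!mulrA g_quad //; last by rewrite /i; lia.
  by congr (_ + kap *: _); rewrite ?e !mulrA.
have ch' y : y * x * h = y * h * x by rewrite -mulrA -ch mulrA.
have eJ y : y * x * j * x * j = y * j * x * j * x by rewrite -!(mulrA y) cj.
have eg y : y * gi (m + i) * h * x = y * h by rewrite -!mulrA ch (mulrA (gi _)) gi_g // mul1r.
have exx y : y * x * x = y + kap *: (y * x) by rewrite -mulrA g_sq // mulrDr mulr1 scalerAr.
do 3!rewrite ?(mulrDr, mulrDl) ?mulrA.
rewrite eA eX eB eZ !ch' mulrDl -!scalerAl.
rewrite !mulrDl eg -!scalerAl eJ exx.
by rewrite /A -!addrA; congr (_ + _); rewrite addrCA.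
Qed.

End HeckeRelations.

(** * Cycles and first-point decomposition *)

Section Cycles.
Variable n : nat.
Implicit Types (u w : 'S_n).

Definition cyc a b : 'S_n := (\prod_(a <= i < b) sref n i)%g.

Lemma cyc_recr a b : (a <= b)%N -> cyc a b.+1 = (cyc a b * sref n b)%g.
Proof. by move=> h; rewrite /cyc big_nat_recr. Qed.

Lemma cyc_recl a b : (a < b)%N -> cyc a b = (sref n a * cyc a.+1 b)%g.
Proof. by move=> h; rewrite /cyc big_ltn. Qed.

Lemma cyc_nil a : cyc a a = 1%g.
Proof. by rewrite /cyc big_geq. Qed.

Lemma pv_cyc a b x : (0 < a)%N -> (a <= b <= n)%N ->
  pv (cyc a b) x = if x == a.-1 then b.-1 else if (a <= x < b)%N then x.-1 else x.
Proof.
move=> a0 /andP[hab hb]; elim: b hab hb => [|b IH] hab hb; first lia.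
have [e|ne] := eqVneq a b.+1.
  rewrite e cyc_nil pv1 /=; case: (eqVneq x b) => [->//|_].
  by case: ifP => //; lia.
have hab' : (a <= b)%N by lia.
have hb' : (0 < b < n)%N by lia.
rewrite cyc_recr // pvM (IH hab' (ltnW hb)).
case: (eqVneq x a.-1) => [e1|x1]; first by rewrite pv_srefl.
case: (ltngtP x b) => h.
- by case: ifP => h2; rewrite pv_srefN //; try (case: ifP => //); lia.
- by rewrite !andbF pv_srefN //; try (case: ifP => //); lia.
- by rewrite h andbF pv_srefr //; case: ifP => //; lia.
Qed.

End Cycles.

Section GeneratorCycles.
Variables (K : fieldType) (v : K) (n : nat).
Hypothesis v0 : v != 0.
Implicit Types (w u : 'S_n).
Notation Gx := (Gx (kap v) (g v n)).

(* [u^-1] increases from [a-1] to each point of [a, b), so every letter lengthens [u]. *)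
Lemma gIw_cycr u a b : (0 < a)%N -> (a <= b <= n)%N ->
  (forall x, (a <= x < b)%N -> (pv u^-1 a.-1 < pv u^-1 x)%N) ->
  gIw v u * Gx true a b = gIw v (u * cyc n a b)%g.
Proof.
move=> a0 /andP[hab hb] hx; elim: b hab hb hx => [|b IH] hab hb hx; first lia.
have [e|ne] := eqVneq a b.+1; first by rewrite -e Gx_nil cyc_nil mulg1 mulr1.
have hab' : (a <= b)%N by lia.
have hbn : (b <= n)%N by lia.
have hb0 : (0 < b < n)%N by lia.
rewrite cyc_recr // Gx_recr // mulrA mulgA IH //; last first.
  by move=> x h; apply: hx; lia.
rewrite gIw_up //.
have hb1 : pv (cyc n a b)^-1 b.-1 = a.-1.
  by apply: pvV_eq; rewrite pv_cyc ?eqxx //; lia.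
have hb2 : pv (cyc n a b)^-1 b = b.
  apply: pvV_eq; rewrite pv_cyc //; last by lia.
  by rewrite ltnn andbF; case: eqP; lia.
by rewrite invMg !pvM hb1 hb2 hx //; lia.
Qed.

Lemma gIw_cycl u a b : (0 < a)%N -> (a <= b <= n)%N ->
  (forall x, (a <= x < b)%N -> (pv u x.-1 < pv u b.-1)%N) ->
  Gx true a b * gIw v u = gIw v (cyc n a b * u)%g.
Proof.
move=> a0 /andP[hab hb] hx; move: hx; rewrite -(subKn hab).
have : (b - a < b)%N by lia.
move: (b - a)%N => k {hab a0}; elim: k => [|k IH] hk hx.
  by rewrite subn0 Gx_nil cyc_nil mul1g mul1r.
have e : (b - k.+1).+1 = (b - k)%N by lia.
have lt : (b - k.+1 < b)%N by lia.
rewrite Gx_recl // cyc_recl // e -mulrA -mulgA IH; first last.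
- by move=> x h; apply: hx; lia.
- by lia.
have hb1 : (0 < b - k.+1 < n)%N by lia.
have hb2 : (0 < b - k)%N by lia.
have hb3 : (b - k <= b <= n)%N by lia.
rewrite g_gIw_up // !pvM !pv_cyc //.
have -> : ((b - k.+1).-1 == (b - k).-1) = false by lia.
have -> : (b - k.+1 == (b - k).-1)%N by lia.
have -> : ((b - k <= (b - k.+1).-1 < b) = false)%N by lia.
by apply: hx; lia.
Qed.

End GeneratorCycles.

(** * The square of the intertwiner *)

Section SquareOfIntertwiner.
Variables (K : fieldType) (R : algType K) (kap : K) (m : nat) (g : nat -> R).
Notation n := (m.*2).
Hypothesis m0 : (0 < m)%N.
Hypothesis g_sq : forall i, (0 < i < n)%N -> g i * g i = 1 + kap *: g i.
Hypothesis g_braid : forall i, (0 < i)%N -> (i.+1 < n)%N ->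
  g i * g i.+1 * g i = g i.+1 * g i * g i.+1.
Hypothesis g_comm : forall i j, (0 < i)%N -> (i.+1 < j < n)%N -> GRing.comm (g i) (g j).
Variable Lam : {linear R -> R}.
Hypothesis Lam_l : forall j y, (1 < j < n)%N -> Lam (g j * y) = g j * Lam y.
Hypothesis Lam_r : forall j y, (0 < j < n)%N -> j != m -> Lam (y * g j) = Lam y * g j.
Hypothesis Lam1 : Lam 1 = -1.
Notation gi := (gi kap g).
Notation gs := (gs kap g).
Notation Gx := (Gx kap g).
Notation D := (D kap m g).
Notation J := (J m g).
Notation hh := (hh kap m g).
Hypothesis LamG : Lam (Gx true 1 m.+1) = Gx false 1 m.+1.
(* [1], [Gx true 2 m.+1], [Gx true 1 m.+1] and [Gx true 2 m.+2 * Gx true 1 m.+1] represent the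
   double cosets of the parabolics of s_3, ... and of s_j, j <> m. *)
Hypothesis gen : forall f : {linear R -> R},
  (forall j y, (2 < j < n)%N -> f (g j * y) = g j * f y) ->
  (forall j y, (0 < j < n)%N -> j != m -> f (y * g j) = f y * g j) ->
  f 1 = 0 -> f (Gx true 2 m.+1) = 0 -> f (Gx true 1 m.+1) = 0 ->
  ((1 < m)%N -> f (Gx true 2 m.+2 * Gx true 1 m.+1) = 0) ->
  forall y, f y = 0.

(* Vanishing of the defect is the type B braid relation between [Lam] and [g 1]. *)
Definition LamB_defect y : R := Lam (g 1 * Lam (g 1 * y)) - g 1 * Lam (g 1 * Lam y).

Lemma LamB_defect_is_linear : linear LamB_defect.
Proof.
have E (c : K) x y : Lam (c *: x + y) = c *: Lam x + Lam y by exact: linearP.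
have M (c : K) x y : g 1 * (c *: x + y) = c *: (g 1 * x) + g 1 * y.
  by rewrite mulrDr scalerAr.
by move=> c x y; rewrite /LamB_defect !(E, M) scalerBr opprD addrACA.
Qed.
HB.instance Definition _ := GRing.isLinear.Build K R R _ LamB_defect LamB_defect_is_linear.

Lemma scaleA1 (c : K) (y : R) : c *: 1 * y = c *: y.
Proof. by rewrite -scalerAl mul1r. Qed.

Lemma scaleA1r (c : K) (y : R) : y * (c *: 1) = c *: y.
Proof. by rewrite -scalerAr mulr1. Qed.

Lemma Lam_gs_l e j y : (1 < j < n)%N -> Lam (gs e j * y) = gs e j * Lam y.
Proof.
move=> hj; case: e; first exact: Lam_l.
by rewrite /gs /gi !mulrBl !scaleA1 linearB linearZ /= Lam_l.
Qed.

Lemma Lam_Gx_l e a b y : (1 < a)%N -> (b <= n)%N -> Lam (Gx e a b * y) = Gx e a b * Lam y.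
Proof.
move=> ha hb; have [k] := ubnP (b - a); elim: k a ha y => // k IH a ha y hk.
case: (ltnP a b) => hab; last by rewrite Gx_geq // !mul1r.
have h1 : (1 < a < n)%N by lia.
by rewrite Gx_recl // -!mulrA Lam_gs_l // IH //; lia.
Qed.

Lemma gi_gE i y : (0 < i < n)%N -> gi i * (g i * y) = y.
Proof. by move=> hi; rewrite mulrA (gi_g g_sq) // mul1r. Qed.

Lemma gE2 i y : (0 < i < n)%N -> g i * (g i * y) = y + kap *: (g i * y).
Proof. by move=> hi; rewrite mulrA g_sq // mulrDl mul1r scalerAl. Qed.

(** The defect is left linear only for j > 2, since g_1 has to pass g_j, so four representatives are
    checked. On I_2 ... I_m, [LamG] yields a negative word whose first letter g_1 cancels; I_1 ...
    I_m follows from this by the quadratic relation of g_1. *)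
Lemma LamB y : Lam (g 1 * Lam (g 1 * y)) = g 1 * Lam (g 1 * Lam y).
Proof.
have h1n : (0 < 1 < n)%N by lia.
apply/eqP; rewrite -subr_eq0; apply/eqP; rewrite -/(LamB_defect y); move: y.
have X2 : LamB_defect (Gx true 2 m.+1) = 0.
  rewrite /LamB_defect -[Gx true 2 _]mulr1 !Lam_Gx_l //; try lia.
  rewrite Lam1 !mulrN1 mulrN !mulr1.
  have -> : g 1 * Gx true 2 m.+1 = Gx true 1 m.+1 by rewrite [RHS]Gx_recl.
  rewrite linearN LamG [Gx false 1 _]Gx_recl // /gs mulrN -[gi 1 * _]mulr1.
  have e : g 1 * gi 1 = 1 by rewrite (g_gi g_sq).
  rewrite !mulrA e !mul1r mulr1 -[Gx false 2 _]mulr1 Lam_Gx_l //; last lia.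
  by rewrite Lam1 mulrN1 mulr1 opprK addrC subrr.
apply: gen => //.
- move=> j y hj; have h2 : (1 < j < n)%N by lia.
  have c z : g 1 * (g j * z) = g j * (g 1 * z) by rewrite !mulrA g_comm.
  have l z : Lam (g j * z) = g j * Lam z by exact: Lam_l.
  by rewrite /= /LamB_defect !(l, c) mulrBr.
- move=> j y hj jm; have r z : Lam (z * g j) = Lam z * g j by exact: Lam_r.
  by rewrite /= /LamB_defect !(mulrA, r) mulrBl.
- have [e|ne] := eqVneq m 1%N.
    by have := X2; rewrite e Gx_nil.
  have h : (0 < 1 < n)%N by lia.
  have n1 : 1%N != m by rewrite eq_sym.
  have Lg : Lam (g 1) = - g 1 by rewrite -[g 1]mul1r Lam_r // Lam1 mulNr.
  have Lgg : Lam (g 1 * g 1) = - (g 1 * g 1) by rewrite Lam_r // Lg mulNr.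
  by rewrite /= /LamB_defect mulr1 Lg Lam1 mulrN1 mulrN !linearN Lgg Lg !opprK subrr.
- have e : Gx true 1 m.+1 = g 1 * Gx true 2 m.+1 by rewrite Gx_recl.
  move: X2; rewrite e; set X := Gx true 2 _ => /eqP; rewrite /= /LamB_defect subr_eq0 => /eqP X2.
  have E y (c : K) z : Lam (y + c *: z) = Lam y + c *: Lam z by rewrite linearD linearZ.
  have M y (c : K) z : g 1 * (y + c *: z) = g 1 * y + c *: (g 1 * z) by rewrite mulrDr scalerAr.
  by rewrite /= /LamB_defect gE2 // !(E, M) X2 gE2 // subrr.
- move=> m1; have hm : (0 < m.+1 < n)%N by lia.
  have hmm : m.+1 != m by lia.
  have h2 : (m.+2 <= n)%N by lia.
  (* On the last representative g_1 on the left becomes g_{m+1} on the right, which commutes with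
     [Lam]; [X5] is the same with both words negative. *)
  have X4 e : g 1 * (Gx true 2 m.+2 * Gx e 1 m.+1) = Gx e 2 m.+2 * Gx true 1 m.+1 * g m.+1.
    rewrite mulrA.
    have -> : g 1 * Gx true 2 m.+2 = Gx true 1 m.+2 by rewrite [RHS]Gx_recl.
    by rewrite (Gx_Gx g_sq g_braid g_comm) // -mulrA -Gx_recr.
  have X5 : g 1 * (Gx false 2 m.+2 * Gx false 1 m.+1) = Gx false 2 m.+2 * Gx false 1 m.+1 * g m.+1.
    have : gi 1 * Gx false 2 m.+2 * Gx false 1 m.+1 = Gx false 2 m.+2 * Gx false 1 m.+1 * gi m.+1.
      have -> : gi 1 * Gx false 2 m.+2 = Gx false 1 m.+2 by rewrite [RHS]Gx_recl.
      by rewrite (Gx_Gx g_sq g_braid g_comm) // -mulrA -Gx_recr.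
    by rewrite -mulrA /gi mulrBl mulrBr scaleA1 scaleA1r => /addIr.
  have LX e : Lam (Gx e 2 m.+2 * Gx true 1 m.+1) = Gx e 2 m.+2 * Gx false 1 m.+1.
    by rewrite Lam_Gx_l // LamG.
  have r z : Lam (z * g m.+1) = Lam z * g m.+1 by exact: Lam_r.
  by rewrite /= /LamB_defect X4 r !LX [g 1 * (_ * _ * _)]mulrA X4 !r LX mulrA X5 subrr.
Qed.

Let gq k y : (0 < k < n)%N -> g k * (g k * y) = y + kap *: (g k * y).
Proof. exact: gE2. Qed.
Let gb k y : (0 < k)%N -> (k.+1 < n)%N ->
  g k * (g k.+1 * (g k * y)) = g k.+1 * (g k * (g k.+1 * y)).
Proof. exact: (g_br g_braid). Qed.
Let gf k j y : (0 < k)%N -> (k.+1 < j < n)%N -> g k * (g j * y) = g j * (g k * y).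
Proof. exact: (g_far g_comm). Qed.
Let LB y : (1 < n)%N -> Lam (g 1 * Lam (g 1 * y)) = g 1 * Lam (g 1 * Lam y).
Proof. by move=> _; exact: LamB. Qed.

Notation L := (JM g Lam).
Notation U := (JMu g Lam).

Lemma L_r k j y : (0 < j < n)%N -> j != m -> L k (y * g j) = L k y * g j.
Proof.
move=> hj jm; elim: k y => [|k IH] y /=; first exact: Lam_r.
by rewrite mulrA IH mulrA.
Qed.

Lemma L_gs_lt k e j y : (0 < j < k)%N -> (k < n)%N -> L k (gs e j * y) = gs e j * L k y.
Proof.
move=> hj hk; have h := JM_g_lt gb gf Lam_l y hj hk; case: e => //.
by rewrite /gs /gi !mulrBl !scaleA1 linearB linearZ /= h.
Qed.

Lemma L_Gx_lt k e a b y : (0 < a)%N -> (b <= k)%N -> (k < n)%N ->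
  L k (Gx e a b * y) = Gx e a b * L k y.
Proof.
move=> a0 bk kn; have [d] := ubnP (b - a); elim: d a a0 y => // d IH a a0 y hd.
case: (ltnP a b) => hab; last by rewrite Gx_geq // !mul1r.
have h1 : (0 < a < k)%N by lia.
by rewrite Gx_recl // -!mulrA L_gs_lt // IH //; lia.
Qed.

(** From L_{j+1} = I_j L_j I_j follows L_j I_j = I_j^{-1} L_{j+1}, which telescopes: an operator
    that crosses a positive word makes it negative. This is the source of the two signs in h. *)
Lemma L_shift i k y : (i + k < n)%N ->
  L i (Gx true i.+1 (i + k).+1 * y) = Gx false i.+1 (i + k).+1 * L (i + k) y.
Proof.
elim: k y => [|k IH] y hk; first by rewrite addn0 !Gx_nil !mul1r.
have h1 : (i < (i + k).+1)%N by lia.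
have h2 : (i + k < n)%N by lia.
have h3 : (0 < (i + k).+1 < n)%N by lia.
by rewrite !addnS [Gx true _ _]Gx_recr // [Gx false _ _]Gx_recr // -!mulrA IH //= gi_gE.
Qed.

Lemma Gx_linv e a b : (0 < a)%N -> (b <= n)%N -> exists z, z * Gx e a b = 1.
Proof.
move=> a0; elim: b => [|b IH] hb; first by exists 1; rewrite Gx_geq ?mulr1.
case: (leqP a b) => hab; last by exists 1; rewrite Gx_geq ?mulr1.
have [z hz] := IH (ltnW hb); exists (gs (~~ e) b * z).
have hb' : (0 < b < n)%N by lia.
rewrite Gx_recr // mulrA -(mulrA _ z) hz mulr1 -{2}[e]negbK.
exact: (gs_gs g_sq).
Qed.

(** The value prescribed by [LamG] amounts to this normalisation, from which the later operators
    take the values c_{m,k} at 1. *)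
Lemma L_m_1 : L m 1 = 1.
Proof.
have mn : (m < n)%N by lia.
have [z hz] := @Gx_linv false 1 m.+1 isT mn.
have := @L_shift 0 m 1 mn; rewrite add0n mulr1 /= LamG => /(congr1 (fun y => z * y)).
by rewrite hz mulrA hz mul1r.
Qed.

Lemma L_J k : (k < m)%N -> L (m + k) 1 = J k.
Proof.
elim: k => [|k IH] hk; first by rewrite addn0 L_m_1.
have h1 : (0 < m + k.+1 < n)%N by lia.
have h2 : m + k.+1 != m by lia.
have e : L (m + k.+1) 1 = g (m + k.+1) * L (m + k) (g (m + k.+1) * 1) by rewrite addnS.
by rewrite e mulr1 -[X in L _ X]mul1r L_r // IH ?(ltnW hk) // mulrA.
Qed.

Lemma L_right_J k j y : (j < m)%N -> L k (y * J j) = L k y * J j.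
Proof.
elim: j y => [|j IH] y hj; first by rewrite !mulr1.
have h1 : (0 < m + j.+1 < n)%N by lia.
have h2 : m + j.+1 != m by lia.
by rewrite JS !mulrA L_r // IH ?(ltnW hj) // L_r.
Qed.

Lemma L_hh k j : (j <= k)%N -> (k < m)%N -> L (m + k) (hh j) = hh j * J k.
Proof.
elim: j => [|j IH] hj hk; first by rewrite L_J // mul1r.
have [h1 h2] : (m + j.+1 <= m + k)%N /\ (m + k < n)%N by lia.
have jm : (j < m)%N by lia.
rewrite hhS linearD /= L_right_J // /D !L_Gx_lt // IH ?(ltnW hj) //.
by rewrite mulrDl -!mulrA (J_comm g_braid g_comm) // !mulrA.
Qed.

Lemma U_is_linear k : linear (U k).
Proof.
elim: k => [|k IH] c x y //=; rewrite IH linearP /= scalerDr.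
by rewrite addrACA.
Qed.
HB.instance Definition _ k := GRing.isLinear.Build K R R _ (U k) (@U_is_linear k).

Lemma U_gs_gt k e j y : (k < j < n)%N -> U k (gs e j * y) = gs e j * U k y.
Proof.
move=> hj; have h := JMu_g_gt gf Lam_l y hj; case: e => //.
by rewrite /gs /gi !mulrBl !scaleA1 linearB linearZ /= h.
Qed.

Lemma U_Gx_gt k e a b y : (k < a)%N -> (b <= n)%N -> U k (Gx e a b * y) = Gx e a b * U k y.
Proof.
move=> ka bn; have [d] := ubnP (b - a); elim: d a ka y => // d IH a ka y hd.
case: (ltnP a b) => hab; last by rewrite Gx_geq // !mul1r.
have h1 : (k < a < n)%N by lia.
by rewrite Gx_recl // -!mulrA U_gs_gt // IH //; lia.
Qed.

(* [Dt m] is I_{t_1}; [desc] collects the first letters of its factors. *)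
Fixpoint Dt k : R := if k is k'.+1 then D true k * Dt k' else 1.
Fixpoint desc k : R := if k is k'.+1 then g k * desc k' else 1.

(** In the new factor L_{k+1} + 1, the summand 1 keeps the word [D true k.+1] and L_{k+1} replaces
    it by [D false k.+1] and a factor [J k] on the right: this is the recursion for [hh]. *)
Lemma U_Dt k : (k <= m)%N -> U k (Dt k) = hh k.
Proof.
elim: k => [//|k IH] hk.
have h1 : (m + k.+1 <= n)%N by lia.
have h2 : (k + m < n)%N by lia.
have e : U k (Dt k.+1) = D true k.+1 * hh k by rewrite /= U_Gx_gt // IH ?(ltnW hk).
rewrite -[LHS]/(L k (U k (Dt k.+1)) + U k (Dt k.+1)) e hhS addrC; congr (_ + _).
by rewrite /D addnS addnC L_shift // addnC L_hh // mulrA.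
Qed.

Lemma comm_desc k (y : R) : (forall j, (0 < j <= k)%N -> GRing.comm y (g j)) -> GRing.comm y (desc k).
Proof.
elim: k => [|k IH] h; first exact: commr1.
apply: commrM; first by apply: h; rewrite ltnS leqnn.
by apply: IH => j /andP[h1 h2]; apply: h; rewrite h1 leqW.
Qed.

(** Once the first letters are collected on the left, the remaining ones have index at least 2, so
    [Lam] acts on their product as it does on 1. *)
Lemma Dt_desc k : (k <= m)%N -> exists2 z, Lam z = - z & Dt k = desc k * z.
Proof.
elim: k => [|k IH] hk; first by exists 1; rewrite ?mulr1.
have [z hz e] := IH (ltnW hk); exists (Gx true k.+2 (m + k.+1) * z).
  by rewrite Lam_Gx_l //; [rewrite hz mulrN|lia].
have lt : (k.+1 < m + k.+1)%N by lia.
rewrite /= e /D Gx_recl // -!mulrA; congr (_ * _); rewrite !mulrA; congr (_ * _).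
apply: comm_desc => j hj; apply: (Gx_comm_gs kap g_comm _ true) => //; lia.
Qed.

Lemma U_desc k j y : (j <= k)%N -> (k < n)%N -> U k.+1 (desc j * y) = desc j * U k.+1 y.
Proof.
elim: j => [|j IH] hj hk; first by rewrite !mul1r.
have h1 : (0 < j.+1 < k.+1)%N by lia.
rewrite [desc _]/= -!mulrA (JMu_g_lt gq gb gf Lam_l LB) //.
by rewrite IH ?(ltnW hj).
Qed.

Lemma U_eigen k z : Lam z = - z -> U k.+1 z = 0.
Proof.
move=> hz; elim: k => [|k IH]; first by rewrite /= hz addNr.
by rewrite -[LHS]/(L k.+1 (U k.+1 z) + U k.+1 z) IH linear0 addr0.
Qed.

(* [hh m] is [U m] applied to I_{t_1} = [desc m * z] with [Lam z = - z], and [U m.+1], which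
   commutes with [desc m], has the factor L_1 + 1 that kills [z]. *)
Lemma L_m_hh : L m (hh m) = - hh m.
Proof.
have mn : (m < n)%N by lia.
have [z hz e] := Dt_desc (leqnn m).
apply/eqP; rewrite -addr_eq0 -U_Dt // e -[X in X == _]/(U m.+1 (desc m * z)).
by rewrite U_desc // U_eigen // mulr0.
Qed.

Variable P : R -> Prop.
Hypothesis P_D : forall y z, P y -> P z -> P (y + z).
Hypothesis P_Z : forall (c : K) y, P y -> P (c *: y).
Hypothesis P_l : forall j y, (1 < j < n)%N -> P y -> P (g j * y).
Hypothesis P_r : forall j y, (0 < j < n)%N -> j != m -> P y -> P (y * g j).
Hypothesis P_Lam : forall y, P (y - Lam y).

Lemma P_gs_l e j y : (1 < j < n)%N -> P y -> P (gs e j * y).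
Proof.
move=> hj hy; case: e; first exact: P_l.
by rewrite /gs /gi mulrBl scaleA1 -scaleNr; apply: P_D; [apply: P_l|apply: P_Z].
Qed.

Lemma P_Gx_l e a b y : (1 < a)%N -> (b <= n)%N -> P y -> P (Gx e a b * y).
Proof.
move=> ha bn hy; have [d] := ubnP (b - a); elim: d a ha => // d IH a ha hd.
case: (ltnP a b) => hab; last by rewrite Gx_geq // mul1r.
have h1 : (1 < a < n)%N by lia.
by rewrite Gx_recl // -mulrA; apply: P_gs_l => //; apply: IH; lia.
Qed.

Lemma P_hh1_hh : P (hh 1 * hh m).
Proof.
have mn : (0 + m < n)%N by lia.
have := L_shift (hh m) mn; rewrite !add0n L_m_hh mulrN /= => e.
by have := P_Lam (Gx true 1 m.+1 * hh m); rewrite e opprK /D addn1 !mulr1 mulrDl.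
Qed.

(** In the recursion for [hh k * hh m] the factor J stands between the two; moved to the far right,
    it becomes a word in letters of index below m, which preserve P there. *)
Lemma J_hh k : (k < m)%N -> exists z, J k * hh m = hh m * z /\ forall y, P y -> P (y * z).
Proof.
elim: k => [|k IH] hk; first by exists 1; rewrite mulr1 mul1r; split=> // y; rewrite mulr1.
have [z [e hz]] := IH (ltnW hk); exists (g k.+1 * z * g k.+1); split.
  have c : g (m + k.+1) * hh m = hh m * g k.+1.
    by rewrite (hh_g_lo g_sq g_braid g_comm) // addnC.
  by rewrite JS -!mulrA c (mulrA (J k)) e !mulrA c.
have h1 : (0 < k.+1 < n)%N by lia.
have h2 : k.+1 != m by lia.
by move=> y hy; rewrite !mulrA; apply: P_r => //; apply: hz; apply: P_r.
Qed.

Lemma P_hh_hh k : (0 < k <= m)%N -> P (hh k * hh m).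
Proof.
case: k => // k; elim: k => [|k IH] hk; first exact: P_hh1_hh.
have hk' : (0 < k.+1 <= m)%N by lia.
have [h1 h2 h3] : [/\ (1 < k.+2)%N, (m + k.+2 <= n)%N & (k.+1 < m)%N] by split; lia.
have [z [e hz]] := J_hh h3.
rewrite hhS mulrDl -(mulrA (D true _)) -(mulrA _ (J _)) e -!(mulrA (D false _)); apply: P_D; apply: P_Gx_l => //; first exact: IH.
by rewrite mulrA; apply: hz; apply: IH.
Qed.

Lemma P_hh_sq : P (hh m * hh m).
Proof. by apply: P_hh_hh; rewrite m0 leqnn. Qed.

End SquareOfIntertwiner.

(** * Splitting off the image of one point *)

Section FirstRest.
Variable n : nat.
Implicit Types (w u : 'S_n) (x k p : nat).

Definition fixes_below k u := forall x, (x < k)%N -> pv u x = x.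

Lemma pv_cyc_lt k p (x y : nat) : (k < p.+1 <= n)%N -> (k < x)%N -> (k < y)%N ->
  (pv (cyc n k.+1 p.+1) x < pv (cyc n k.+1 p.+1) y)%N = (x < y)%N.
Proof.
move=> hp hx hy; rewrite !pv_cyc //.
have -> : (x == k.+1.-1) = false by lia.
have -> : (y == k.+1.-1) = false by lia.
by case: ifP; case: ifP; lia.
Qed.

(* [w] is [first_rest k w] followed by the cycle carrying the point [k] to its image. *)
Definition first_rest k w := (w * (cyc n k.+1 (pv w k).+1)^-1)%g.

Lemma fixes_le k u x : fixes_below k u -> (k <= x)%N -> (k <= pv u x)%N.
Proof.
move=> hu hx; rewrite leqNgt; apply/negP => h.
by have := hu _ h => /(@pv_inj _ u) e; lia.
Qed.

Lemma first_restE k w : w = (first_rest k w * cyc n k.+1 (pv w k).+1)%g.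
Proof. by rewrite /first_rest mulgKV. Qed.

Lemma fixes_first_rest k w : (k < n)%N -> fixes_below k w -> fixes_below k.+1 (first_rest k w).
Proof.
move=> kn hw x hx; rewrite /first_rest pvM; apply: pvV_eq.
have h1 : (k <= pv w k)%N by apply: fixes_le.
have h2 : (pv w k < n)%N by rewrite pv_lt.
have h3 : (k.+1 <= (pv w k).+1 <= n)%N by rewrite ltnS h1.
rewrite pv_cyc //=; case: (eqVneq x k) => [->//|hk].
have xk : (x < k)%N by lia.
by rewrite (hw x xk) ifF //; lia.
Qed.

(** An element fixing the points below k involves only letters s_i with i > k; linearity for these
    letters therefore extends to [gIw u]. *)
Lemma fixes_ind k (Q : 'S_n -> Prop) : Q 1%g ->
  (forall u i, (k < i < n)%N -> (0 < i < n)%N -> (pv u^-1 i.-1 < pv u^-1 i)%N ->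
     fixes_below k u -> Q u -> Q (u * sref n i)%g) ->
  forall u, fixes_below k u -> Q u.
Proof.
move=> Q1 QS u; elim/perm_ind: u => [|u i hi hup _ IH] hu //.
have ki : (k < i)%N.
  rewrite ltnNge; apply/negP => hik.
  have := hu i.-1; rewrite pvM => /(_ ltac:(lia)) /(congr1 (pv (sref n i))).
  rewrite -pvM sref_sq // pv1 pv_srefl // => e.
  have e2 : pv u^-1 i = i.-1 by apply: pvV_eq.
  have := hu (pv u^-1 i.-1); rewrite pvM pvVK pv_srefl // => /(_ ltac:(lia)) e3.
  by move: hup; rewrite e2 -e3; lia.
have hu' : fixes_below k u.
  move=> x hx; have := hu x hx; rewrite pvM => /(congr1 (pv (sref n i))).
  by rewrite -pvM sref_sq // pv1 pv_srefN //; lia.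
by apply: QS; rewrite ?ki //; [case/andP: hi|apply: IH].
Qed.

End FirstRest.

Section FirstPointDecomposition.
Variables (K : fieldType) (v : K) (n : nat).
Hypothesis v0 : v != 0.
Notation H := (heckeA v n).
Implicit Types (w u : 'S_n) (y z : H).
Notation g := (g v n).
Notation kap := (kap v).
Notation Gx := (Gx kap g).
Notation gIw := (gIw v).

Lemma T_gIw w : gT v w = v ^+ ell w *: gIw w.
Proof. by rewrite gIwE scalerA mulfV ?scale1r // expf_neq0. Qed.

Lemma eq_linear_gIw (V : lmodType K) (f f' : {linear H -> V}) :
  (forall w, f (gIw w) = f' (gIw w)) -> f =1 f'.
Proof. by move=> e; apply: eq_linear => w; rewrite T_gIw !linearZ /= e. Qed.

Definition lmulf (a : H) y : H := a * y.
Lemma lmulf_is_linear a : linear (lmulf a).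
Proof. by move=> c y z; rewrite /lmulf mulrDr scalerAr. Qed.
HB.instance Definition _ a := GRing.isLinear.Build K H H _ (lmulf a) (@lmulf_is_linear a).

Definition rmulf (a : H) y : H := y * a.
Lemma rmulf_is_linear a : linear (rmulf a).
Proof. by move=> c y z; rewrite /rmulf mulrDl scalerAl. Qed.
HB.instance Definition _ a := GRing.isLinear.Build K H H _ (rmulf a) (@rmulf_is_linear a).

Lemma gsE e j : gs kap g e j = g j - (if e then 0 else kap) *: 1.
Proof. by case: e => //=; rewrite scale0r subr0. Qed.

Lemma linear_gIw_l (f : {linear H -> H}) k :
  (forall j y, (k < j < n)%N -> f (g j * y) = g j * f y) ->
  forall u, fixes_below k u -> forall y, f (gIw u * y) = gIw u * f y.
Proof.
move=> hf u; elim/fixes_ind: u / => [y|u i hi hin hup hu IH y].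
  by rewrite gIw1 !mul1r.
by rewrite -gIw_up // -!mulrA IH // hf.
Qed.

Lemma linear_Gx_r (f : {linear H -> H}) e a b y :
  (forall j y, (a <= j < b)%N -> f (y * g j) = f y * g j) ->
  f (y * Gx e a b) = f y * Gx e a b.
Proof.
elim: b => [|b IH] hf; first by rewrite Gx_geq // !mulr1.
case: (leqP a b) => hab; last by rewrite Gx_geq // !mulr1.
have hb j z : (a <= j < b)%N -> f (z * g j) = f z * g j by move=> hj; apply: hf; lia.
have hbb z : f (z * g b) = f z * g b by apply: hf; rewrite hab leqnn.
rewrite Gx_recr // !mulrA -IH // gsE !mulrBr linearB -!scalerAr !mulr1 linearZ /=.
by rewrite hbb.
Qed.

Lemma gIw_first k p u : (k <= p < n)%N -> fixes_below k.+1 u ->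
  gIw (u * cyc n k.+1 p.+1)%g = gIw u * Gx true k.+1 p.+1.
Proof.
move=> hp hu; rewrite gIw_cycr // => x hx /=.
have -> : pv u^-1 k = k by apply: pvV_eq; rewrite hu.
rewrite ltnNge; apply/negP => h.
have : pv u (pv u^-1 x) = pv u^-1 x by apply: hu; lia.
by rewrite pvVK; lia.
Qed.

Lemma gIw_first_rest k w : (k < n)%N -> fixes_below k w ->
  gIw w = gIw (first_rest k w) * Gx true k.+1 (pv w k).+1.
Proof.
move=> kn hw; rewrite {1}(first_restE k w) gIw_first //.
  by rewrite fixes_le //= pv_lt.
exact: fixes_first_rest.
Qed.

End FirstPointDecomposition.

(** * The operator Lam on the Hecke algebra *)

Section AffineAction.
Variables (K : fieldType) (v : K) (m : nat).
Hypotheses (v0 : v != 0) (m0 : (0 < m)%N).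
Notation n := (m.*2).
Notation H := (heckeA v n).
Implicit Types (w u : 'S_n) (y z : H).
Notation g := (g v n).
Notation kap := (kap v).
Notation Gx := (Gx kap g).
Notation gIw := (gIw v).
Let g_sq := g_sq v0 (n := n).
Let g_br := g_braid v0 (n := n).
Let g_co := g_comm v0 (n := n).

(* The operator [Lam] is left linear for the parabolic of s_2, ..., s_{2m-1} and right linear
   for that of the s_j, j <> m; these are its values on the cycles I_1 ... I_p. *)
Definition lam_cyc p : H :=
  if (p < m)%N then - Gx true 1 p.+1 else Gx false 1 m.+1 * Gx true m.+1 p.+1.

(** [lext] prescribes values on T_w, whereas the intended formula is for I_w; the power of v
    converts one into the other. *)
Definition Lam : H -> H :=
  lext (fun w => v ^+ ell w *: (gIw (first_rest 0 w) * lam_cyc (pv w 0))).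
HB.instance Definition _ := GRing.Linear.on Lam.

Lemma fixes0 u : fixes_below 0 u. Proof. by []. Qed.

Lemma double_m_gt0 : (0 < n)%N. Proof. by rewrite double_gt0. Qed.

Lemma Lam_gIw w : Lam (gIw w) = gIw (first_rest 0 w) * lam_cyc (pv w 0).
Proof.
rewrite gIwE linearZ /= /Lam lextT scalerA mulVf ?scale1r //.
by rewrite expf_neq0.
Qed.

Lemma first_rest_mul p u : (p < n)%N -> fixes_below 1 u ->
  pv (u * cyc n 1 p.+1)%g 0 = p /\ first_rest 0 (u * cyc n 1 p.+1)%g = u.
Proof.
move=> hp hu; have e : pv (u * cyc n 1 p.+1)%g 0 = p.
  by rewrite pvM hu // pv_cyc.
by rewrite /first_rest e mulgK.
Qed.

Lemma Lam_first p u : (p < n)%N -> fixes_below 1 u ->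
  Lam (gIw u * Gx true 1 p.+1) = gIw u * lam_cyc p.
Proof.
move=> hp hu; have [e1 e2] := first_rest_mul hp hu.
by rewrite -gIw_first // Lam_gIw e1 e2.
Qed.

Lemma fixes_sref_mul k u j : (k < j < n)%N -> fixes_below k u -> fixes_below k (sref n j * u)%g.
Proof.
move=> hj hu x hx; have hj' : (0 < j < n)%N by lia.
by rewrite pvM pv_srefN ?hu //; lia.
Qed.

Lemma Lam_l j y : (1 < j < n)%N -> Lam (g j * y) = g j * Lam y.
Proof.
move=> hj; have hj' : (0 < j < n)%N by lia.
apply: (eq_linear_gIw v0 (f := Lam \o lmulf (g j)) (f' := lmulf (g j) \o Lam)) => w.
rewrite /= /lmulf {y}; have hp : (pv w 0 < n)%N by rewrite pv_lt double_m_gt0.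
have hu := fixes_first_rest double_m_gt0 (@fixes0 w); have ew := first_restE 0 w.
move: (pv w 0) (first_rest 0 w) hp hu ew => p u hp hu -> {w}.
set w := (u * _)%g.
have lt : (pv w j.-1 < pv w j)%N = (pv u j.-1 < pv u j)%N.
  have a1 : (0 < pv u j.-1)%N by apply: (fixes_le hu); lia.
  have a2 : (0 < pv u j)%N by apply: (fixes_le hu); lia.
  by rewrite !pvM pv_cyc_lt.
have hs : fixes_below 1 (sref n j * u)%g by apply: fixes_sref_mul.
have ew : gIw w = gIw u * Gx true 1 p.+1 by apply: gIw_first.
have esw : gIw (sref n j * w)%g = gIw (sref n j * u)%g * Gx true 1 p.+1.
  by rewrite -gIw_first // mulgA.
case: (ltngtP (pv u j.-1) (pv u j)) => h.
- by rewrite g_gIw_up ?lt // esw ew !Lam_first // mulrA g_gIw_up.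
- rewrite g_gIw_dn //; last first.
    by have := pvV_neq w hj'; rewrite neq_ltn lt ltnNge (ltnW h).
  rewrite linearD linearZ /= esw ew !Lam_first // mulrA g_gIw_dn //.
  by rewrite mulrDl scalerAl.
- by have := pvV_neq u hj'; rewrite h eqxx.
Qed.

Lemma fixes1 k : fixes_below k (1%g : 'S_n). Proof. by move=> x _; rewrite pv1. Qed.

Lemma Lam_Gx p : (p < n)%N -> Lam (Gx true 1 p.+1) = lam_cyc p.
Proof.
move=> hp; have := Lam_first hp (@fixes1 1).
by rewrite gIw1 !mul1r.
Qed.

(** By left linearity it suffices to treat I_1 ... I_p. For j < p or j > p+1 the letter moves to the
    left end with an index above 1; for j = p or p+1 the word is shortened or extended, and j <> m
    keeps it in the same branch of [lam_cyc]. *)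
Lemma Lam_r j y : (0 < j < n)%N -> j != m -> Lam (y * g j) = Lam y * g j.
Proof.
move=> hj jm.
apply: (eq_linear_gIw v0 (f := Lam \o rmulf (g j)) (f' := rmulf (g j) \o Lam)) => w.
rewrite /= /rmulf {y}; have h0 := double_m_gt0; have hp : (pv w 0 < n)%N by rewrite pv_lt.
have hu : fixes_below 1 (first_rest 0 w) by exact: (fixes_first_rest double_m_gt0 (@fixes0 w)).
have L z : Lam (gIw (first_rest 0 w) * z) = gIw (first_rest 0 w) * Lam z.
  exact: (linear_gIw_l Lam_l hu).
rewrite Lam_gIw (gIw_first_rest v0 h0 (@fixes0 w)) -!mulrA L; congr (_ * _).
move: (pv w 0) hp => p hp {L hu w}.
case: (ltngtP j p) => jp.
- have h1 : (j.+1 < p.+1)%N by lia.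
  have h2 : (1 < j.+1 < n)%N by lia.
  rewrite (Gx_g g_sq g_br g_co) //; last by case/andP: hj.
  rewrite Lam_l // Lam_Gx // /lam_cyc; case: ltnP => pm.
    by rewrite mulrN mulNr (Gx_g g_sq g_br g_co) //; case/andP: hj.
  apply: esym; have [jlt|jgt] : (j < m)%N \/ (m < j)%N by lia.
  + have c : GRing.comm (Gx true m.+1 p.+1) (g j).
      by apply: (Gx_comm_gs kap g_co _ true); lia.
    have [i1 i2 i3] : [/\ (1 <= j)%N, (j.+1 < m.+1)%N & (m.+1 <= n)%N] by split; lia.
    by rewrite -mulrA c mulrA (Gx_g g_sq g_br g_co) // mulrA.
  + have c : GRing.comm (Gx false 1 m.+1) (g j.+1).
      by apply: (Gx_comm_gs kap g_co _ true); lia.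
    rewrite -mulrA (Gx_g g_sq g_br g_co) //.
    by rewrite mulrA c mulrA.
- case: (eqVneq j p.+1) => [e|ne].
    have h1 : (p.+1 < n)%N by lia.
    have r : Gx true 1 p.+1 * g j = Gx true 1 p.+2 by rewrite e [RHS]Gx_recr.
    rewrite r Lam_Gx // /lam_cyc; case: ltnP => pm.
      by rewrite ifT ?mulNr ?r //; lia.
    rewrite ifF; last by lia.
    by rewrite e [Gx true _ p.+2]Gx_recr ?mulrA //; lia.
  have [h1 h2] : (1 < j < n)%N /\ (p.+1 < j)%N by lia.
  have c : GRing.comm (Gx true 1 p.+1) (g j).
    by apply: (Gx_comm_gs kap g_co _ true); lia.
  rewrite c Lam_l // Lam_Gx // /lam_cyc; case: ltnP => pm.
    by rewrite mulrN mulNr c.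
  have c1 : GRing.comm (g j) (Gx false 1 m.+1).
    by apply/commr_sym/(Gx_comm_gs kap g_co _ true); lia.
  have c2 : GRing.comm (g j) (Gx true m.+1 p.+1).
    by apply/commr_sym/(Gx_comm_gs kap g_co _ true); lia.
  exact: commrM.
- rewrite jp in jm hj *; case: p => [|p] in jp jm hj hp *; first by case/andP: hj.
  have pn : (p < n)%N by lia.
  have r a : (a <= p.+1)%N -> Gx true a p.+2 * g p.+1 = Gx true a p.+1 + kap *: Gx true a p.+2.
    by move=> ap; rewrite [Gx true a p.+2]Gx_recr // -mulrA g_sq // mulrDr mulr1 scalerAr.
  rewrite r // linearD linearZ /= !Lam_Gx // /lam_cyc.
  case: (ltnP p.+1 m) => pm.
    by rewrite ifT ?(ltnW pm) // mulNr r // opprD scalerN.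
  rewrite ifF; last by lia.
  rewrite -mulrA r; last by lia.
  by rewrite mulrDr scalerAr.
Qed.

Lemma Lam1 : Lam 1 = -1.
Proof.
have := Lam_first double_m_gt0 (@fixes1 1); rewrite gIw1 !mul1r Gx_nil => ->.
by rewrite /lam_cyc m0 Gx_nil.
Qed.

Lemma ltn_double_m : (m < n)%N. Proof. by move: m0; lia. Qed.

Lemma LamG : Lam (Gx true 1 m.+1) = Gx false 1 m.+1.
Proof. by rewrite Lam_Gx ?ltn_double_m // /lam_cyc ltnn Gx_nil mulr1. Qed.

End AffineAction.

(** * Coefficients and supports *)

Section Coefficients.
Variables (K : fieldType) (v : K) (n : nat).
Hypothesis v0 : v != 0.
Notation H := (heckeA v n).
Implicit Types (w u : 'S_n) (y z : H).
Notation g := (g v n).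
Notation s := (sref n).

Lemma rm_coef j y u : (0 < j < n)%N ->
  rm j y u = y u * cA v (ell u < ell (u * s j)%g)%N + y (u * s j)%g * cB v (ell (u * s j)%g < ell u)%N.
Proof.
move=> hj; rewrite [in LHS](heckeE y) linear_sum ffsum.
have E w : @rm K v n j (y w *: gT v w) u = (u == w)%:R * (y w * cA v (ell w < ell (w * s j)%g)%N) +
    (u == (w * s j)%g)%:R * (y w * cB v (ell w < ell (w * s j)%g)%N).
  rewrite linearZ /= ffZ rmT ffE !ffZ !TE mulrDr.
  by congr (_ + _); rewrite mulrA mulrC.
rewrite (eq_bigr _ (fun w _ => E w)) big_split /=; congr (_ + _).
  rewrite (bigD1 u) //= eqxx mul1r big1 ?addr0 // => w /negPf.
  by rewrite eq_sym => ->; rewrite mul0r.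
rewrite (bigD1 (u * s j)%g) //= mul_srefK // eqxx mul1r big1 ?addr0 // => w hw.
by case: eqP => [e|_]; [case/eqP: hw; rewrite e mul_srefK|rewrite mul0r].
Qed.

Lemma mul_g_coef j y u : (0 < j < n)%N ->
  (y * g j) u = v^-1 * (y u * cA v (ell u < ell (u * s j)%g)%N +
    y (u * s j)%g * cB v (ell (u * s j)%g < ell u)%N).
Proof. by move=> hj; rewrite gE // -scalerAr ffZ mul_Ts // rm_coef. Qed.

Lemma star_coef y u : star y u = y u^-1%g.
Proof.
rewrite [in LHS](heckeE y) linear_sum ffsum (bigD1 u^-1%g) //= linearZ /= ffZ starT TE invgK eqxx mulr1.
rewrite big1 ?addr0 // => w hw; rewrite linearZ /= ffZ starT TE.
by case: eqP => [e|_]; [case/eqP: hw; rewrite e invgK|rewrite mulr0].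
Qed.

Lemma g_mul_coef j y u : (0 < j < n)%N ->
  (g j * y) u = v^-1 * (y u * cA v (ell u < ell (s j * u)%g)%N +
    y (s j * u)%g * cB v (ell (s j * u)%g < ell u)%N).
Proof.
move=> hj; have := mul_g_coef (star y) u^-1%g hj.
rewrite -{1}(star_g v hj) -starM !star_coef invgK => ->.
by rewrite -[ell (u^-1 * _)%g]ellV !invMg !invgK !srefV // ellV.
Qed.

Definition supp (S : pred 'S_n) y := forall w, ~~ S w -> y w = 0.

Variable S : pred 'S_n.

Lemma suppD y z : supp S y -> supp S z -> supp S (y + z).
Proof. by move=> hy hz w hw; rewrite ffE hy // hz // addr0. Qed.

Lemma suppZ (c : K) y : supp S y -> supp S (c *: y).
Proof. by move=> hy w hw; rewrite ffZ hy // mulr0. Qed.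

Lemma supp0 : supp S 0.
Proof. by move=> w _; rewrite ff0. Qed.

Lemma suppT w : S w -> supp S (gT v w).
Proof. by move=> hw u hu; rewrite TE; case: eqP hu => // ->; rewrite hw. Qed.

Lemma supp_g_r j y : (0 < j < n)%N -> (forall w, S (w * s j)%g = S w) ->
  supp S y -> supp S (y * g j).
Proof. by move=> hj hS hy w hw; rewrite mul_g_coef // !hy ?hS // !mul0r addr0 mulr0. Qed.

Lemma supp_g_l j y : (0 < j < n)%N -> (forall w, S (s j * w)%g = S w) ->
  supp S y -> supp S (g j * y).
Proof. by move=> hj hS hy w hw; rewrite g_mul_coef // !hy ?hS // !mul0r addr0 mulr0. Qed.

End Coefficients.

Lemma sref_ltm n m j (x : nat) : (0 < j < n)%N -> j != m ->
  (pv (sref n j) x < m)%N = (x < m)%N.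
Proof.
move=> hj jm; rewrite pv_sref //; case: (eqVneq x j.-1) => [->|_]; first by lia.
by case: (eqVneq x j) => [->|//]; lia.
Qed.

Section Square.
Variables (K : fieldType) (v : K) (m : nat).
Hypotheses (v0 : v != 0) (m0 : (0 < m)%N).
Notation n := (m.*2).
Notation H := (heckeA v n).
Implicit Types (w u : 'S_n) (y z : H).
Notation g := (g v n).
Notation s := (sref n).
Notation kap := (kap v).
Notation Gx := (Gx kap g).
Notation gIw := (gIw v).
Notation Lam := (@Lam K v m).
Let g_sq := g_sq v0 (n := n).
Let g_br := g_braid v0 (n := n).
Let g_co := g_comm v0 (n := n).

Definition first_lo w := (pv w 0 < m)%N.
Notation P := (supp first_lo).

Lemma P_l j y : (1 < j < n)%N -> P y -> P (g j * y).
Proof.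
move=> hj; apply: supp_g_l => //; first by lia.
by move=> w; rewrite /first_lo pvM pv_srefN //; lia.
Qed.

Lemma P_r j y : (0 < j < n)%N -> j != m -> P y -> P (y * g j).
Proof.
move=> hj jm; apply: supp_g_r => // w.
by rewrite /first_lo pvM sref_ltm.
Qed.

Lemma P_one : P (1 : H).
Proof. by apply: suppT; rewrite /first_lo pv1. Qed.

Lemma P_gsr e j y : (0 < j < n)%N -> j != m -> P y -> P (y * gs kap g e j).
Proof.
move=> hj jm hy; rewrite gsE mulrBr -scalerAr mulr1 -scaleNr.
by apply: suppD; [apply: P_r|apply: suppZ].
Qed.

Lemma P_Gxr e a b y : (0 < a)%N -> (b <= m)%N || (m < a)%N -> (b <= n)%N -> P y -> P (y * Gx e a b).
Proof.
move=> a0; elim: b => [|b IH] hm hb hy; first by rewrite Gx_geq ?mulr1.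
case: (leqP a b) => hab; last by rewrite Gx_geq ?mulr1.
have [h1 h2] : (0 < b < n)%N /\ b != m by lia.
by rewrite Gx_recr // mulrA; apply: P_gsr => //; apply: IH => //; lia.
Qed.

Lemma P_gIw_l u y : fixes_below 1 u -> P y -> P (gIw u * y).
Proof.
move=> hu; elim/fixes_ind: u / hu y => [|u i hi hin hup hu IH] y hy; first by rewrite gIw1 mul1r.
by rewrite -gIw_up // -mulrA; apply/IH/P_l.
Qed.

(** Signs are changed one letter at a time, each at the cost of [kap] times the word with that
    letter omitted. Its two halves commute, so the half without I_1 may stand on the left and the
    other, with letters below m, on the right. *)
Lemma P_Gx_sub b : (0 < b <= m.+1)%N -> P ((Gx true 1 b - Gx false 1 b) * Gx true b m.+1).
Proof.
elim: b => // b IH hb; case: b => [|b] in IH hb *.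
  by rewrite !Gx_nil subrr mul0r; apply: supp0.
have hb' : (0 < b.+1 < n)%N by lia.
have [i1 i2] : (b.+1 <= m.+1)%N /\ (b.+1 < m.+1)%N by lia.
have -> : Gx true 1 b.+2 - Gx false 1 b.+2 =
    (Gx true 1 b.+1 - Gx false 1 b.+1) * g b.+1 + kap *: Gx false 1 b.+1.
  rewrite ![Gx _ 1 b.+2]Gx_recr // /gs /gi mulrBr mulrBl -scalerAr mulr1 opprB.
  by rewrite addrA addrAC.
rewrite mulrDl -mulrA -[g b.+1]/(gs kap g true b.+1) -Gx_recl // -scalerAl.
apply: suppD; first exact: IH.
apply: suppZ; have c : GRing.comm (Gx false 1 b.+1) (Gx true b.+2 m.+1).
  by apply: (Gx_comm_far kap g_co); lia.
rewrite c -[Gx true b.+2 m.+1]mulr1; apply: P_Gxr; try lia.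
apply: (P_Gx_l kap m0 (@suppD _ _ _ _) (@suppZ _ _ _ _) P_l) => //; try lia.
exact: P_one.
Qed.

Lemma P_Lam y : P (y - Lam y).
Proof.
have -> : y - Lam y = \sum_w (y w : K) *: (gT v w - Lam (gT v w)).
  rewrite [in LHS](heckeE y) (linear_sum Lam) -[LHS]/(_ + - _) -sumrN -big_split.
  by apply: eq_bigr => w _; rewrite linearZ /= -scalerBr.
apply: (big_ind P); [exact: supp0|exact: suppD|move=> w _]; apply: suppZ.
rewrite (T_gIw v0) linearZ /= -scalerBr; apply: suppZ.
have h0 := double_m_gt0 m0; have f0 := @fixes0 m w.
have hu := fixes_first_rest h0 f0.
have hp : (pv w 0 < n)%N by rewrite pv_lt.
rewrite Lam_gIw // {1}(gIw_first_rest v0 h0 f0) -mulrBr; apply: P_gIw_l => //.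
rewrite /lam_cyc; case: ltnP => pm.
  rewrite opprK; have h : P (Gx true 1 (pv w 0).+1).
    rewrite -[Gx _ _ _]mul1r; apply: P_Gxr; try lia.
    exact: P_one.
  exact: suppD.
have pm' : (1 <= m.+1 <= (pv w 0).+1)%N by lia.
rewrite (Gx_cat _ _ _ pm') -mulrBl; apply: P_Gxr; try lia.
have hm : (0 < m.+1 <= m.+1)%N by lia.
by have := P_Gx_sub hm; rewrite Gx_nil mulr1.
Qed.

(** Splitting off the images of the first two points leaves two cycles. Letters other than I_m at
    the right end are stripped by right linearity, and four products remain. *)
Lemma bimodule_generators (f : {linear H -> H}) :
  (forall j y, (2 < j < n)%N -> f (g j * y) = g j * f y) ->
  (forall j y, (0 < j < n)%N -> j != m -> f (y * g j) = f y * g j) ->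
  f 1 = 0 -> f (Gx true 2 m.+1) = 0 -> f (Gx true 1 m.+1) = 0 ->
  ((1 < m)%N -> f (Gx true 2 m.+2 * Gx true 1 m.+1) = 0) ->
  forall y, f y = 0.
Proof.
move=> fl fr f1 f2 f3 f4.
have fG e a b y : (0 < a)%N -> (b <= m)%N || (m < a)%N -> (b <= n)%N -> f y = 0 -> f (y * Gx e a b) = 0.
  move=> a0 hab hb hy; rewrite linear_Gx_r ?hy ?mul0r // => j z hj.
  by apply: fr; lia.
apply: (eq_linear_gIw v0 (f' := \0)) => w /=.
have h0 := double_m_gt0 m0; have f0 := @fixes0 m w.
have hu := fixes_first_rest h0 f0.
have hp : (pv w 0 < n)%N by rewrite pv_lt.
rewrite (gIw_first_rest v0 h0 f0); move: (first_rest 0 w) (pv w 0) hu hp => u p hu hp {f0 w}.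
have n1 : (1 < n)%N by lia.
have hu2 := fixes_first_rest n1 hu.
have hp' : (0 < pv u 1 < n)%N by rewrite pv_lt (fixes_le hu) //=; lia.
rewrite (gIw_first_rest v0 n1 hu); move: (first_rest 1 u) (pv u 1) hu2 hp' => u2 p' hu2 hp' {hu u}.
rewrite -mulrA (linear_gIw_l fl hu2) [f _](_ : _ = 0) ?mulr0 // {u2 hu2}.
have hp2 : (p < n)%N by lia.
case: (ltnP p m) => pm.
  apply: (fG); try lia.
  case: (ltnP p' m) => pm'; first by have := fG true 2 p'.+1 1; rewrite mul1r; apply=> //; lia.
  have c : (2 <= m.+1 <= p'.+1)%N by lia.
  by rewrite (Gx_cat _ _ _ c); apply: (fG); try lia.
have c : (1 <= m.+1 <= p.+1)%N by lia.
rewrite (Gx_cat _ _ _ c) mulrA; apply: (fG); try lia.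
case: (ltnP m p') => pm'.
  have c2 : (2 <= m.+2 <= p'.+1)%N by lia.
  have cc : GRing.comm (Gx true m.+2 p'.+1) (Gx true 1 m.+1).
    by apply/commr_sym/(Gx_comm_far kap g_co); lia.
  by rewrite (Gx_cat _ _ _ c2) -mulrA cc mulrA; apply: (fG); try (apply: f4); lia.
case: p' => [|p'] in hp' pm' *; first lia.
(* The shorter word is pushed to the right through I_1 ... I_m; its letters drop below m and are
   stripped. *)
rewrite -(Gx_Gx g_sq g_br g_co) //; try lia.
by apply: (fG); try lia.
Qed.

Notation hh := (hh kap m g m).

Lemma P_hh2 : P (hh * hh).
Proof.
apply: (P_hh_sq m0 g_sq g_br g_co (Lam := Lam)).
- by move=> j y; exact: Lam_l.
- by move=> j y; exact: Lam_r.
- exact: Lam1.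
- exact: LamG.
- exact: bimodule_generators.
- exact: suppD.
- exact: suppZ.
- exact: P_l.
- exact: P_r.
- exact: P_Lam.
Qed.

(** Conjugation by t_1 on the indices of the simple reflections of the Young subgroup. *)
Definition young_swap j := if (j < m)%N then (j + m)%N else (j - m)%N.

Lemma hh_g j : (0 < j < n)%N -> j != m -> hh * g j = g (young_swap j) * hh.
Proof.
move=> hj jm; rewrite /young_swap; case: ltnP => h.
  by rewrite (hh_g_lo g_sq g_br g_co) //; lia.
have -> : j = (m + (j - m))%N by lia.
by rewrite (hh_g_hi g_sq g_br g_co) ?addKn //; lia.
Qed.

Lemma young_swapK j : (0 < j < n)%N -> j != m -> [/\ (0 < young_swap j < n)%N, young_swap j != m & young_swap (young_swap j) = j].
Proof. by move=> hj jm; rewrite /young_swap; case: (ltnP j m) => h; split; try (case: ifP); lia. Qed.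

Lemma young_lo w : (forall x, (x < m)%N -> (pv w x < m)%N) -> forall x, (pv w x < m)%N = (x < m)%N.
Proof.
move=> h x; apply/idP/idP; last exact: h.
have inj : injective (fun a : 'I_m => Ordinal (h a (ltn_ord a))).
  by move=> a b /(congr1 val) /= /(@pv_inj _ w) e; apply: val_inj.
move=> hx; have [f' _ fK] := injF_bij inj.
have /(congr1 val) /= := fK (Ordinal hx) => /(@pv_inj _ w) <-.
exact: ltn_ord.
Qed.

(* An element supported on [pv w 0 < m] and commuting with the Young subalgebra is supported on
   the Young subgroup: conjugation moves the condition from point 0 to all points below m. *)
Lemma supp_young y : P y ->
  (forall j, (0 < j < n)%N -> j != m -> g j * y = y * g j) ->
  forall w, y w != 0 -> forall x, (pv w x < m)%N = (x < m)%N.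
Proof.
move=> Py yc w hw; apply: young_lo => x; elim: x w hw => [|x IH] w hw hx.
  by apply: contraNT hw => h; apply/eqP/Py.
rewrite ltnNge; apply/negP => hge.
have [hj jm] : (0 < x.+1 < n)%N /\ x.+1 != m by lia.
have hx' : (x < m)%N by lia.
have lt : (pv w x < pv w x.+1)%N by have := IH w hw hx'; lia.
have Z u : (m <= pv u x)%N -> y u = 0.
  by move=> h; apply/eqP/negPn/negP => /IH /(_ hx'); lia.
(* The coefficients of g y = y g are compared at this permutation: on the left only y(w) survives,
   and on the right nothing does, since both permutations involved send x to m or beyond. *)
pose u := (s x.+1 * w)%g.
have ux : pv u x = pv w x.+1 by rewrite pvM pv_srefl.
have e1 : (g x.+1 * y) u = v^-1 * y w.
  rewrite g_mul_coef // (Z u) ?ux // mul0r add0r sref_mulK // /cB.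
  by rewrite ell_sref_mul_ltE // lt mulr1.
have e2 : (y * g x.+1) u = 0.
  have hu : (m <= pv u x)%N by rewrite ux.
  have hus : (m <= pv (u * s x.+1)%g x)%N by rewrite pvM leqNgt sref_ltm // -leqNgt.
  by rewrite mul_g_coef // !Z // !mul0r addr0 mulr0.
move: e1; rewrite yc // e2 => /esym/eqP; rewrite mulf_eq0 invr_eq0 (negPf v0) /=.
exact/negP.
Qed.

Lemma hh2_young w : (hh * hh) w != 0 -> forall x, (pv w x < m)%N = (x < m)%N.
Proof.
apply: supp_young; first exact: P_hh2.
move=> j hj jm; have [h1 h2 h3] := young_swapK hj jm.
by rewrite -mulrA hh_g // mulrA hh_g // h3 mulrA.
Qed.

End Square.

(** * Lattices over Laurent polynomials and the bar involution *)

Section Lattice.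
Variables (K : fieldType) (v : K) (n : nat) (Lau : K -> Prop).
Hypothesis v0 : v != 0.
Hypothesis LauD : forall x y, Lau x -> Lau y -> Lau (x + y).
Hypothesis LauM : forall x y, Lau x -> Lau y -> Lau (x * y).
Hypothesis LauN : forall x, Lau x -> Lau (- x).
Hypothesis Lau0 : Lau 0.
Hypothesis Lau1 : Lau 1.
Hypothesis Lauv : Lau v.
Hypothesis LauV : Lau v^-1.
Notation H := (heckeA v n).
Implicit Types (w u : 'S_n) (y z : H) (S : pred 'S_n).
Notation g := (g v n).
Notation kap := (kap v).
Notation gIw := (gIw v).
Notation s := (sref n).

Lemma LauX x k : Lau x -> Lau (x ^+ k).
Proof. by move=> hx; elim: k => [|k IH]; rewrite ?expr0 ?exprS //; apply: LauM. Qed.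

Lemma LauVX k : Lau (v ^- k).
Proof. by rewrite -exprVn; apply: LauX. Qed.

Lemma Lau_kap : Lau kap.
Proof. by apply: LauD => //; apply: LauN. Qed.

Lemma Lau_cA b : Lau (cA v b).
Proof. by case: b => //=; apply: LauD; [apply: LauX|apply: LauN]. Qed.

Lemma Lau_cB b : Lau (cB v b).
Proof. by case: b => //=; apply: LauX. Qed.

(** Coefficients are those in the basis T_w; as v is a unit for [Lau], the basis I_w spans the same
    lattice. *)
Definition lat S y := (forall w, Lau (y w)) /\ supp S y.

Lemma latD S y z : lat S y -> lat S z -> lat S (y + z).
Proof. by move=> [h1 h2] [h3 h4]; split; [move=> w; rewrite ffE; apply: LauD|apply: suppD]. Qed.

Lemma latZ S c y : Lau c -> lat S y -> lat S (c *: y).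
Proof. by move=> hc [h1 h2]; split; [move=> w; rewrite ffZ; apply: LauM|apply: suppZ]. Qed.

Lemma latN S y : lat S y -> lat S (- y).
Proof. by rewrite -scaleN1r; apply: latZ; apply: LauN. Qed.

Lemma latB S y z : lat S y -> lat S z -> lat S (y - z).
Proof. by move=> h1 h2; apply: latD => //; apply: latN. Qed.

Lemma lat0 S : lat S 0.
Proof. by split=> [w|]; [rewrite ff0|apply: supp0]. Qed.

Lemma latT S w : S w -> lat S (gT v w).
Proof. by move=> hw; split; [move=> u; rewrite TE; case: (_ == _)|apply: suppT]. Qed.

Lemma lat_gIw S w : S w -> lat S (gIw w).
Proof. by move=> hw; rewrite gIwE; apply: latZ; [apply: LauVX|apply: latT]. Qed.

Lemma lat_sub (S S' : pred 'S_n) y : (forall w, S w -> S' w) -> lat S y -> lat S' y.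
Proof.
move=> h [h1 h2]; split=> // w hw; apply: h2; apply: contra hw; exact: h.
Qed.

Lemma lat_g S j y : (0 < j < n)%N -> (forall w, S (w * s j)%g = S w) ->
  lat S y -> lat S (y * g j).
Proof.
move=> hj hS [h1 h2]; split; last exact: supp_g_r.
move=> w; rewrite mul_g_coef //; apply: LauM => //.
by apply: LauD; apply: LauM => //; [apply: Lau_cA|apply: Lau_cB].
Qed.

(** What the inductions along reduced words need of a standard parabolic subgroup: closure under
    prefixes, and stability under the letters that occur. It is applied to the whole group and to
    the Young subgroup. *)
Definition parabolic S := S 1%g /\ forall u i, (0 < i < n)%N ->
  (pv u^-1 i.-1 < pv u^-1 i)%N -> S (u * s i)%g -> S u /\ forall w, S (w * s i)%g = S w.

Lemma lat_mul_gIw S y w : parabolic S -> S w -> lat S y -> lat S (y * gIw w).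
Proof.
move=> [_ hS]; elim/perm_ind: w => [|w i hi hup _ IH] hw hy; first by rewrite gIw1 mulr1.
have [hw' hSi] := hS _ _ hi hup hw.
by rewrite -gIw_up // mulrA; apply: lat_g => //; apply: IH.
Qed.

Lemma lat_mul S y z : parabolic S -> lat S y -> lat S z -> lat S (y * z).
Proof.
move=> pS hy [h1 h2]; rewrite (heckeE z) mulr_sumr.
apply: (big_ind (lat S)); [exact: lat0|exact: latD|move=> w _].
rewrite -scalerAr; case: (boolP (S w)) => hw; last by rewrite h2 // scale0r; apply: lat0.
apply: latZ => //; rewrite T_gIw // -scalerAr; apply: latZ; first exact: LauX.
exact: lat_mul_gIw.
Qed.

Lemma parabolicT : parabolic predT. Proof. by []. Qed.

Lemma lat_span S y : lat S y -> y = \sum_(w | S w) (y w * v ^+ ell w) *: gIw w.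
Proof.
move=> [_ h]; rewrite [in LHS](heckeE y) (bigID S) /= [X in _ + X]big1 ?addr0.
  by apply: eq_bigr => w _; rewrite T_gIw // scalerA.
by move=> w hw; rewrite h // scale0r.
Qed.

Lemma lat_coef S y w : lat S y -> Lau (y w * v ^+ ell w).
Proof. by move=> [h _]; apply: LauM => //; apply: LauX. Qed.

Definition gbarI w : H := \prod_(i <- redword w) gi kap g i.

Lemma gbarI1 : gbarI 1%g = 1.
Proof. by rewrite /gbarI redword1 big_nil. Qed.

Lemma gbarI_rcons w i : redword (w * s i)%g = rcons (redword w) i ->
  gbarI (w * s i)%g = gbarI w * gi kap g i.
Proof. by move=> e; rewrite /gbarI e big_rcons /=. Qed.

(** Multiplying I_y, y < w, by I_i^{-1} gives I_{y s_i}, with a multiple of I_y subtracted when s_i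
    lengthens y. Both y and y s_i lie below w s_i, the latter by the lifting property. *)
Lemma gbarI_lower S w : parabolic S -> S w ->
  lat (fun u => S u && bruhat_lt u w) (gbarI w - gIw w).
Proof.
move=> [S1 hS]; elim/perm_ind: w => [|w i hi hup hr IH] hw.
  by rewrite gbarI1 gIw1 subrr; apply: lat0.
have [hw' hSi] := hS _ _ hi hup hw; have {}IH := IH hw'.
have lt : (ell w < ell (w * s i)%g)%N by rewrite ell_mul_sref_up.
have le := bruhat_le_up hi lt.
have low (y : 'S_n) : bruhat_le y w -> bruhat_lt y (w * s i)%g.
  move=> hy; rewrite /bruhat_lt (bruhat_le_trans hy le) /=.
  by apply: contraTneq (bruhat_le_ell hy) => ->; rewrite -ltnNge.
rewrite gbarI_rcons // -(subrK (gIw w) (gbarI w)) mulrDl -addrA; apply: latD; last first.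
  rewrite /gi mulrBr gIw_up // -scalerAr mulr1 addrAC subrr add0r -scaleNr.
  apply: latZ; first exact/LauN/Lau_kap.
  by apply: lat_gIw; rewrite hw' low // bruhat_le_refl.
rewrite (lat_span IH) mulr_suml; apply: (big_ind (lat _)); [exact: lat0|exact: latD|].
move=> y /andP[hy /andP[hyw ne]]; rewrite -scalerAl; apply: latZ.
  exact: lat_coef IH.
have hS1 : lat (fun u => S u && bruhat_lt u (w * s i)%g) (gIw y).
  by apply: lat_gIw; rewrite hy low.
have hS2 : lat (fun u => S u && bruhat_lt u (w * s i)%g) (gIw (y * s i)%g).
  apply: lat_gIw; rewrite hSi hy /= /bruhat_lt bruhat_le_mul_sref //=.
  by apply: contraNneq ne => /mulIg ->.
have := pvV_neq y^-1 hi; rewrite neq_ltn => /orP[h|h].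
  rewrite /gi mulrBr gIw_up // -scalerAr mulr1.
  by apply: latB => //; apply: latZ => //; apply: Lau_kap.
by rewrite /gi mulrBr gIw_dn // -scalerAr mulr1 addrK.
Qed.

End Lattice.

(** * The bar involution *)

Section Bar.
Variables (K : fieldType) (v : K) (m : nat) (sig : {rmorphism K -> K}).
Notation n := (m.*2).
Hypothesis v0 : v != 0.
Hypothesis sigv : sig v = v^-1.
Notation H := (heckeA v n).
Implicit Types (w u : 'S_n) (y z : H).
Notation g := (g v n).
Notation kap := (kap v).
Notation gi := (gi kap g).
Notation gs := (gs kap g).
Notation gIw := (gIw v).
Notation gbarI := (@gbarI K v n).
Notation s := (sref n).

Lemma sig_kap : sig kap = - kap.
Proof. by rewrite /kap rmorphB /= fmorphV sigv invrK opprB. Qed.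

(** Inverses are unique, so this removes the dependence of [gbarI] on the reduced word chosen;
    [gbarI_up] then holds for every lengthening letter. *)
Lemma gbarI_inv w : gbarI w * gIw w^-1%g = 1 /\ gIw w^-1%g * gbarI w = 1.
Proof.
elim/perm_ind: w => [|w i hi hup hr [IH1 IH2]]; first by rewrite gbarI1 invg1 gIw1 mulr1.
have e : gIw (w * s i)^-1%g = g i * gIw w^-1%g.
  by rewrite invMg srefV // g_gIw_up.
rewrite e gbarI_rcons //; split.
  by rewrite mulrA -(mulrA _ (gi i)) (gi_g (g_sq v0 (n := n))) // mulr1.
by rewrite mulrA -(mulrA (g i)) IH2 mulr1 (g_gi (g_sq v0 (n := n))).
Qed.

Lemma gbarI_up w i : (0 < i < n)%N -> (pv w^-1 i.-1 < pv w^-1 i)%N ->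
  gbarI (w * s i)%g = gbarI w * gi i.
Proof.
move=> hi hup; have [h1 _] := gbarI_inv (w * s i)%g; have [h3 h4] := gbarI_inv w.
rewrite -[LHS]mulr1 -[X in _ * X = _](g_gi (g_sq v0 (n := n)) hi) mulrA; congr (_ * _).
rewrite -[RHS]mul1r -h1 -mulrA; congr (_ * _).
by rewrite invMg srefV // -g_gIw_up // -mulrA h4 mulr1.
Qed.

Definition bar y : H := \sum_w sig (y w * v ^+ ell w) *: gbarI w.

Lemma barD y z : bar (y + z) = bar y + bar z.
Proof.
rewrite /bar -big_split; apply: eq_bigr => w _ /=.
by rewrite ffE mulrDl rmorphD scalerDl.
Qed.

Lemma barZ c y : bar (c *: y) = sig c *: bar y.
Proof.
rewrite /bar scaler_sumr; apply: eq_bigr => w _ /=.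
by rewrite ffZ -mulrA rmorphM scalerA.
Qed.

Lemma bar0 : bar 0 = 0.
Proof. by have := barZ 0 0; rewrite scale0r rmorph0 scale0r. Qed.

Lemma barN y : bar (- y) = - bar y.
Proof. by rewrite -scaleN1r barZ rmorphN1 scaleN1r. Qed.

Lemma bar_sum I (r : seq I) (P : pred I) (f : I -> H) :
  bar (\sum_(i <- r | P i) f i) = \sum_(i <- r | P i) bar (f i).
Proof. exact: (big_morph bar barD bar0). Qed.

Lemma bar_gIw w : bar (gIw w) = gbarI w.
Proof.
rewrite /bar (bigD1 w) //= gIwE ffZ TE eqxx mulr1 mulVf ?expf_neq0 // rmorph1 scale1r.
rewrite big1 ?addr0 // => u hu.
by rewrite ffZ TE (negPf hu) mulr0 mul0r rmorph0 scale0r.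
Qed.

Lemma bar1 : bar 1 = 1.
Proof. by rewrite -(gIw1 v n) bar_gIw gbarI1 gIw1. Qed.

Lemma bar_g i : (0 < i < n)%N -> bar (g i) = gi i.
Proof.
move=> hi; rewrite -gIw_sref bar_gIw -[s i]mul1g gbarI_up // ?gbarI1 ?mul1r //.
by rewrite invg1 !pv1; lia.
Qed.

Lemma bar_mul_g y i : (0 < i < n)%N -> bar (y * g i) = bar y * gi i.
Proof.
move=> hi; rewrite [in LHS](heckeE y) mulr_suml bar_sum [in RHS](heckeE y) bar_sum mulr_suml.
apply: eq_bigr => w _; rewrite -scalerAl !barZ -scalerAl; congr (_ *: _).
rewrite T_gIw // -scalerAl !barZ -scalerAl; congr (_ *: _); rewrite bar_gIw.
have := pvV_neq w^-1 hi; rewrite neq_ltn => /orP[h|h].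
  by rewrite gIw_up // bar_gIw gbarI_up.
rewrite gIw_dn // barD barZ !bar_gIw sig_kap.
have h' : (pv (w * s i)^-1 i.-1 < pv (w * s i)^-1 i)%N.
  by rewrite invMg srefV // !pvM pv_srefl // pv_srefr.
have e : gbarI w = gbarI (w * s i)%g * gi i by rewrite -gbarI_up // mul_srefK.
rewrite !e -mulrA.
have -> : gi i * gi i = 1 - kap *: gi i.
  by rewrite {1}/gi mulrBl (g_gi (g_sq v0 (n := n))) // -scalerAl mul1r.
by rewrite [RHS]mulrBr mulr1 scaleNr -scalerAr.
Qed.

Lemma barM y z : bar (y * z) = bar y * bar z.
Proof.
rewrite (heckeE z) mulr_sumr !bar_sum mulr_sumr; apply: eq_bigr => w _.
rewrite -scalerAr !barZ -scalerAr; congr (_ *: _).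
rewrite T_gIw // -scalerAr !barZ -scalerAr; congr (_ *: _) => {z}.
elim/perm_ind: w y => [|w i hi hup _ IH] y; first by rewrite gIw1 mulr1 bar1 mulr1.
by rewrite -gIw_up // mulrA !bar_mul_g // IH mulrA.
Qed.

Lemma bar_gs e i : (0 < i < n)%N -> bar (gs e i) = gs (~~ e) i.
Proof.
move=> hi; case: e; rewrite /gs /= ?bar_g //.
by rewrite /gi barD barN barZ bar1 sig_kap bar_g // /gi scaleNr opprK subrK.
Qed.

Lemma bar_Gx e a b : (0 < a)%N -> (b <= n)%N -> bar (Gx kap g e a b) = Gx kap g (~~ e) a b.
Proof.
move=> a0; elim: b => [|b IH] hb; first by rewrite !Gx_geq // bar1.
case: (leqP a b) => hab; last by rewrite !Gx_geq // bar1.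
have hb' : (0 < b < n)%N by rewrite hb (leq_trans a0).
by rewrite !Gx_recr // barM IH ?(ltnW hb) // bar_gs.
Qed.

End Bar.

(** * The longest element of the second factor and bar invariance of b_1 *)

Section LongestElement.
Variable m : nat.
Notation n := (m.*2).

(* Longest element of the symmetric group on the points m, ..., m + k - 1. *)
Fixpoint w0hi k : 'S_n := if k is k'.+1 then (cyc n m.+1 (m + k').+1 * w0hi k')%g else 1%g.

Lemma pv_w0hi k (x : nat) : (k <= m)%N ->
  pv (w0hi k) x = if (m <= x < m + k)%N then (m + m + k - x.+1)%N else x.
Proof.
elim: k x => [|k IH] x hk; first by rewrite pv1 ifF //; lia.
have hb : (m.+1 <= (m + k).+1 <= n)%N by lia.
rewrite pvM pv_cyc // IH ?(ltnW hk) //=.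
case: (eqVneq x m) => [->|xm].
  by rewrite ifF; [rewrite ifT; lia|lia].
case: (boolP (m < x < (m + k).+1)%N) => hx.
  by rewrite !ifT; lia.
by rewrite !ifF; lia.
Qed.

Lemma w0hiV k : (k <= m)%N -> (w0hi k)^-1%g = w0hi k.
Proof.
move=> hk; apply/eqP; rewrite eq_invg_mul; apply/eqP/pv_perm => x hx.
rewrite pvM pv1 !pv_w0hi //; case: (boolP (m <= x < m + k)%N) => h.
  by rewrite ifT; lia.
by rewrite ifF //; apply/negP/negP.
Qed.

End LongestElement.

Section BarInvariance.
Variables (K : fieldType) (v : K) (m : nat) (sig : {rmorphism K -> K}).
Hypothesis v0 : v != 0.
Hypothesis sigv : sig v = v^-1.
Notation n := (m.*2).
Notation H := (heckeA v n).
Implicit Types (w u : 'S_n) (y z : H).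
Notation g := (g v n).
Notation kap := (kap v).
Notation Gx := (Gx kap g).
Notation gIw := (gIw v).
Notation gbarI := (@gbarI K v n).
Notation bar := (@bar K v m sig).
Notation J := (J m g).
Notation D := (D kap m g).
Notation hh := (hh kap m g).
Let g_sq := g_sq v0 (n := n).
Let g_br := g_braid v0 (n := n).
Let g_co := g_comm v0 (n := n).

Notation w0hi := (w0hi m).
Notation gam k := (gIw (w0hi k)).

Lemma gamS k : (k < m)%N -> gam k.+1 = Gx true m.+1 (m + k).+1 * gam k.
Proof.
move=> hk; have hb : (m.+1 <= (m + k).+1 <= n)%N by lia.
rewrite gIw_cycl // => x hx; rewrite !pv_w0hi ?(ltnW hk) //=.
rewrite [X in (_ < X)%N]ifF; last by lia.
by case: ifP => h; lia.
Qed.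

Lemma J_star k : (k < m)%N ->
  star (Gx true m.+1 (m + k).+1) * Gx true m.+1 (m + k).+1 = J k.
Proof.
elim: k => [|k IH] hk; first by rewrite addn0 Gx_nil star1 mulr1.
have h1 : (m.+1 <= (m + k).+1)%N by lia.
have h2 : (0 < m + k.+1 < n)%N by lia.
have e : Gx true m.+1 (m + k.+1).+1 = Gx true m.+1 (m + k).+1 * g (m + k.+1).
  by rewrite addnS Gx_recr.
by rewrite e starM star_g // JS -IH ?(ltnW hk) // !mulrA.
Qed.

Fixpoint PJ k : H := if k is k'.+1 then J k' * PJ k' else 1.

Lemma comm_gam k y : (k <= m)%N -> (forall j, (m < j < m + k)%N -> GRing.comm y (g j)) ->
  GRing.comm y (gam k).
Proof.
elim: k => [|k IH] hk hy; first by rewrite gIw1; apply: commr1.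
rewrite gamS //; apply: commrM.
  by apply: comm_Gx => j hj; apply: hy; lia.
by apply: IH => [|j hj]; [exact: ltnW|apply: hy; lia].
Qed.

(** [w0hi k] is an involution, so [gam] is fixed by [star]. With G the cycle word that extends it,
    the square of the next one is [gam k * (star G * G) * gam k], whose middle is [J k] by [J_star]
    and commutes with [gam k]. *)
Lemma gam_sq k : (k <= m)%N -> gam k * gam k = PJ k.
Proof.
elim: k => [|k IH] hk; first by rewrite gIw1 mulr1.
have e : gam k.+1 = gam k * star (Gx true m.+1 (m + k).+1).
  by rewrite -{1}(w0hiV hk) -star_gIw gamS // starM star_gIw w0hiV ?(ltnW hk).
rewrite {1}e gamS // -mulrA (mulrA (star _)) J_star //.
have c : GRing.comm (J k) (gam k).
  apply: comm_gam => [|j hj]; first exact: ltnW.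
  have -> : j = (m + (j - m))%N by lia.
  by apply: (J_g_hi g_br g_co); lia.
by rewrite mulrA -c -mulrA IH ?(ltnW hk).
Qed.

Lemma J_PJ i k : (i < m)%N -> (k <= m)%N -> GRing.comm (J i) (PJ k).
Proof.
move=> hi; elim: k => [|k IH] hk; first exact: commr1.
by apply: commrM; [apply: (J_comm g_br g_co)|apply: IH; exact: ltnW].
Qed.

Lemma bar_J k : (k < m)%N -> bar (J k) * J k = 1.
Proof.
elim: k => [|k IH] hk; first by rewrite bar1 // mulr1.
have h : (0 < m + k.+1 < n)%N by lia.
have e y : gi kap g (m + k.+1) * (g (m + k.+1) * y) = y by rewrite mulrA (gi_g g_sq) // mul1r.
rewrite JS !barM // !bar_g // -!mulrA e.
by rewrite (mulrA (bar _)) IH ?(ltnW hk) // mul1r (gi_g g_sq).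
Qed.

(* bar exchanges the factors [D true] and [D false], and since bar (J i) J i = 1 the factor [PJ
   k] moves each [J i] to the other summand. *)
Lemma bar_hh k : (k <= m)%N -> bar (hh k) * PJ k = hh k.
Proof.
elim: k => [|k IH] hk; first by rewrite bar1 // mulr1.
have IH' := IH (ltnW hk).
have h : (m + k.+1 <= n)%N by lia.
have hD e : bar (D e k.+1) = D (~~ e) k.+1 by apply: bar_Gx.
rewrite hhS barD !barM // !hD /= mulrDl -!mulrA (mulrA (bar (J k))) bar_J // mul1r IH' addrC.
by congr (_ + _); rewrite (J_PJ hk (ltnW hk)) (mulrA (bar _)) IH'.
Qed.

Definition gb1 : H := hh m * gbarI (w0hi m).

Lemma gbarI_w0hi : gbarI (w0hi m) * gam m = 1 /\ gam m * gbarI (w0hi m) = 1.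
Proof. by have := gbarI_inv v0 (w0hi m); rewrite w0hiV. Qed.

Lemma bar_gb1 : bar gb1 = gb1.
Proof.
have [h1 h2] := gbarI_w0hi.
have hb : bar (gbarI (w0hi m)) = gam m.
  have e : bar (gam m) * bar (gbarI (w0hi m)) = 1 by rewrite -barM // h2 bar1.
  rewrite bar_gIw // in e.
  by rewrite -[LHS]mul1r -h2 -mulrA e mulr1.
have e2 : PJ m * gbarI (w0hi m) = gam m by rewrite -gam_sq // -mulrA h2 mulr1.
by rewrite /gb1 barM // hb -e2 mulrA bar_hh.
Qed.

End BarInvariance.

Lemma youngP m (w : 'S_(m.*2)) : reflect (forall x, (pv w x < m)%N = (x < m)%N) (young m w).
Proof.
apply: (iffP forallP) => [h x|h j]; last by rewrite -pv_ord h.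
case: (ltnP x m.*2) => hx; last by rewrite pv_out.
by have /eqP := h (Ordinal hx); rewrite -pv_ord.
Qed.

Lemma young1 m : young m 1%g.
Proof. by apply/youngP => x; rewrite pv1. Qed.

Lemma youngM m (w u : 'S_(m.*2)) : young m u -> young m (w * u)%g = young m w.
Proof.
move=> /youngP hu; apply/youngP/youngP => h x; last by rewrite pvM hu h.
by rewrite -hu -pvM h.
Qed.

Lemma young_parabolic m : (0 < m)%N -> parabolic (young m).
Proof.
move=> m0; split=> [|u i hi hup hus]; first exact: young1.
(* If i were m, membership of u s_m would put the preimage of m-1 under u at m or beyond and that of
   m below m, against [hup]. *)
have him : i != m.
  apply/eqP => e; rewrite e in hi hup hus; move: hup.
  have /youngP h := hus.
  have := h (pv u^-1%g m.-1); rewrite pvM pvVK pv_srefl // ltnn => /esym h1.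
  have := h (pv u^-1%g m); rewrite pvM pvVK pv_srefr // prednK // leqnn => /esym h2.
  by move: h1 => /negbT; rewrite -leqNgt; lia.
have H w : young m (w * sref m.*2 i)%g = young m w.
  apply: youngM; apply/youngP => x; exact: sref_ltm.
by split=> //; rewrite -H.
Qed.

Lemma youngV m (w : 'S_(m.*2)) : young m w -> young m w^-1%g.
Proof. by move=> hw; rewrite -(youngM _ hw) mulVg young1. Qed.

Lemma young_w0hi m : (0 < m)%N -> young m (w0hi m m).
Proof. by move=> m0; apply/youngP => x; rewrite pv_w0hi //; case: ifP; lia. Qed.

(** * The span of the wreath product basis is a subalgebra *)

Section Span.
Variables (K : fieldType) (v : K) (m : nat) (Lau : K -> Prop).
Hypotheses (v0 : v != 0) (m0 : (0 < m)%N).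
Hypothesis LauD : forall x y, Lau x -> Lau y -> Lau (x + y).
Hypothesis LauM : forall x y, Lau x -> Lau y -> Lau (x * y).
Hypothesis LauN : forall x, Lau x -> Lau (- x).
Hypothesis Lau0 : Lau 0.
Hypothesis Lau1 : Lau 1.
Hypothesis Lauv : Lau v.
Hypothesis LauV : Lau v^-1.
Notation n := (m.*2).
Notation H := (heckeA v n).
Implicit Types (w u : 'S_n) (y z : H).
Notation g := (g v n).
Notation kap := (kap v).
Notation gs := (gs kap g).
Notation Gx := (Gx kap g).
Notation gIw := (gIw v).
Notation gbarI := (@gbarI K v n).
Notation J := (J m g).
Notation D := (D kap m g).
Notation hh := (hh kap m g).
Notation s := (sref n).
Notation lat := (lat Lau).
Notation gam := (gIw (w0hi m m)).
Notation gb1 := (gb1 v m).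
Let latD S := @latD K v n Lau LauD S.
Let latZ S := @latZ K v n Lau LauM S.
Let latB S := @latB K v n Lau LauD LauM LauN Lau1 S.
Let lat_g S := @lat_g K v n Lau LauD LauM LauN Lau0 Lau1 Lauv LauV S.
Let lat_mul S := @lat_mul K v n Lau v0 LauD LauM LauN Lau0 Lau1 Lauv LauV S.
Let lat_gIw S := @lat_gIw K v n Lau LauM Lau0 Lau1 LauV S.
Let Lau_kap := Lau_kap LauD LauN Lauv LauV.

Lemma lat1 (S : pred 'S_n) : S 1%g -> lat S (1 : H).
Proof. by move=> h; rewrite -(gIw1 v n); apply: lat_gIw. Qed.

Lemma lat_gs (S : pred 'S_n) e j y : (0 < j < n)%N -> (forall w, S (w * s j)%g = S w) ->
  lat S y -> lat S (y * gs e j).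
Proof.
move=> hj hS hy; rewrite gsE mulrBr -scalerAr mulr1; apply: latB; first exact: lat_g.
by case: e; [rewrite scale0r; apply: lat0|apply: latZ].
Qed.

Lemma lat_Gx (S : pred 'S_n) e a b y : (0 < a)%N -> (b <= n)%N ->
  (forall j w, (a <= j < b)%N -> S (w * s j)%g = S w) -> lat S y -> lat S (y * Gx e a b).
Proof.
move=> a0; elim: b => [|b IH] hb hS hy; first by rewrite Gx_geq ?mulr1.
case: (leqP a b) => hab; last by rewrite Gx_geq ?mulr1.
have hb' : (0 < b < n)%N by rewrite hb (leq_trans a0).
rewrite Gx_recr // mulrA; apply: lat_gs => // [w|].
  by apply: hS; rewrite hab leqnn.
by apply: IH => // [|j w hj]; [exact: ltnW|apply: hS; lia].
Qed.

Lemma lat_J k y : (k < m)%N -> lat predT y -> lat predT (y * J k).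
Proof.
elim: k y => [|k IH] y hk hy; first by rewrite mulr1.
have h : (0 < m + k.+1 < n)%N by lia.
by rewrite JS !mulrA; apply: lat_g => //; apply: IH; rewrite ?(ltnW hk) //; apply: lat_g.
Qed.

Lemma lat_hh k y : (k <= m)%N -> lat predT y -> lat predT (y * hh k).
Proof.
elim: k y => [|k IH] y hk hy; first by rewrite mulr1.
have h : (m + k.+1 <= n)%N by lia.
have hD e : lat predT (y * D e k.+1) by apply: lat_Gx.
rewrite hhS mulrDr !mulrA; apply: latD; first exact: IH (ltnW hk) (hD true).
by apply: lat_J => //; apply: IH (ltnW hk) (hD false).
Qed.

Lemma latT_hh : lat predT (hh m).
Proof. by rewrite -[hh m]mul1r; apply: lat_hh => //; apply: lat1. Qed.

Notation latY := (lat (young m)).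
Let pY := young_parabolic m0.

Lemma latY_mul y z : latY y -> latY z -> latY (y * z).
Proof. exact: lat_mul. Qed.

Lemma latY_hh2 : latY (hh m * hh m).
Proof.
have [h1 _] := lat_mul (@parabolicT n) latT_hh latT_hh; split=> // w hw.
apply/eqP; apply: contraNT hw => h; apply/youngP => x.
exact: (hh2_young v0 m0 h).
Qed.

Lemma latY_ind (Q : H -> Prop) :
  (forall y z, Q y -> Q z -> Q (y + z)) -> (forall c y, Lau c -> Q y -> Q (c *: y)) -> Q 0 ->
  Q 1 -> (forall y i, (0 < i < n)%N -> i != m -> Q y -> Q (y * g i)) ->
  forall y, latY y -> Q y.
Proof.
move=> QD QZ Q0 Q1 Qg y hy; rewrite (lat_span v0 hy); apply: (big_ind Q) => // w hw.
apply: QZ; first by apply: (lat_coef LauM Lau1 Lauv _ hy).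
elim/perm_ind: w hw => [|w i hi hup _ IH] hw; first by rewrite gIw1.
have [hw' hS] := proj2 pY _ _ hi hup hw.
rewrite -gIw_up //; apply: Qg => //; last exact: IH.
apply/eqP => e; rewrite e in hi hS.
have := hS 1%g; rewrite mul1g young1 => /youngP /(_ m).
by rewrite pv_srefr // ltnn prednK ?leqnn.
Qed.

Lemma young_sref i w : (0 < i < n)%N -> i != m -> young m (w * s i)%g = young m w.
Proof. by move=> hi him; apply: youngM; apply/youngP => x; apply: sref_ltm. Qed.

Lemma hh_move y : latY y -> exists2 z, latY z & hh m * y = z * hh m.
Proof.
apply: (latY_ind (Q := fun y => exists2 z, latY z & hh m * y = z * hh m)) => {y} [y1 y2 [z1 h1 e1] [z2 h2 e2]|c y hc [z h e]|||y i hi him [z h e]].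
- by exists (z1 + z2); [exact: latD|rewrite mulrDr mulrDl e1 e2].
- by exists (c *: z); [exact: latZ|rewrite -scalerAr -scalerAl e].
- by exists 0; [exact: lat0|rewrite mulr0 mul0r].
- by exists 1; [apply/lat1/young1|rewrite mulr1 mul1r].
- have [h1 h2 _] := young_swapK v m0 hi him.
  exists (z * g (young_swap m i)); last by rewrite mulrA e -!mulrA (hh_g v0 m0 hi him).
  by apply: lat_g => // w; apply: young_sref.
Qed.

(** [latY_ind] adds generators on the right, while here the new one has to come first; [star]
    reverses the order. *)
Lemma move_hh y : latY y -> exists2 z, latY z & y * hh m = hh m * z.
Proof.
move=> hy; have hs : latY (star y).
  move: hy => [h1 h2]; split=> w; rewrite star_coef // => hw.
  by apply: h2; apply: contra hw => /youngV; rewrite invgK.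
suff : forall y, latY y -> exists2 z, latY z & star y * hh m = hh m * z.
  by move=> /(_ _ hs); rewrite starK.
apply: (latY_ind (Q := fun y => exists2 z, latY z & star y * hh m = hh m * z)) => {y hy hs} [y1 y2 [z1 h1 e1] [z2 h2 e2]|c y hc [z h e]|||y i hi him [z h e]].
- by exists (z1 + z2); [exact: latD|rewrite starD mulrDr mulrDl e1 e2].
- by exists (c *: z); [exact: latZ|rewrite starZ -scalerAr -scalerAl e].
- by exists 0; [exact: lat0|rewrite linear0 mulr0 mul0r].
- by exists 1; [apply/lat1/young1|rewrite star1 mulr1 mul1r].
- have [h1 h2 h3] := young_swapK v m0 hi him.
  exists (g (young_swap m i) * z); last first.
    by rewrite starM star_g // -mulrA e !mulrA (hh_g v0 m0 h1 h2) h3.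
  apply: latY_mul => //; rewrite -[g _]mul1r; apply: lat_g => // [w|].
    exact: young_sref.
  exact/lat1/young1.
Qed.

Lemma latY_gbarI w : young m w -> latY (gbarI w).
Proof.
move=> hw; rewrite -(subrK (gIw w) (gbarI w)); apply: latD; last exact: lat_gIw.
apply: (@lat_sub _ _ _ _ (fun u => young m u && bruhat_lt u w)); first by move=> u /andP[].
exact: (gbarI_lower v0 LauD LauM LauN Lau0 Lau1 Lauv LauV pY hw).
Qed.

(** It is closed under products because b_1 can be moved across the Young lattice ([gb1_move]) and
    its square lies in that lattice ([gb1_sq]). *)
Definition wreath_span y := exists a b, [/\ latY a, latY b & y = a + b * gb1].

Lemma wreath_spanD y z : wreath_span y -> wreath_span z -> wreath_span (y + z).
Proof.
move=> [a [b [ha hb ->]]] [c [d [hc hd ->]]]; exists (a + c), (b + d).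
by split; [exact: latD|exact: latD|rewrite mulrDl addrACA].
Qed.

Lemma wreath_spanZ c y : Lau c -> wreath_span y -> wreath_span (c *: y).
Proof.
move=> hc [a [b [ha hb ->]]]; exists (c *: a), (c *: b).
by split; [exact: latZ|exact: latZ|rewrite scalerDr scalerAl].
Qed.

Lemma wreath_span_young y : latY y -> wreath_span y.
Proof. by move=> hy; exists y, 0; split=> //; [exact: lat0|rewrite mul0r addr0]. Qed.

Let gK1 : gbarI (w0hi m m) * gam = 1. Proof. exact: (proj1 (gbarI_w0hi m v0)). Qed.
Let gK2 : gam * gbarI (w0hi m m) = 1. Proof. exact: (proj2 (gbarI_w0hi m v0)). Qed.
Let latg : latY gam. Proof. by apply: lat_gIw; exact: young_w0hi. Qed.
Let latgb : latY (gbarI (w0hi m m)). Proof. by apply: latY_gbarI; exact: young_w0hi. Qed.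

Lemma gb1_move y : latY y -> exists2 z, latY z & gb1 * y = z * gb1.
Proof.
move=> hy; have [z hz e] := hh_move (latY_mul (latY_mul latgb hy) latg).
exists z => //; rewrite /gb1 mulrA -e -!mulrA gK2 mulr1 //.
Qed.

Lemma gb1_sq : latY (gb1 * gb1).
Proof.
have [z hz e] := move_hh latgb.
rewrite /gb1 mulrA -(mulrA _ _ (hh m)) e mulrA.
by do 2!apply: latY_mul => //; exact: latY_hh2.
Qed.

Lemma wreath_spanM y z : wreath_span y -> wreath_span z -> wreath_span (y * z).
Proof.
move=> [a [b [ha hb ->]]] [c [d [hc hd ->]]].
have [c' hc' ec] := gb1_move hc; have [d' hd' ed] := gb1_move hd.
exists (a * c + b * d' * (gb1 * gb1)), (a * d + b * c'); split.
- by apply: latD; [exact: latY_mul|apply: latY_mul; [exact: latY_mul|exact: gb1_sq]].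
- by apply: latD; apply: latY_mul.
move: gb1 ec ed => B ec ed.
rewrite mulrDl !mulrDr !mulrA -(mulrA b) ec -(mulrA b B d) ed mulrDl !mulrA.
by rewrite -!addrA; congr (_ + _); rewrite addrA addrC.
Qed.

Lemma wreath_span_hh : wreath_span (hh m).
Proof.
have [z hz e] := gb1_move latg; exists 0, z; split=> //; first exact: lat0.
by rewrite add0r -e /gb1 -mulrA gK1 mulr1.
Qed.

End Span.

(** * Specialisation at v = 1 *)

Section Specialisation.
Variables (K : fieldType) (v : K) (m : nat) (Lau : K -> Prop).
Hypotheses (v0 : v != 0) (m0 : (0 < m)%N) (v1 : v - 1 != 0).
Hypothesis LauD : forall x y, Lau x -> Lau y -> Lau (x + y).
Hypothesis LauM : forall x y, Lau x -> Lau y -> Lau (x * y).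
Hypothesis LauN : forall x, Lau x -> Lau (- x).
Hypothesis Lau0 : Lau 0.
Hypothesis Lau1 : Lau 1.
Hypothesis Lauv : Lau v.
Hypothesis LauV : Lau v^-1.

(* The ideal (v - 1) of the subring of Laurent polynomials. *)
Definition Idl (x : K) := Lau (x / (v - 1)).
(** The quotient of Z[v, 1/v] by v - 1 is Z, which has no 2-torsion; the next hypothesis says that
    the powers of this ideal intersect in 0. *)
Hypothesis Idl2 : forall x k, Lau x -> Idl ((2 ^ k)%:R * x) -> Idl x.
Hypothesis Idl_sep : forall x, (forall k, Lau (x / (v - 1) ^+ k)) -> x = 0.

Notation n := (m.*2).
Notation H := (heckeA v n).
Implicit Types (w u p : 'S_n) (y z : H).
Notation g := (g v n).
Notation kap := (kap v).
Notation gs := (gs kap g).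
Notation Gx := (Gx kap g).
Notation gIw := (gIw v).
Notation gbarI := (@gbarI K v n).
Notation J := (J m g).
Notation D := (D kap m g).
Notation hh := (hh kap m g).
Notation s := (sref n).
Notation lat := (lat Lau).
Notation gb1 := (gb1 v m).
Let latD S := @latD K v n Lau LauD S.
Let lat1 S := @lat1 K v m Lau LauM Lau0 Lau1 LauV S.
Let lat_g S := @lat_g K v n Lau LauD LauM LauN Lau0 Lau1 Lauv LauV S.
Let lat_gs S := @lat_gs K v m Lau LauD LauM LauN Lau0 Lau1 Lauv LauV S.

Lemma IdlD (x y : K) : Idl x -> Idl y -> Idl (x + y).
Proof. by rewrite /Idl mulrDl; apply: LauD. Qed.
Lemma IdlM (x y : K) : Lau x -> Idl y -> Idl (x * y).
Proof. by rewrite /Idl -mulrA; apply: LauM. Qed.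
Lemma IdlMr (x y : K) : Idl x -> Lau y -> Idl (x * y).
Proof. by rewrite mulrC => h1 h2; apply: IdlM. Qed.
Lemma IdlN x : Idl x -> Idl (- x).
Proof. by rewrite /Idl mulNr; apply: LauN. Qed.
Lemma Idl0 : Idl 0.
Proof. by rewrite /Idl mul0r. Qed.
Lemma Idl_gen x : Lau x -> Idl ((v - 1) * x).
Proof. by rewrite /Idl [_ * x]mulrC mulfK. Qed.

Lemma Idl_kap : Idl kap.
Proof.
have -> : kap = (v - 1) * (1 + v^-1) by rewrite /kap; field.
by apply: Idl_gen; apply: LauD.
Qed.

Lemma Idl_cA b : Idl (cA v b).
Proof.
case: b; first exact: Idl0.
have -> : cA v false = (v - 1) * (1 + v) by rewrite /cA; ring.
by apply: Idl_gen; apply: LauD.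
Qed.

Lemma Idl_cB b : Idl (v^-1 * cB v b - 1).
Proof.
case: b; rewrite /cB.
  have -> : v^-1 * 1 - 1 = (v - 1) * (- v^-1) by field.
  by apply: Idl_gen; apply: LauN.
have -> : v^-1 * v ^+ 2 - 1 = (v - 1) * 1 by field.
exact: Idl_gen.
Qed.

(* [y] is a lattice element specialising at v = 1 to [c] times the permutation [p]. *)
Definition spec_at1 c p y := lat predT y /\ forall u, Idl (y u - c * (u == p)%:R).

Lemma specD c d p y z : spec_at1 c p y -> spec_at1 d p z -> spec_at1 (c + d) p (y + z).
Proof.
move=> [h1 h2] [h3 h4]; split; first by apply: latD.
by move=> u; rewrite ffE mulrDl opprD addrACA; apply: IdlD.
Qed.

Lemma spec_g c p y i : (0 < i < n)%N -> spec_at1 c p y -> spec_at1 c (p * s i)%g (y * g i).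
Proof.
move=> hi [h1 h2]; split; first exact: lat_g.
move=> u; rewrite mul_g_coef //; set A := cA _ _; set B := cB _ _.
have -> : (u == p * s i)%g = (u * s i == p)%g.
  by apply/eqP/eqP => [->|<-]; rewrite mul_srefK.
have h := h2 (u * s i)%g; move: h; set d := (_ == p)%:R => h.
have -> : v^-1 * (y u * A + y (u * s i)%g * B) - c * d =
  v^-1 * y u * A + (y (u * s i)%g * (v^-1 * B - 1) + (y (u * s i)%g - c * d)) by ring.
apply: IdlD; first by apply: IdlM; [apply: LauM => //; exact: (proj1 h1)|exact: Idl_cA].
by apply: IdlD => //; apply: IdlM; [exact: (proj1 h1)|exact: Idl_cB].
Qed.

Lemma spec_gs e c p y i : (0 < i < n)%N -> spec_at1 c p y -> spec_at1 c (p * s i)%g (y * gs e i).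
Proof.
move=> hi hy; case: e; first exact: spec_g.
have [h1 h2] := spec_g hi hy; split; first exact: lat_gs (proj1 hy).
move=> u; rewrite /gs /gi mulrBr ffE ffN -scalerAr mulr1 ffZ addrAC; apply: IdlD => //.
by apply/IdlN/IdlMr; [exact: Idl_kap|exact: (proj1 (proj1 hy))].
Qed.

Lemma spec_Gx e c p y a b : (0 < a)%N -> (b <= n)%N -> spec_at1 c p y ->
  spec_at1 c (p * cyc n a b)%g (y * Gx e a b).
Proof.
move=> a0; elim: b => [|b IH] hb hy.
  by rewrite Gx_geq // /cyc big_geq // mulr1 mulg1.
case: (leqP a b) => hab; last by rewrite Gx_geq // /cyc big_geq // mulr1 mulg1.
rewrite Gx_recr // cyc_recr // mulrA mulgA; apply: spec_gs; first by rewrite hb (leq_trans a0).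
by apply: IH => //; exact: ltnW.
Qed.

Lemma spec_J k c p y : (k < m)%N -> spec_at1 c p y -> spec_at1 c p (y * J k).
Proof.
elim: k p y => [|k IH] p y hk hy; first by rewrite mulr1.
have h : (0 < m + k.+1 < n)%N by lia.
have := spec_g h (IH _ _ (ltnW hk) (spec_g h hy)).
by rewrite mul_srefK // JS !mulrA.
Qed.

Fixpoint dt k : 'S_n := if k is k'.+1 then (cyc n k'.+1 (m + k'.+1) * dt k')%g else 1%g.

(** At v = 1 the two signs give the same permutation and [J k] gives 1, so each step of the
    recursion doubles the coefficient. *)
Lemma spec_hh k c p y : (k <= m)%N -> spec_at1 c p y -> spec_at1 ((2 ^ k)%:R * c) (p * dt k)%g (y * hh k).
Proof.
elim: k c p y => [|k IH] c p y hk hy; first by rewrite mul1r mulg1 mulr1.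
have h : (m + k.+1 <= n)%N by lia.
have hD e : spec_at1 c (p * cyc n k.+1 (m + k.+1))%g (y * D e k.+1) by apply: spec_Gx.
have -> : (2 ^ k.+1)%:R * c = (2 ^ k)%:R * c + (2 ^ k)%:R * c :> K.
  by rewrite expnS mul2n -addnn natrD mulrDl.
rewrite hhS mulrDr !mulrA mulgA; apply: specD; first exact: IH (ltnW hk) (hD true).
by apply: spec_J => //; apply: IH (ltnW hk) (hD false).
Qed.

Lemma spec_gbarI c p y w : spec_at1 c p y -> spec_at1 c (p * w)%g (y * gbarI w).
Proof.
move=> hy; elim/perm_ind: w => [|w i hi hup hr IH]; first by rewrite mulg1 gbarI1 mulr1.
by rewrite gbarI_rcons // mulgA mulrA; apply: (spec_gs false).
Qed.

Lemma spec1 : spec_at1 1 1%g (1 : H).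
Proof.
split; first exact: lat1.
by move=> u; rewrite TE mul1r subrr; apply: Idl0.
Qed.

Lemma spec_gIw w : spec_at1 1 w (gIw w).
Proof.
elim/perm_ind: w => [|w i hi hup hr IH]; first by rewrite gIw1; apply: spec1.
by rewrite -gIw_up //; apply: spec_g.
Qed.

Definition x0 : 'S_n := (dt m * w0hi m m)%g.

Lemma spec_gb1 w : spec_at1 (2 ^ m)%:R (w * x0)%g (gIw w * gb1).
Proof.
rewrite /gb1 mulrA /x0 mulgA; apply: spec_gbarI.
by rewrite -[(2 ^ m)%:R]mulr1; apply: spec_hh => //; exact: spec_gIw.
Qed.

Lemma pv_dt k : (0 < k <= m)%N -> pv (dt k) 0 = m.
Proof.
elim: k => // k IH hk; rewrite pvM pv_cyc //; last by lia.
case: k => [|k] in IH hk *; first by rewrite /= pv1 addn1.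
by rewrite /= IH //; lia.
Qed.

Lemma x0_young : ~~ young m x0.
Proof.
have hm : (0 < m <= m)%N by rewrite m0 leqnn.
apply/youngP => /(_ 0%N); rewrite pvM pv_dt // m0.
by have /youngP -> := young_w0hi m0; rewrite ltnn.
Qed.

Lemma sum_Idl (P : pred 'S_n) (a b : 'S_n -> K) : (forall w, P w -> Idl (a w - b w)) ->
  Idl (\sum_(w | P w) a w - \sum_(w | P w) b w).
Proof.
move=> h; rewrite -sumrB; apply: (big_ind Idl) => //; [exact: Idl0|exact: IdlD].
Qed.

Definition relation (a b : 'S_n -> K) :=
  \sum_(w | young m w) (a w *: gIw w + b w *: (gIw w * gb1)) = 0.

(** At v = 1 the elements become w and 2^m w x_0. As x_0 is not in the Young subgroup, these
    permutations are all distinct, and each coefficient is isolated by evaluating at its own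
    permutation. *)
Lemma relation_Idl a b : (forall w, Lau (a w)) -> (forall w, Lau (b w)) -> relation a b ->
  forall w, young m w -> Idl (a w) /\ Idl (b w).
Proof.
move=> ha hb rel.
have E u : Idl (\sum_(w | young m w) (a w * (u == w)%:R + b w * ((2 ^ m)%:R * (u == (w * x0)%g)%:R))).
  have e : \sum_(w | young m w) (a w * gIw w u + b w * (gIw w * gb1) u) = 0.
    have e' w : (a w *: gIw w + b w *: (gIw w * gb1)) u = a w * gIw w u + b w * (gIw w * gb1) u.
      by rewrite ffE !ffZ.
    have := congr1 (fun y : H => y u) rel.
    by rewrite ffsum ff0 (eq_bigr _ (fun w _ => e' w)).
  rewrite -[X in Idl X]opprK -[X in - X]sub0r; apply: IdlN.
  have := @sum_Idl (young m) (fun w => a w * gIw w u + b w * (gIw w * gb1) u)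
    (fun w => a w * (u == w)%:R + b w * ((2 ^ m)%:R * (u == (w * x0)%g)%:R)).
  rewrite e; apply=> w _; rewrite opprD addrACA -!mulrBr.
  apply: IdlD; apply: IdlM => //; last exact: (proj2 (spec_gb1 w)).
  by have := proj2 (spec_gIw w) u; rewrite mul1r.
move=> w hw; split.
  move: (E w); rewrite (bigD1 w) //= eqxx mulr1 big1 => [|u /andP[hu uw]].
    rewrite addr0; case: eqP => [e|_]; last by rewrite !mulr0 addr0.
    case/negP: x0_young; have -> : x0 = 1%g by apply: (mulgI w); rewrite mulg1 -e.
    exact: young1.
  rewrite eq_sym (negPf uw) mulr0 add0r; case: eqP => [e|_]; last by rewrite !mulr0.
  case/negP: x0_young; rewrite -(mulKg u x0) -e.
  by rewrite youngM // youngV.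
apply: (@Idl2 _ m) => //.
move: (E (w * x0)%g); rewrite (bigD1 w) //= eqxx mulr1 big1 => [|u /andP[hu uw]].
  rewrite addr0; case: eqP => [e|_]; last by rewrite mulr0 add0r mulrC.
  case/negP: x0_young; have : x0 = 1%g by apply: (mulgI w); rewrite e mulg1.
  by move=> ->; apply: young1.
have -> : (w * x0 == u * x0)%g = false by rewrite (inj_eq (@mulIg _ x0)) eq_sym (negPf uw).
rewrite !mulr0 addr0.
case: eqP => [e|_]; last by rewrite mulr0.
case/negP: x0_young; rewrite -(mulKg w x0) e youngM // youngV //.
Qed.

Lemma relation_trivial a b : (forall w, Lau (a w)) -> (forall w, Lau (b w)) -> relation a b ->
  forall w, young m w -> a w = 0 /\ b w = 0.
Proof.
move=> ha hb rel.
(* Set to 0 where the relation gives no information, so that divisibility by powers of v - 1 can be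
   claimed for all w, as the next application of [relation_Idl] requires. *)
pose a' w := if young m w then a w else 0; pose b' w := if young m w then b w else 0.
suff key k : (forall w, Lau (a' w / (v - 1) ^+ k)) /\ (forall w, Lau (b' w / (v - 1) ^+ k)).
  move=> w hw; split; apply: Idl_sep => k; have [h1 h2] := key k.
    by have := h1 w; rewrite /a' hw.
  by have := h2 w; rewrite /b' hw.
elim: k => [|k [IHa IHb]].
  by split=> w; rewrite expr0 divr1 /a' /b'; case: ifP.
have rel' : relation (fun w => a' w / (v - 1) ^+ k) (fun w => b' w / (v - 1) ^+ k).
  rewrite /relation; apply: etrans (scaler0 H ((v - 1) ^- k)); rewrite -[in RHS]rel scaler_sumr.
  apply: eq_bigr => w hw.
  by rewrite /a' /b' hw scalerDr !scalerA ![_ / _]mulrC.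
have h := relation_Idl IHa IHb rel'.
split=> w; have := h w; rewrite /Idl /a' /b' exprSr invfM mulrA; case: ifP => [hw /(_ isT) [] //|_ _];
  by rewrite !mul0r.
Qed.

End Specialisation.

(** * Laurent polynomials inside the fraction field *)

Section FractionMorphism.
Variables (R : idomainType) (E : fieldType) (ev : {rmorphism R -> E}).
Hypothesis ev_inj : forall p, ev p = 0 -> p = 0.
Notation FR := {fraction R}.
Notation tofrac := (@tofrac R).
Implicit Types (x y : FR) (p r : R).

Lemma frac_repr x : x * tofrac (frac (repr x)).2 = tofrac (frac (repr x)).1.
Proof.
have e : x = (\pi_(FracField.type R)%qT (repr x))%qT by rewrite reprK.
rewrite {1}e; unlock FracField.tofrac; rewrite -[LHS]FracField.pi_mul.
apply/eqmodP; rewrite /= FracField.equivfE /FracField.mulf.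
have d0 := denom_ratioP (repr x).
by rewrite !numden_Ratio ?mulf_neq0 ?oner_eq0 // !mulr1 mulrC.
Qed.

(** The formula of [sigma], with the same chosen representative; [frac_liftE] shows that any other
    fraction gives the same value. *)
Definition frac_lift x : E := ev (frac (repr x)).1 / ev (frac (repr x)).2.

Lemma ev_neq0 p : p != 0 -> ev p != 0.
Proof. by apply: contraNneq => /ev_inj ->. Qed.

Lemma frac_liftE x p r : r != 0 -> x * tofrac r = tofrac p -> frac_lift x = ev p / ev r.
Proof.
move=> r0 e; have d0 := denom_ratioP (repr x); have := frac_repr x.
rewrite /frac_lift; move: (frac _).1 (frac _).2 d0 => a d d0 e2.
have /eqP := congr1 (fun z => z * tofrac r) e2.
rewrite mulrAC e -!tofracM tofrac_eq => /eqP e3.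
by apply/eqP; rewrite eqr_div ?ev_neq0 // -!rmorphM -e3 mulrC.
Qed.

Lemma fracP x : exists p r, r != 0 /\ x * tofrac r = tofrac p.
Proof. by exists (frac (repr x)).1, (frac (repr x)).2; split; [exact: denom_ratioP|exact: frac_repr]. Qed.

Lemma frac_lift_zmod : zmod_morphism frac_lift.
Proof.
move=> x y; have [a [b [b0 e1]]] := fracP x; have [c [d [d0 e2]]] := fracP y.
rewrite (frac_liftE b0 e1) (frac_liftE d0 e2) (@frac_liftE (x - y) (a * d - c * b) (b * d)) ?mulf_neq0 //.
  by rewrite rmorphB !rmorphM /=; field; rewrite !ev_neq0.
by rewrite tofracB !tofracM -e1 -e2; ring.
Qed.

Lemma frac_lift_monoid : monoid_morphism frac_lift.
Proof.
split=> [|x y].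
  by rewrite (@frac_liftE 1 1 1) ?oner_eq0 // ?mul1r // rmorph1 divr1.
have [a [b [b0 e1]]] := fracP x; have [c [d [d0 e2]]] := fracP y.
rewrite (frac_liftE b0 e1) (frac_liftE d0 e2) (@frac_liftE (x * y) (a * c) (b * d)) ?mulf_neq0 //.
  by rewrite !rmorphM /=; field; rewrite !ev_neq0.
by rewrite !tofracM -e1 -e2; ring.
Qed.

End FractionMorphism.

Section EvalInt.
Variables (E : fieldType) (u : E).

Definition ev_int (p : {poly int}) : E := \sum_(i < size p) (p`_i)%:~R * u ^+ i.

Lemma ev_intE p : ev_int p = (map_poly intr p).[u].
Proof. by rewrite /map_poly horner_poly. Qed.

Lemma ev_int_zmod : zmod_morphism ev_int.
Proof. by move=> p r; rewrite !ev_intE rmorphB hornerD hornerN. Qed.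

Lemma ev_int_monoid : monoid_morphism ev_int.
Proof.
split=> [|p r]; first by rewrite ev_intE rmorph1 hornerC.
by rewrite !ev_intE rmorphM hornerM.
Qed.

HB.instance Definition _ := GRing.isZmodMorphism.Build {poly int} E ev_int ev_int_zmod.
HB.instance Definition _ := GRing.isMonoidMorphism.Build {poly int} E ev_int ev_int_monoid.

(* Reversing the coefficients turns evaluation at 1/z into evaluation at z. *)
Lemma ev_int_inj (z : E) : u * z = 1 -> (forall p : {poly int}, (map_poly intr p).[z] = 0 -> p = 0) ->
  forall p, ev_int p = 0 -> p = 0.
Proof.
move=> uz hz p; have [->//|p0 e] := eqVneq p 0.
have sp : (0 < size p)%N by rewrite size_poly_gt0.
pose r := \poly_(i < size p) p`_((size p).-1 - i).
have : r = 0.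
  apply: hz; rewrite horner_coef.
  have -> : \sum_(i < size (map_poly (intr : int -> E) r)) (map_poly intr r)`_i * z ^+ i
      = \sum_(i < size p) (p`_((size p).-1 - i))%:~R * z ^+ i.
    rewrite -horner_coef; have -> : map_poly (intr : int -> E) r = \poly_(i < size p) (p`_((size p).-1 - i))%:~R.
      by apply/polyP => i; rewrite coef_map !coef_poly; case: ifP => // _; rewrite rmorph0.
    by rewrite horner_poly.
  have e0 : ev_int p * z ^+ (size p).-1 = 0 by rewrite e mul0r.
  apply: etrans e0; rewrite /ev_int mulr_suml.
  rewrite [LHS](reindex_inj rev_ord_inj) /=; apply: eq_bigr => i _.
  have hi : (i <= (size p).-1)%N by rewrite -ltnS prednK.
  have -> : (size p - i.+1 = (size p).-1 - i)%N by lia.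
  rewrite subKn // -{1 2}(subnK hi) -mulrA; congr (_ * _).
  by rewrite addnK [in RHS]addnC exprD mulrA -exprMn uz expr1n mul1r.
(* The constant term of the reversed polynomial is the leading coefficient of p. *)
move/polyP/(_ 0%N); rewrite coef_poly sp subn0 coef0 => /eqP.
by rewrite -/(lead_coef p) lead_coef_eq0 (negPf p0).
Qed.

End EvalInt.

Lemma tofrac_horner (p : {poly int}) :
  (map_poly intr p).[tofrac ('X : {poly int})] = tofrac p.
Proof.
rewrite /map_poly horner_poly -[in RHS](coefK p) poly_def rmorph_sum /=.
apply: eq_bigr => i _; rewrite -mul_polyC rmorphM rmorphXn /=; congr (_ * _).
have -> : (p`_i)%:P = (p`_i)%:~R by rewrite -(rmorph_int (polyC : int -> {poly int})) intz.
by rewrite rmorph_int.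
Qed.

Lemma map_intr_horner_inj (p : {poly int}) :
  (map_poly intr p).[tofrac ('X : {poly int})] = 0 -> p = 0.
Proof. by rewrite tofrac_horner => /eqP; rewrite tofrac_eq0 => /eqP. Qed.

Section Laurent.
Notation FR := {fraction {poly int}}.
Variable v : FR.
Hypothesis vE : v = tofrac 'X.

Definition laurent (x : FR) : Prop := exists (p : {poly int}) (k : nat), x = tofrac p / v ^+ k.

Lemma v_neq0 : v != 0.
Proof. by rewrite vE tofrac_eq0 polyX_eq0. Qed.

Lemma vX_neq0 k : v ^+ k != 0.
Proof. by rewrite expf_neq0 // v_neq0. Qed.

Lemma v_sub1 : v - 1 = tofrac ('X - 1%:P).
Proof. by rewrite vE rmorphB rmorph1. Qed.

Lemma v_sub1_neq0 : v - 1 != 0.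
Proof. by rewrite v_sub1 tofrac_eq0 polyXsubC_eq0. Qed.

Lemma laurentD x y : laurent x -> laurent y -> laurent (x + y).
Proof.
move=> [p [k ->]] [r [l ->]]; exists (p * 'X^l + r * 'X^k), (k + l)%N.
rewrite rmorphD !rmorphM !rmorphXn /= -vE exprD.
rewrite addf_div ?vX_neq0 //.
Qed.

Lemma laurentM x y : laurent x -> laurent y -> laurent (x * y).
Proof.
move=> [p [k ->]] [r [l ->]]; exists (p * r), (k + l)%N.
by rewrite rmorphM exprD mulf_div.
Qed.

Lemma laurentN x : laurent x -> laurent (- x).
Proof. by move=> [p [k ->]]; exists (- p), k; rewrite rmorphN mulNr. Qed.

Lemma laurent_tofrac p : laurent (tofrac p).
Proof. by exists p, 0%N; rewrite expr0 divr1. Qed.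

Lemma laurent0 : laurent 0.
Proof. by rewrite -tofrac0; apply: laurent_tofrac. Qed.

Lemma laurent1 : laurent 1.
Proof. by rewrite -tofrac1; apply: laurent_tofrac. Qed.

Lemma laurentv : laurent v.
Proof. by rewrite vE; apply: laurent_tofrac. Qed.

Lemma laurentV : laurent v^-1.
Proof. by exists 1, 1%N; rewrite tofrac1 expr1 mul1r. Qed.

Lemma root_of_div p k : laurent (tofrac p / v ^+ k / (v - 1)) -> root p 1.
Proof.
move=> [r [l /eqP]].
rewrite -mulrA -invfM eqr_div ?mulf_neq0 ?vX_neq0 ?v_sub1_neq0 //.
rewrite v_sub1 vE -!rmorphXn -!rmorphM tofrac_eq => /eqP /(congr1 (fun z => z.[1])).
by rewrite !hornerM !hornerXn !expr1n hornerXsubC subrr !mulr0 mulr1 => /eqP.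
Qed.

Lemma div_of_root p : root p 1 -> exists q, p = q * ('X - 1%:P) /\
  forall k, tofrac p / v ^+ k / (v - 1) = tofrac q / v ^+ k.
Proof.
move=> /factor_theorem[q ->]; exists q; split=> // k.
by rewrite tofracM -v_sub1 mulrAC mulfK ?v_sub1_neq0.
Qed.

Lemma laurent_div2 x k : laurent x -> laurent ((2 ^ k)%:R * x / (v - 1)) -> laurent (x / (v - 1)).
Proof.
move=> [p [j ->]] h.
have : root ((2 ^ k)%:R * p) 1.
  by apply: (@root_of_div _ j); rewrite rmorphM rmorph_nat -(mulrA _ (tofrac p)).
rewrite rootE hornerM -polyC_natr hornerC mulf_eq0 Num.Theory.pnatr_eq0 expn_eq0 /= -rootE.
by move=> /div_of_root[q [_ ->]]; exists q, j.
Qed.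

Lemma laurent_sep x : (forall k, laurent (x / (v - 1) ^+ k)) -> x = 0.
Proof.
move=> h; have := h 0%N; rewrite expr0 divr1 => -[p [j e]].
have [s] := ubnP (size p); elim: s p x h e => // s IH p x h e hs.
case: (eqVneq p 0) => [p0|p0]; first by rewrite e p0 tofrac0 mul0r.
have : root p 1 by apply: (@root_of_div _ j); rewrite -e; have := h 1%N; rewrite expr1.
move=> /div_of_root[q [ep eq]].
have h' k : laurent (x / (v - 1) / (v - 1) ^+ k).
  by have := h k.+1; rewrite exprS invfM mulrA.
have := IH q _ h'; rewrite e eq => /(_ erefl).
have q0 : q != 0 by apply: contraNneq p0 => q0; rewrite ep q0 mul0r.
have hq : (size q < s)%N.
  by move: hs; rewrite ep size_mul ?polyXsubC_eq0 // size_XsubC addn2.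
move=> /(_ hq); rewrite -eq => /eqP; rewrite mulf_eq0 invr_eq0 (negPf v_sub1_neq0) orbF.
by move/eqP.
Qed.

End Laurent.

(** * Identification with the given definitions *)

Section ConsFfun.
Variable j : nat.

Definition ffcons (p : bool * {ffun 'I_j -> bool}) : {ffun 'I_j.+1 -> bool} :=
  [ffun i => if unlift ord0 i is Some k then p.2 k else p.1].

Lemma ffcons0 p : ffcons p ord0 = p.1.
Proof. by rewrite ffunE unlift_none. Qed.

Lemma ffconsS p k : ffcons p (lift ord0 k) = p.2 k.
Proof. by rewrite ffunE liftK. Qed.

Lemma ffcons_bij : bijective ffcons.
Proof.
exists (fun f : {ffun 'I_j.+1 -> bool} => (f ord0, [ffun k => f (lift ord0 k)])).
  by move=> [b f]; rewrite ffcons0; congr (_, _); apply/ffunP => k; rewrite ffunE ffconsS.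
move=> f; apply/ffunP => i; case: (unliftP ord0 i) => [k ->|->].
  by rewrite ffconsS ffunE.
by rewrite ffcons0.
Qed.

End ConsFfun.

Section SignSum.
Variables (K : fieldType) (R : algType K) (kap : K) (m : nat) (g : nat -> R).
Notation n := (m.*2).
Hypothesis g_braid : forall i, (0 < i)%N -> (i.+1 < n)%N ->
  g i * g i.+1 * g i = g i.+1 * g i * g i.+1.
Hypothesis g_comm : forall i j, (0 < i)%N -> (i.+1 < j < n)%N -> GRing.comm (g i) (g j).
Notation D := (D kap m g).
Notation J := (J m g).
Notation hh := (hh kap m g).

Lemma sum_signs j : (j <= m)%N ->
  \sum_(eps : {ffun 'I_j -> bool})
    (\prod_(k <- enum 'I_j) D (eps k) (j - k)) *
    (\prod_(k <- enum 'I_j | ~~ eps k) J (j - k.+1)) = hh j.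
Proof.
elim: j => [|j IH] hj.
  rewrite (eq_bigr (fun=> 1)) ?sumr_const ?card_ffun ?card_bool ?card_ord //.
  by move=> eps _; rewrite enum_ord0 !big_nil mulr1.
rewrite (reindex _ (onW_bij _ (@ffcons_bij j))) /=.
pose X (eps : {ffun 'I_j -> bool}) := \prod_(k <- enum 'I_j) D (eps k) (j - k).
pose Y (eps : {ffun 'I_j -> bool}) := \prod_(k <- enum 'I_j | ~~ eps k) J (j - k.+1).
have E p : (\prod_(k <- enum 'I_j.+1) D (ffcons p k) (j.+1 - k)) *
    (\prod_(k <- enum 'I_j.+1 | ~~ ffcons p k) J (j.+1 - k.+1)) =
    D p.1 j.+1 * X p.2 * Y p.2 * (if p.1 then 1 else J j).
  rewrite enum_ordSl !big_cons !big_map -?enumT ffcons0 subn0 subSS subn0.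
  have -> : \prod_(k <- enum 'I_j) D (ffcons p (lift ord0 k)) (j.+1 - lift ord0 k) = X p.2.
    by apply: eq_bigr => k _; rewrite ffconsS lift0 subSS.
  have -> : \prod_(k <- enum 'I_j | ~~ ffcons p (lift ord0 k)) J (j.+1 - (lift ord0 k).+1) = Y p.2.
    by apply: eq_big => [k|k _]; rewrite ?ffconsS ?lift0 ?subSS.
  case: p.1; first by rewrite /= mulr1.
  (* In C_epsilon the factor of the first sign comes first, in the recursion for [hh] it comes last;
     the [J] commute. *)
  have c : GRing.comm (J j) (Y p.2).
    apply: commr_prod => k _; apply: (J_comm g_braid g_comm) => //.
    by have := ltn_ord k; lia.
  by rewrite /= c !mulrA.
rewrite (eq_bigr _ (fun p _ => E p)) -(pair_bigA _ (fun b eps => D b j.+1 * X eps * Y eps * (if b then 1 else J j))) /=.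
rewrite big_bool /= -!mulr_suml.
have S b : \sum_(eps : {ffun 'I_j -> bool}) D b j.+1 * X eps * Y eps = D b j.+1 * hh j.
  by rewrite -IH ?(ltnW hj) // mulr_sumr; apply: eq_bigr => eps _; rewrite mulrA.
by rewrite !S mulr1.
Qed.

End SignSum.

Notation vF := Defs.v.

Lemma scale_invK (K : fieldType) (R : algType K) (c : K) (x y : R) :
  c != 0 -> c^-1 *: ((c *: x) * y) = x * y.
Proof. by move=> c0; rewrite -scalerAl scalerA mulVf // scale1r. Qed.

Definition sigF : F -> F := frac_lift (ev_int vF^-1).

Lemma vF_neq0 : vF != 0. Proof. exact: (v_neq0 (erefl vF)). Qed.

Lemma ev_vinv_inj p : ev_int vF^-1 p = 0 -> p = 0.
Proof.
apply: (ev_int_inj (z := vF)); first by rewrite mulVf // vF_neq0.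
exact: map_intr_horner_inj.
Qed.

HB.instance Definition _ := GRing.isZmodMorphism.Build F F sigF (frac_lift_zmod ev_vinv_inj).
HB.instance Definition _ := GRing.isMonoidMorphism.Build F F sigF (frac_lift_monoid ev_vinv_inj).

Lemma sigF_v : sigF vF = vF^-1.
Proof.
rewrite /sigF (frac_liftE ev_vinv_inj (p := 'X) (r := 1)) ?oner_eq0 //; last first.
  by rewrite tofrac1 mulr1.
by rewrite rmorph1 divr1 /= ev_intE map_polyX hornerX.
Qed.

Section Bridge.
Variable n : nat.
Notation H := (heckeA vF n).
Notation g := (g vF n).
Notation kap := (kap vF).

Lemma hmul_bridge (a b : H) : Defs.hmul a b = a * b.
Proof. by []. Qed.

Lemma Iw_bridge (w : 'S_n) : Iw w = gIw vF w :> H.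
Proof. by rewrite gIwE. Qed.

Lemma Ig_bridge i : Ig n i = g i :> H.
Proof. by rewrite /Ig Iw_bridge gIw_sref. Qed.

Lemma Iginv_bridge i : Iginv n i = gi kap g i :> H.
Proof. by rewrite /Iginv Ig_bridge. Qed.

Lemma hprod_bridge (t : seq H) : hprod t = \prod_(x <- t) x :> H.
Proof. by elim: t => [|x t IH]; rewrite ?big_nil // big_cons -IH. Qed.

Lemma barI_bridge (w : 'S_n) : barI w = gbarI vF w :> H.
Proof.
rewrite /barI hprod_bridge big_map; apply: eq_bigr => i _; exact: Iginv_bridge.
Qed.

Lemma Iarrow_prod e a b : Iarrow n e a b = \prod_(i <- arrow a b) gs kap g e i :> H.
Proof.
rewrite /Iarrow; case: e; rewrite hprod_bridge big_map; apply: eq_bigr => i _.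
  exact: Ig_bridge.
exact: Iginv_bridge.
Qed.

Lemma Iarrow_bridge e a b : (a <= b)%N -> Iarrow n e a b = Gx kap g e a b.+1 :> H.
Proof.
move=> ab; rewrite Iarrow_prod /Gx /arrow /index_iota subSn //.
have e0 : iota a (b - a).+1 = map (addn a) (iota 0 (b - a).+1) by rewrite -iotaDl addn0.
(* For equal endpoints [arrow] takes its decreasing branch, where it gives the same one-letter
   word. *)
case: leqP => h; last by rewrite e0.
have -> : a = b by apply/eqP; rewrite eqn_leq ab.
by rewrite subnn /= subn0.
Qed.

Lemma arrow_rev a b : (b <= a)%N -> arrow a b = rev (index_iota b a.+1).
Proof.
move=> ba; rewrite /arrow ba; apply: (@eq_from_nth _ 0%N).
  by rewrite size_map size_rev !size_iota subSn.
move=> i; rewrite size_map size_iota => hi.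
rewrite (nth_map 0%N) ?size_iota // nth_iota // nth_rev /index_iota size_iota; last by lia.
by rewrite nth_iota; lia.
Qed.

Lemma star_prod (t : seq nat) : all (fun i => 0 < i < n)%N t ->
  star (\prod_(i <- t) gs kap g true i) = \prod_(i <- rev t) gs kap g true i :> H.
Proof.
elim: t => [|i t IH] /=; first by rewrite !big_nil star1.
case/andP=> hi ht; rewrite rev_cons big_cons starM IH // star_g //.
by rewrite big_rcons.
Qed.

Lemma Iarrow_star a b : (0 < b)%N -> (b <= a < n)%N ->
  Iarrow n true a b = star (Gx kap g true b a.+1) :> H.
Proof.
move=> b0 /andP[ba an]; rewrite Iarrow_prod arrow_rev // -star_prod //.
by apply/allP => i; rewrite mem_index_iota; lia.
Qed.

End Bridge.

Lemma hbar_bridge m (h : heckeA vF m.*2) : hbar h = bar sigF h :> heckeA vF m.*2.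
Proof. by apply: eq_bigr => w _; rewrite barI_bridge. Qed.

Section Main.
Variable m : nat.
Hypothesis m0 : (0 < m)%N.
Notation n := (m.*2).
Notation H := (heckeA vF n).
Notation g := (g vF n).
Notation kap := (kap vF).
Notation hh := (hh kap m g).
Notation J := (J m g).
Notation D := (D kap m g).
Notation gb1 := (gb1 vF m).
Implicit Types (w u : 'S_n) (y z : H).
Let v0 := vF_neq0.
Let g_br := g_braid v0 (n := n).
Let g_co := g_comm v0 (n := n).

Lemma cmi_bridge i : (i < m)%N -> cmi m i = J i :> H.
Proof.
move=> hi; rewrite /cmi; case: eqP => [->//|/eqP i0].
have [h1 h2] : (m.+1 <= m + i < n)%N /\ (m < m + i)%N by lia.
by rewrite hmul_bridge Iarrow_star // Iarrow_bridge // J_star.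
Qed.

Lemma H1_bridge : H1 m = vF ^+ (m * n.-1) *: hh m :> H.
Proof.
rewrite -(sum_signs kap g_br g_co (leqnn m)).
apply: (congr1 (fun y : H => vF ^+ (m * n.-1) *: y)).
apply: eq_bigr => eps _; rewrite hmul_bridge; congr (_ * _).
  rewrite /Ieps hprod_bridge big_map; apply: eq_bigr => k _.
  have hk := ltn_ord k.
  rewrite Iarrow_bridge; last by lia.
  by rewrite /D; congr Gx; lia.
rewrite /Ceps hprod_bridge big_map big_filter; apply: eq_bigr => k _.
by rewrite cmi_bridge //; have := ltn_ord k; lia.
Qed.

(** [t1] and [w0shift] fall back on 1 if their map is not a permutation; injectivity excludes that
    default. *)
Lemma insub_permE k (f : 'I_k -> 'I_k) : injective f ->
  forall x, odflt 1%g (insub [ffun j => f j] : option 'S_k) x = f x.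
Proof.
move=> fi x; case: insubP => [u _ e|]; first by rewrite /= -pvalE e ffunE.
by case/negP; apply/injectiveP => a b; rewrite !ffunE => /fi.
Qed.

Lemma pv_t1 (x : nat) : (x < n)%N -> pv (t1 m) x = if (x < m)%N then (x + m)%N else (x - m)%N.
Proof.
move=> hx; pose f (x : nat) := if (x < m)%N then (x + m)%N else (x - m)%N.
have fn (y : nat) : (y < n)%N -> (f y < n)%N by rewrite /f; case: ifP; lia.
have fE (j : 'I_n) : t1_fun j = f j :> nat.
  by rewrite /t1_fun -/(f j) (insubT (fun i => i < n)%N (fn j (ltn_ord j))).
have ti : injective (@t1_fun m).
  move=> a b /(congr1 val) /=; rewrite !fE /f => e; apply: val_inj => /=.
  by have := ltn_ord a; have := ltn_ord b; move: e; case: (ltnP a m); case: (ltnP b m); lia.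
by rewrite -[x in LHS]/(val (Ordinal hx)) pv_ord /t1 insub_permE // fE.
Qed.

Lemma w0shift_w0hi : w0shift m = w0hi m m.
Proof.
pose f (x : nat) := if (x < m)%N then x else (n + m - x.+1)%N.
have fE (j : 'I_n) : w0shift_fun j = f j :> nat.
  rewrite /w0shift_fun /f; case: ltnP => // h.
  have h2 : (n + m - j.+1 < n)%N by have := ltn_ord j; lia.
  by rewrite (insubT (fun i => i < n)%N h2).
have wi : injective (@w0shift_fun m).
  move=> a b /(congr1 val) /=; rewrite !fE /f => e; apply: val_inj => /=.
  by have := ltn_ord a; have := ltn_ord b; move: e; case: (ltnP a m); case: (ltnP b m); lia.
apply: pv_perm => x hx; rewrite pv_w0hi //.
have -> : pv (w0shift m) x = w0shift m (Ordinal hx) by rewrite -pv_ord.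
rewrite /w0shift insub_permE // fE /f /=.
by case: (ltnP x m) => //= h; rewrite ifT; lia.
Qed.

Lemma b1_bridge : b1 m = gb1 :> H.
Proof.
rewrite /b1 hbar_bridge /gamma Iw_bridge bar_gIw // w0shift_w0hi hmul_bridge H1_bridge.
exact: (scale_invK (hh m) (gbarI vF (w0hi m m)) (vX_neq0 (erefl vF) (m * n.-1))).
Qed.

End Main.

Lemma mulr_sub_split (R : pzRingType) (x y z : R) : x * z = y * z + (x - y) * z.
Proof. by rewrite -mulrDl addrC subrK. Qed.

Lemma eq_sum_widen (V : nmodType) (I : finType) (P Q : pred I) (f f' : I -> V) :
  (forall i, P i -> Q i) -> (forall i, P i -> f i = f' i) ->
  (forall i, Q i -> ~~ P i -> f' i = 0) -> \sum_(i | P i) f i = \sum_(i | Q i) f' i.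
Proof.
move=> PQ e z; rewrite [RHS](bigID P) /= [X in _ + X]big1 ?addr0 => [|i /andP[]]; last exact: z.
apply: eq_big => [i|i]; last exact: e.
by case: (boolP (P i)) => [/PQ ->|]; rewrite ?andbF.
Qed.

(** * Membership, independence, span and triangularity *)

Section Final.
Variable m : nat.
Hypothesis m0 : (0 < m)%N.
Notation n := (m.*2).
Notation H := (heckeA vF n).
Notation g := (g vF n).
Notation kap := (kap vF).
Notation hh := (hh kap m g).
Notation gb1 := (gb1 vF m).
Implicit Types (w u : 'S_n) (y z : H).
Let v0 := vF_neq0.

Lemma pv_t1_lt (x : nat) : (x < n)%N -> (pv (t1 m) x < m)%N = ~~ (x < m)%N.
Proof. by move=> hx; rewrite pv_t1 //; case: (ltnP x m) => h /=; apply/idP/idP; lia. Qed.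

Lemma young_t1 w : young m w -> ~~ young m (w * t1 m)%g.
Proof.
move=> /youngP hw; apply/youngP => /(_ 0%N).
by rewrite pvM pv_t1_lt ?pv_lt ?double_gt0 // hw m0.
Qed.

Lemma Iwr_young w : young m w -> Iwr m w = gIw vF w :> H.
Proof. by move=> hw; rewrite /Iwr hw Iw_bridge. Qed.

Lemma Iwr_t1 w : young m w -> Iwr m (w * t1 m)%g = gIw vF w * gb1 :> H.
Proof.
move=> hw; rewrite /Iwr (negPf (young_t1 hw)) mulgK.
by rewrite hmul_bridge Iw_bridge b1_bridge.
Qed.

Lemma wreathP x : wreath m x -> young m x \/ exists2 w, young m w & x = (w * t1 m)%g.
Proof.
case/orP=> [|h]; first by left.
by right; exists (x * (t1 m)^-1)%g; rewrite // mulgKV.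
Qed.

Lemma big_wreath (V : nmodType) (P : pred 'S_n) (f : 'S_n -> V) :
  \sum_(x | wreath m x && P x) f x =
  \sum_(w | young m w && P w) f w + \sum_(w | young m w && P (w * t1 m)%g) f (w * t1 m)%g.
Proof.
rewrite (bigID (young m)) /=; congr (_ + _).
  by apply: eq_bigl => x; rewrite /wreath; case: (young m x); rewrite ?andbF ?andbT.
rewrite (reindex_inj (@mulIg _ (t1 m))) /=; apply: eq_bigl => w.
rewrite /wreath mulgK andbAC; congr (_ && _).
by case: (boolP (young m w)) => [/young_t1 ->|_]; [rewrite orbT|rewrite orbF andbN].
Qed.

Lemma big_wreathT (V : nmodType) (f : 'S_n -> V) :
  \sum_(x | wreath m x) f x = \sum_(w | young m w) f w + \sum_(w | young m w) f (w * t1 m)%g.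
Proof.
have e Q (f' : 'S_n -> V) : \sum_(x | Q x && predT x) f' x = \sum_(x | Q x) f' x.
  by apply: eq_bigl => x; rewrite andbT.
by rewrite -e big_wreath !e.
Qed.

Lemma sum_wreath (P : pred 'S_n) (c : 'S_n -> F) :
  \sum_(x | wreath m x && P x) c x *: (Iwr m x : H) =
  \sum_(w | young m w && P w) c w *: gIw vF w +
  \sum_(w | young m w && P (w * t1 m)%g) c (w * t1 m)%g *: (gIw vF w * gb1).
Proof.
rewrite big_wreath; congr (_ + _); apply: eq_bigr => w /andP[hw _].
  by rewrite Iwr_young.
by rewrite Iwr_t1.
Qed.

Lemma sum_wreathT (c : 'S_n -> F) :
  \sum_(x | wreath m x) c x *: (Iwr m x : H) =
  \sum_(w | young m w) (c w *: gIw vF w + c (w * t1 m)%g *: (gIw vF w * gb1)).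
Proof.
apply: etrans (big_wreathT _) _; rewrite [RHS]big_split.
congr (_ + _); apply: eq_bigr => w hw; first by rewrite Iwr_young.
by rewrite Iwr_t1.
Qed.

(** An inversion of a Young element has both values in one block, and t_1 is increasing on each
    block. *)
Lemma ell_t1 w : young m w -> ell (w * t1 m)%g = (ell w + ell (t1 m))%N.
Proof.
move=> /youngP hw; apply: ell_mul_add => p r pr.
have := hw p; have := hw r; have := ltn_ord (w p); have := ltn_ord (w r).
rewrite -!pv_ord => hr hp er ep lt.
by rewrite !pv_t1 //; case: ifP; case: ifP; lia.
Qed.

Lemma bruhat_lt_t1 u w : young m w -> bruhat_lt u w -> bruhat_lt (u * t1 m)%g (w * t1 m)%g.
Proof.
move=> hw /andP[h1 h2]; rewrite /bruhat_lt bruhat_le_mul ?ell_t1 //=.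
by apply: contraNneq h2 => /mulIg ->.
Qed.

Notation Lau := (laurent vF).
Let LD := @laurentD vF (erefl vF).
Let LM := @laurentM vF.
Let LN := @laurentN vF.
Let L0 := laurent0 vF.
Let L1 := laurent1 vF.
Let Lv := laurentv (erefl vF).
Let LV := laurentV vF.
Let pY := young_parabolic m0.

Lemma young_mul_sref w i : (0 < i < n)%N -> (pv w^-1 i.-1 < pv w^-1 i)%N -> young m (w * sref n i)%g ->
  young m w /\ i != m.
Proof.
move=> hi hup hw; have [hw' hS] := proj2 pY _ _ hi hup hw; split=> //.
apply/eqP => e; rewrite e in hi hS; have := hS 1%g.
rewrite mul1g young1 => /youngP /(_ m).
by rewrite pv_srefr // ltnn prednK ?leqnn.
Qed.

Notation inA := (inHu m : H -> Prop).

Lemma inA_scale c y : Lau c -> inA y -> inA (c *: y).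
Proof. by move=> hc hy; apply: (Hu_scale m c y hc hy). Qed.

Lemma inA_mul y z : inA y -> inA z -> inA (y * z).
Proof. by move=> hy hz; rewrite -hmul_bridge; exact: (Hu_mul m y z hy hz). Qed.

Lemma inA_sub y z : inA y -> inA z -> inA (y - z).
Proof.
move=> hy hz; apply: (Hu_add m y (- z) hy).
by rewrite -scaleN1r; apply: inA_scale => //; apply: LN.
Qed.

Lemma inA_g i : (0 < i < n)%N -> i != m -> inA (g i).
Proof.
move=> hi im; rewrite gE //; apply: inA_scale; first exact: LV.
by apply: Hu_T => //; lia.
Qed.

Lemma inA_gi i : (0 < i < n)%N -> i != m -> inA (gi kap g i).
Proof.
move=> hi im; apply: inA_sub; first exact: inA_g.
apply: inA_scale; last exact: Hu_one.
exact: (Lau_kap LD LN Lv LV).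
Qed.

Lemma inA_gIw w : young m w -> inA (gIw vF w).
Proof.
elim/perm_ind: w => [|w i hi hup _ IH] hw; first by rewrite gIw1; apply: Hu_one.
have [hw' im] := young_mul_sref hi hup hw.
by rewrite -gIw_up //; apply: inA_mul; [apply: IH|apply: inA_g].
Qed.

Lemma inA_gbarI w : young m w -> inA (gbarI vF w).
Proof.
elim/perm_ind: w => [|w i hi hup hr IH] hw; first by rewrite gbarI1; apply: Hu_one.
have [hw' im] := young_mul_sref hi hup hw.
by rewrite gbarI_rcons //; apply: inA_mul; [apply: IH|apply: inA_gi].
Qed.

Lemma inA_hh : inA (hh m).
Proof.
have h := vX_neq0 (erefl vF) (m * n.-1).
have : inA (vF ^- (m * n.-1) *: (H1 m : H)).
  by apply: inA_scale; [apply: (LauVX LM L1 LV)|apply: Hu_H1].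
by rewrite H1_bridge // scalerA mulVf // scale1r.
Qed.

Lemma inA_gb1 : inA gb1.
Proof. by apply: inA_mul; [exact: inA_hh|apply: inA_gbarI; apply: young_w0hi]. Qed.

Lemma inA_Iwr x : wreath m x -> inA (Iwr m x).
Proof.
case/wreathP => [hx|[w hw ->]]; first by rewrite Iwr_young //; apply: inA_gIw.
by rewrite Iwr_t1 //; apply: inA_mul; [apply: inA_gIw|exact: inA_gb1].
Qed.

Notation wreath_span := (wreath_span (m := m) Lau : H -> Prop).

Lemma inA_wreath_span h : inA h -> wreath_span h.
Proof.
elim=> [i i1 i2 im||||c a hc _ ha|a b _ ha _ hb].
- have hi : (0 < i < n)%N by move: i1 i2 m0; clear; lia.
  have -> : T (sref n i) = vF ^+ ell (sref n i) *: gIw vF (sref n i) :> H by rewrite -T_gIw.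
  apply: wreath_spanZ => //; first exact: (LauX LM L1 _ Lv).
  apply: wreath_span_young => //; apply: (lat_gIw LM L0 L1 LV).
  by apply/youngP => x; apply: sref_ltm.
- rewrite H1_bridge //; apply: wreath_spanZ => //; first exact: (LauX LM L1 _ Lv).
  exact: (wreath_span_hh v0 m0 LD LM LN L0 L1 Lv LV).
- apply: wreath_span_young => //; exact: (lat1 LM L0 L1 LV (young1 m)).
- by move=> a b _ ha _ hb; apply: wreath_spanD.
- by apply: wreath_spanZ.
- by rewrite hmul_bridge; apply: (wreath_spanM v0 m0 LD LM LN L0 L1 Lv LV).
Qed.

Lemma wreath_span_sum h : wreath_span h -> exists c : 'S_n -> F, (forall x, Lau (c x)) /\
  h = \sum_(x | wreath m x) c x *: (Iwr m x : H).
Proof.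
move=> [a [b [ha hb ->]]].
pose c x := if young m x then a x * vF ^+ ell x
  else b (x * (t1 m)^-1)%g * vF ^+ ell (x * (t1 m)^-1)%g.
exists c; split=> [x|].
  by rewrite /c; case: ifP => _; [apply: (lat_coef LM L1 Lv _ ha)|apply: (lat_coef LM L1 Lv _ hb)].
apply/esym; apply: etrans (sum_wreathT c) _; rewrite big_split; congr (_ + _).
  by rewrite [RHS](lat_span v0 ha); apply: eq_bigr => w hw; rewrite /c hw.
rewrite [X in _ = X * _](lat_span v0 hb) mulr_suml; apply: eq_bigr => w hw.
by rewrite /c (negPf (young_t1 hw)) mulgK scalerAl.
Qed.

Lemma Iwr_independent (c : 'S_n -> F) : (forall x, Lau (c x)) ->
  \sum_(x | wreath m x) c x *: (Iwr m x : H) = 0 -> forall x, wreath m x -> c x = 0.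
Proof.
move=> hc rel.
have h := relation_trivial v0 m0 (v_sub1_neq0 (erefl vF)) LD LM LN L0 L1 Lv LV
  (laurent_div2 (erefl vF)) (laurent_sep (erefl vF)) hc (fun w => hc _)
  (etrans (esym (sum_wreathT c)) rel).
by move=> x /wreathP[hx|[w hw ->]]; [case: (h x hx)|case: (h w hw)].
Qed.

Lemma hbar_Iwr x : wreath m x -> exists c : 'S_n -> F, (forall u, Lau (c u)) /\
  hbar (Iwr m x) = (Iwr m x : H) +
    \sum_(u | wreath m u && bruhat_lt u x) c u *: (Iwr m u : H) :> H.
Proof.
case/wreathP => [hx|[w hw ->]].
  have hd := gbarI_lower v0 LD LM LN L0 L1 Lv LV pY hx.
  pose d := gbarI vF x - gIw vF x.
  exists (fun u => if young m u then d u * vF ^+ ell u else 0); split=> [u|].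
    by case: ifP => _; [apply: (lat_coef LM L1 Lv u hd)|exact: L0].
  rewrite hbar_bridge Iwr_young // bar_gIw // sum_wreath [X in _ + (_ + X)]big1 ?addr0.
    rewrite (eq_bigr (fun u => (d u * vF ^+ ell u) *: gIw vF u)) => [|u /andP[-> _]] //.
    by rewrite -(lat_span v0 hd) /d addrC subrK.
  by move=> u /andP[hu _]; rewrite (negPf (young_t1 hu)) scale0r.
have hd := gbarI_lower v0 LD LM LN L0 L1 Lv LV pY hw.
pose d := gbarI vF w - gIw vF w.
pose e u := d (u * (t1 m)^-1)%g * vF ^+ ell (u * (t1 m)^-1)%g.
exists (fun u => if young m u then 0 else e u); split=> [u|].
  by case: ifP => _; [exact: L0|apply: (lat_coef LM L1 Lv _ hd)].
rewrite hbar_bridge Iwr_t1 // (@barM _ _ m sigF v0 sigF_v) (@bar_gb1 _ _ m sigF v0 sigF_v) bar_gIw //.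
rewrite sum_wreath [X in _ + (X + _)]big1 ?add0r; last first.
  by move=> u /andP[-> _]; rewrite scale0r.
have E : d * gb1 = \sum_(u | young m u && bruhat_lt u w) (d u * vF ^+ ell u) *: (gIw vF u * gb1).
  by rewrite [in LHS](lat_span v0 (hd : lat Lau _ d)) mulr_suml; apply: eq_bigr => u _; rewrite scalerAl.
apply: etrans (mulr_sub_split _ (gIw vF w) _) _; congr (_ + _); apply: etrans E _.
apply: eq_sum_widen => u /andP[hu lt]; first by rewrite hu bruhat_lt_t1.
  by rewrite (negPf (young_t1 hu)) /e mulgK.
rewrite (negPf (young_t1 hu)) /e mulgK hu /= => nlt.
have -> : d u = 0 by apply: (proj2 hd); rewrite hu.
by rewrite mul0r scale0r.
Qed.

End Final.

Theorem theorem6p12 (m : nat) (hm : (1 <= m)%N) :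
  (* each I_x, x in Sigma_m wr Sigma_2, lies in A(m) *)
  (forall x : 'S_(m.*2), wreath m x -> inHu m (Iwr m x)) /\
  (* they are linearly independent over K = Z[v^{+-1}] *)
  (forall c : 'S_(m.*2) -> F, (forall x, isLaurent (c x)) ->
     \sum_(x : 'S_(m.*2) | wreath m x) c x *: Iwr m x = 0 ->
     forall x, wreath m x -> c x = 0) /\
  (* they span A(m) over K *)
  (forall h, inHu m h -> exists c : 'S_(m.*2) -> F, (forall x, isLaurent (c x)) /\
     h = \sum_(x : 'S_(m.*2) | wreath m x) c x *: Iwr m x) /\
  (* standard basis: bar(I_x) in I_x + sum_{y < x} Z[v^{+-1}] I_y *)
  (forall x : 'S_(m.*2), wreath m x ->
     exists c : 'S_(m.*2) -> F, (forall y, isLaurent (c y)) /\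
       hbar (Iwr m x) =
         Iwr m x + \sum_(y : 'S_(m.*2) | wreath m y && bruhat_lt y x) c y *: Iwr m y).
Proof.
split; first exact: inA_Iwr.
split; first exact: Iwr_independent.
split; last exact: hbar_Iwr.
by move=> h /(inA_wreath_span hm) /(wreath_span_sum hm).
Qed.
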